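(* Let $d\in\{2,3,5,6,7,10,11,13,14,15,17,19\}$, let $p$ be a prime, let $a,b\ge 0$ be integers, and let $A,B$ be integers with $AB\neq 0$, $A^2+dB^6=(2^a3^b)^p$ and $\gcd(A,B,2^a3^b)=1$. Then $p\le 3$ if $d=2$; $p\le 2$ if $d\in\{3,5,17\}$; $p\le 7$ if $d=7$; $p\le 5$ if $d=11$; $p\le 3$ if $d=15$; and for $d\in\{6,10,13,14,19\}$ no such $(A,B,a,b,p)$ exists. *)

(* Defs.v *)
From mathcomp Require Import all_boot all_order all_algebra.

(* Main.v *)
(* Valuations at 2 and 3 leave, besides p = 2, the equations A^2 + d B^6 = 3^n (d = 2, 5, 11, 14, 17)
   and A^2 + d B^6 = 2^n (d = 7, 15) with A, B coprime, for which the possible n are found as follows.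
   If n = 2k, the two factors q^k - A and q^k + A of d B^6 are sixth powers up to small
   coefficients, and the resulting equations c u^6 + e v^6 = q^j (or 2 q^j) are treated modulo 7, 9, 13,
   16, by factoring again, or (d = 17) by writing v^3 + q^j sqrt 2 as a unit multiple of a cube.
   If n is odd, A + q^m sqrt(q) or A + B^3 sqrt(-d) is a fixed element times a cube in
   Z[sqrt 3] or in the imaginary quadratic order.  For d = 2, 11 this yields from a solution with
   3 | n one with n / 3 in place of n, or an equation already solved, so the primes dividing n are
   bounded although n itself is not.
   For q = 2 what remains are curves such as A^2 = 8 c^6 - 7 B^6, with c a power of 2, whose right-hand
   side is a norm from a pure cubic field (th^3 = 7, 28 or 5).  There 2 c^2 - th B^2 is a square up to
   an explicit factor: Hermite reduction of a ternary form gives w^2 = alpha beta with beta in a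
   tiny box, and local conditions modulo 8 or 16 leave only explicit square classes of beta.
   Comparing coordinates of the square root then determines c. *)

Require Import Defs.
From Stdlib Require Import ZArith Znumtheory Zpow_facts Setoid Morphisms List Bool.
From Stdlib Require Import Reals Lia Lra Psatz.
Local Open Scope Z_scope.
#[local] Ltac Zify.zify_post_hook ::= Z.to_euclidean_division_equations.

(** Several of these equations have solutions, such as [79^2 + 5 * 2^6 = 3^8] and
    [181^2 + 7 = 2^15], so congruences alone cannot finish and every argument has to let the
    existing ones through. The exponent 6 is used twice: a sum [c u^6 + e v^6] of coprime terms is
    divisible by 9 only if [c + e] is, and [A^2 - 3 W^2 = -d (B^2)^3] displays a cube in the norm
    from [Z[sqrt 3]] whatever [n] is. In an imaginary order the norm is [q^n], and cubes appear
    through [n] modulo 3. In the cubic fields no class group or unit group is computed. For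
    [alpha = a - b th] of norm [A^2] the congruence [th = a / b] modulo [A] cuts out a lattice of
    index [|A|], and the square of each of its elements is a multiple of [alpha]. A short element
    gives a bounded quotient [beta]; the price is a finite list to sift. A square root of [alpha]
    has a square without [ph] coordinate, so its coordinates lie on a conic. Parametrizing it makes
    [c^2], up to a constant, a product such as [p (p^3 - 7 q^3)], and since [c] is a power of 2 the
    odd factor is almost a unit. *)

Ltac destruct_or H :=
  lazymatch type of H with
  | _ \/ _ => destruct H as [H | H]; destruct_or H
  | _ => idtac
  end.

(** * Coprime factors and residues *)

(** The root is [gcd a c]. Writing [a = a' g] and [c = c' g] leaves [a' b = g^(k-1) c'^k] with [a']
    coprime to [c'] and [g] coprime to [b], so [a'] and [g^(k-1)] divide each other. *)
Lemma rel_prime_mul_pow (a b c k : Z) :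
  0 < k -> rel_prime a b -> a * b = c ^ k -> exists d, 0 <= d /\ Z.abs a = d ^ k.
Proof.
  intros Hk Hab Habc.
  destruct (Z.eq_dec a 0) as [-> | Ha].
  { exists 0. rewrite Z.pow_0_l; lia. }
  set (g := Z.gcd a c).
  assert (Hg : 0 < g).
  { assert (g <> 0) by (unfold g; intros H; apply Z.gcd_eq_0_l in H; lia).
    pose proof (Z.gcd_nonneg a c). unfold g in *; lia. }
  destruct (Z.gcd_divide_l a c) as [a' Ha']. fold g in Ha'.
  destruct (Z.gcd_divide_r a c) as [c' Hc']. fold g in Hc'.
  assert (Hcop : rel_prime a' c').
  { apply Zgcd_1_rel_prime. apply (Z.mul_reg_r _ _ g); [lia|].
    rewrite <- (Z.abs_eq g) at 1 by lia.
    rewrite <- Z.gcd_mul_mono_r, <- Ha', <- Hc'. fold g. lia. }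
  assert (Hpow : g ^ k = g * g ^ (k - 1)).
  { replace k with (Z.succ (k - 1)) at 1 by lia. apply Z.pow_succ_r; lia. }
  assert (E : a' * b = g ^ (k - 1) * c' ^ k).
  { apply (Z.mul_reg_l _ _ g); [lia|].
    rewrite Z.mul_assoc, (Z.mul_comm g a'), <- Ha', Habc, Hc', Z.pow_mul_l, Hpow. ring. }
  assert (D1 : (a' | g ^ (k - 1))).
  { apply Gauss with (c' ^ k).
    - rewrite Z.mul_comm, <- E. apply Z.divide_factor_l.
    - apply rel_prime_Zpower_r; [lia | exact Hcop]. }
  assert (D2 : (g ^ (k - 1) | a')).
  { apply Gauss with b.
    - rewrite Z.mul_comm, E. apply Z.divide_factor_l.
    - apply rel_prime_sym, rel_prime_Zpower_r; [lia|]. apply rel_prime_sym.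
      apply rel_prime_div with a; [exact Hab|]. exists a'; lia. }
  exists g. split; [lia|].
  rewrite Hpow, Ha', Z.abs_mul, (Z.abs_eq g) by lia.
  rewrite Z.mul_comm. f_equal.
  apply Z.divide_antisym_nonneg; [lia | apply Z.pow_nonneg; lia | apply Z.divide_abs_l; exact D1 | apply Z.divide_abs_r; exact D2].
Qed.

Lemma rel_prime_mul_cube (a b c : Z) :
  rel_prime a b -> a * b = c ^ 3 -> exists d, a = d ^ 3.
Proof.
  intros Hab E. destruct (rel_prime_mul_pow a b c 3 ltac:(lia) Hab E) as (d & _ & Hd).
  destruct (Z.abs_spec a) as [[_ H] | [_ H]]; rewrite H in Hd.
  - exists d; lia.
  - exists (- d). lia.
Qed.

Lemma rel_prime_mul_sixth (a b c : Z) :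
  0 < a -> 0 < b -> rel_prime a b -> a * b = c ^ 6 ->
  exists u v, a = u ^ 6 /\ b = v ^ 6.
Proof.
  intros Ha Hb Hab E.
  destruct (rel_prime_mul_pow a b c 6 ltac:(lia) Hab E) as (u & _ & Hu).
  destruct (rel_prime_mul_pow b a c 6 ltac:(lia) (rel_prime_sym _ _ Hab) ltac:(lia)) as (v & _ & Hv).
  exists u, v. split; lia.
Qed.

Lemma prime_5 : prime 5.
Proof. apply prime_alt. split; [lia|]. intros n Hn [q Hq]. assert (n = 2 \/ n = 3 \/ n = 4) by lia. lia. Qed.

Lemma prime_7 : prime 7.
Proof.
  apply prime_alt. split; [lia|]. intros n Hn [q Hq].
  assert (n = 2 \/ n = 3 \/ n = 4 \/ n = 5 \/ n = 6) by lia. lia.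
Qed.

Lemma prime_17 : prime 17.
Proof.
  apply prime_alt. split; [lia|]. intros n Hn [q Hq].
  assert (H : n = 2 \/ n = 3 \/ n = 4 \/ n = 5 \/ n = 6 \/ n = 7 \/ n = 8 \/ n = 9 \/ n = 10
    \/ n = 11 \/ n = 12 \/ n = 13 \/ n = 14 \/ n = 15 \/ n = 16) by lia.
  repeat destruct H as [-> | H]; lia.
Qed.

Lemma prime_11 : prime 11.
Proof.
  apply prime_alt. split; [lia|]. intros n Hn [q Hq].
  assert (H : n = 2 \/ n = 3 \/ n = 4 \/ n = 5 \/ n = 6 \/ n = 7 \/ n = 8 \/ n = 9 \/ n = 10) by lia.
  repeat destruct H as [-> | H]; lia.
Qed.

(** * Congruences as a relation open to rewriting, and residues of powers *)

Definition eqmod (m a b : Z) : Prop := (m | a - b).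

#[local] Instance eqmod_equiv m : Equivalence (eqmod m).
Proof.
  split.
  - intros a. exists 0. lia.
  - intros a b [k H]. exists (- k). lia.
  - intros a b c [k H] [l G]. exists (k + l). lia.
Qed.

#[local] Instance eqmod_add m : Proper (eqmod m ==> eqmod m ==> eqmod m) Z.add.
Proof. intros a b [k H] c d [l G]. exists (k + l). lia. Qed.

#[local] Instance eqmod_sub m : Proper (eqmod m ==> eqmod m ==> eqmod m) Z.sub.
Proof. intros a b [k H] c d [l G]. exists (k - l). lia. Qed.

#[local] Instance eqmod_opp m : Proper (eqmod m ==> eqmod m) Z.opp.
Proof. intros a b [k H]. exists (- k). lia. Qed.

#[local] Instance eqmod_mul m : Proper (eqmod m ==> eqmod m ==> eqmod m) Z.mul.
Proof.
  intros a b [k H] c d [l G]. exists (k * c + b * l).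
  replace (a * c - b * d) with ((a - b) * c + b * (c - d)) by ring. rewrite H, G. ring.
Qed.

#[local] Instance eqmod_pow m : Proper (eqmod m ==> eq ==> eqmod m) Z.pow.
Proof.
  intros a b H n ? <-. destruct (Z.neg_nonneg_cases n) as [Hn | Hn].
  - rewrite !Z.pow_neg_r by lia. reflexivity.
  - revert n Hn. apply natlike_ind.
    + reflexivity.
    + intros n Hn IH. rewrite !Z.pow_succ_r by lia. rewrite IH, H. reflexivity.
Qed.

Lemma eqmod_mod m a : m <> 0 -> eqmod m a (a mod m).
Proof. intros Hm. exists (a / m). pose proof (Z.div_mod a m Hm). lia. Qed.

Lemma eqmod_0_divide m a : eqmod m a 0 -> (m | a).
Proof. unfold eqmod. rewrite Z.sub_0_r. exact (fun H => H). Qed.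

Lemma divide_eqmod_0 m a : (m | a) -> eqmod m a 0.
Proof. unfold eqmod. rewrite Z.sub_0_r. exact (fun H => H). Qed.

Lemma eqmod_iff m a b : m <> 0 -> (eqmod m a b <-> a mod m = b mod m).
Proof.
  intros Hm. split.
  - intros [k H]. replace a with (b + k * m) by lia. apply Z.mod_add; exact Hm.
  - intros H. rewrite (eqmod_mod m a Hm), (eqmod_mod m b Hm), H. reflexivity.
Qed.

Definition residues (m : Z) : list Z := map Z.of_nat (seq 0 (Z.to_nat m)).

Lemma mod_in_residues m a : 0 < m -> In (a mod m) (residues m).
Proof.
  intros Hm. apply in_map_iff. exists (Z.to_nat (a mod m)).
  pose proof (Z.mod_pos_bound a m Hm). split; [lia|].
  apply in_seq. lia.
Qed.

(* [f] is any function compatible with reduction mod [m]; the check is discharged by computation. *)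
Lemma residue_check1 (m : Z) (f : Z -> Z) (good : Z -> bool) :
  0 < m -> (forall a, eqmod m (f a) (f (a mod m))) ->
  forallb (fun a => good (f a mod m)) (residues m) = true ->
  forall a, good (f a mod m) = true.
Proof.
  intros Hm Hf Hall a.
  replace (f a mod m) with (f (a mod m) mod m)
    by (symmetry; apply eqmod_iff; [lia | apply Hf]).
  rewrite forallb_forall in Hall. exact (Hall _ (mod_in_residues m a Hm)).
Qed.

Ltac residue_lemma m f g :=
  let H := fresh in
  pose proof (fun a => residue_check1 m f g eq_refl
    ltac:(intros; cbv beta; apply eqmod_pow; [apply eqmod_mod; discriminate | reflexivity])
    ltac:(vm_compute; reflexivity) a) as H;
  cbv beta in H; intros x; specialize (H x); rewrite ?orb_true_iff, ?Z.eqb_eq in H; lia.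

Lemma sqr_mod7 : forall x, x ^ 2 mod 7 = 0 \/ x ^ 2 mod 7 = 1 \/ x ^ 2 mod 7 = 2 \/ x ^ 2 mod 7 = 4.
Proof. residue_lemma 7 (fun a => a ^ 2) (fun r => (r =? 0) || (r =? 1) || (r =? 2) || (r =? 4))%bool. Qed.

Lemma sixth_mod7 : forall x, x ^ 6 mod 7 = 0 \/ x ^ 6 mod 7 = 1.
Proof. residue_lemma 7 (fun a => a ^ 6) (fun r => (r =? 0) || (r =? 1))%bool. Qed.

Lemma sixth_mod9 : forall x, x ^ 6 mod 9 = 0 \/ x ^ 6 mod 9 = 1.
Proof. residue_lemma 9 (fun a => a ^ 6) (fun r => (r =? 0) || (r =? 1))%bool. Qed.

Lemma sixth_mod13 : forall x, x ^ 6 mod 13 = 0 \/ x ^ 6 mod 13 = 1 \/ x ^ 6 mod 13 = 12.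
Proof. residue_lemma 13 (fun a => a ^ 6) (fun r => (r =? 0) || (r =? 1) || (r =? 12))%bool. Qed.

Lemma cube_mod7 : forall x, x ^ 3 mod 7 = 0 \/ x ^ 3 mod 7 = 1 \/ x ^ 3 mod 7 = 6.
Proof. residue_lemma 7 (fun a => a ^ 3) (fun r => (r =? 0) || (r =? 1) || (r =? 6))%bool. Qed.

Lemma cube_mod13 : forall x,
  x ^ 3 mod 13 = 0 \/ x ^ 3 mod 13 = 1 \/ x ^ 3 mod 13 = 5 \/ x ^ 3 mod 13 = 8 \/ x ^ 3 mod 13 = 12.
Proof.
  residue_lemma 13 (fun a => a ^ 3)
    (fun r => (r =? 0) || (r =? 1) || (r =? 5) || (r =? 8) || (r =? 12))%bool.
Qed.

Lemma pow_mod_cycle (m q c k : Z) :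
  1 < m -> 0 < c -> 0 <= k -> q ^ c mod m = 1 -> q ^ k mod m = q ^ (k mod c) mod m.
Proof.
  intros Hm Hc Hk H.
  pose proof (Z.mod_pos_bound k c Hc). pose proof (Z.div_pos k c Hk Hc).
  rewrite (Z.div_mod k c) at 1 by lia.
  rewrite Z.pow_add_r, Z.pow_mul_r by lia.
  apply eqmod_iff; [lia|].
  assert (E : eqmod m (q ^ c) 1) by (apply eqmod_iff; [lia|]; rewrite H, Z.mod_1_l; lia).
  rewrite E, Z.pow_1_l, Z.mul_1_l by lia. reflexivity.
Qed.

Lemma pow3_mod7 k : 0 <= k ->
  k mod 6 = 0 /\ 3 ^ k mod 7 = 1 \/ k mod 6 = 1 /\ 3 ^ k mod 7 = 3 \/
  k mod 6 = 2 /\ 3 ^ k mod 7 = 2 \/ k mod 6 = 3 /\ 3 ^ k mod 7 = 6 \/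
  k mod 6 = 4 /\ 3 ^ k mod 7 = 4 \/ k mod 6 = 5 /\ 3 ^ k mod 7 = 5.
Proof.
  intros Hk. rewrite (pow_mod_cycle 7 3 6 k) by (reflexivity || lia).
  assert (H : k mod 6 = 0 \/ k mod 6 = 1 \/ k mod 6 = 2 \/ k mod 6 = 3 \/ k mod 6 = 4 \/ k mod 6 = 5) by lia.
  destruct_or H; rewrite H; cbn; lia.
Qed.

Lemma pow2_mod7 k : 0 <= k ->
  k mod 3 = 0 /\ 2 ^ k mod 7 = 1 \/ k mod 3 = 1 /\ 2 ^ k mod 7 = 2 \/ k mod 3 = 2 /\ 2 ^ k mod 7 = 4.
Proof.
  intros Hk. rewrite (pow_mod_cycle 7 2 3 k) by (reflexivity || lia).
  assert (H : k mod 3 = 0 \/ k mod 3 = 1 \/ k mod 3 = 2) by lia.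
  destruct_or H; rewrite H; cbn; lia.
Qed.

Lemma pow2_mod9 k : 0 <= k ->
  k mod 6 = 0 /\ 2 ^ k mod 9 = 1 \/ k mod 6 = 1 /\ 2 ^ k mod 9 = 2 \/
  k mod 6 = 2 /\ 2 ^ k mod 9 = 4 \/ k mod 6 = 3 /\ 2 ^ k mod 9 = 8 \/
  k mod 6 = 4 /\ 2 ^ k mod 9 = 7 \/ k mod 6 = 5 /\ 2 ^ k mod 9 = 5.
Proof.
  intros Hk. rewrite (pow_mod_cycle 9 2 6 k) by (reflexivity || lia).
  assert (H : k mod 6 = 0 \/ k mod 6 = 1 \/ k mod 6 = 2 \/ k mod 6 = 3 \/ k mod 6 = 4 \/ k mod 6 = 5) by lia.
  destruct_or H; rewrite H; cbn; lia.
Qed.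

Lemma pow3_mod13 k : 0 <= k ->
  k mod 3 = 0 /\ 3 ^ k mod 13 = 1 \/ k mod 3 = 1 /\ 3 ^ k mod 13 = 3 \/ k mod 3 = 2 /\ 3 ^ k mod 13 = 9.
Proof.
  intros Hk. rewrite (pow_mod_cycle 13 3 3 k) by (reflexivity || lia).
  assert (H : k mod 3 = 0 \/ k mod 3 = 1 \/ k mod 3 = 2) by lia.
  destruct_or H; rewrite H; cbn; lia.
Qed.

Lemma pow3_mod16 k : 0 <= k ->
  k mod 4 = 0 /\ 3 ^ k mod 16 = 1 \/ k mod 4 = 1 /\ 3 ^ k mod 16 = 3 \/
  k mod 4 = 2 /\ 3 ^ k mod 16 = 9 \/ k mod 4 = 3 /\ 3 ^ k mod 16 = 11.
Proof.
  intros Hk. rewrite (pow_mod_cycle 16 3 4 k) by (reflexivity || lia).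
  assert (H : k mod 4 = 0 \/ k mod 4 = 1 \/ k mod 4 = 2 \/ k mod 4 = 3) by lia.
  destruct_or H; rewrite H; cbn; lia.
Qed.

Lemma pow3_mod9 k : 2 <= k -> 3 ^ k mod 9 = 0.
Proof. intros Hk. replace k with (k - 2 + 2) by lia. rewrite Z.pow_add_r by lia. apply Z.mod_mul. lia. Qed.

(** * Quadratic orders of class number one *)

Lemma centered_residue (a b : Z) : a <> 0 -> exists k, Z.abs (b + 2 * a * k) <= Z.abs a.
Proof.
  intros Ha. destruct (Z.lt_ge_cases 0 a) as [H | H].
  - exists (- ((b + a) / (2 * a))).
    pose proof (Z.div_mod (b + a) (2 * a) ltac:(lia)).
    pose proof (Z.mod_pos_bound (b + a) (2 * a) ltac:(lia)). lia.
  - exists ((b - a) / (- 2 * a)).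
    pose proof (Z.div_mod (b - a) (- 2 * a) ltac:(lia)).
    pose proof (Z.mod_pos_bound (b - a) (- 2 * a) ltac:(lia)). lia.
Qed.

(** The discriminants of the maximal orders of the fields of [sqrt 2], [sqrt 3], [sqrt -2],
    [sqrt -7] and [sqrt -11]. For 12 the forms [x^2 - 3 y^2] and [3 y^2 - x^2] are inequivalent, so
    values and norms are tracked only up to sign. *)
Definition one_class_disc (D : Z) : Prop := D = 8 \/ D = 12 \/ D = -8 \/ D = -7 \/ D = -11.

(* Reduction theory: a reduced form has [3 a^2 <= |D|], which leaves [|a| = 1]. *)
Lemma form_represents_unit (D a b c : Z) :
  one_class_disc D -> b * b - 4 * a * c = D ->
  exists x y, Z.abs (a * x * x + b * x * y + c * y * y) = 1.
Proof.
  intros HD. remember (Z.to_nat (Z.abs a)) as n eqn:Hn.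
  revert a b c Hn. induction n as [n IH] using lt_wf_ind. intros a b c Hn E.
  assert (Ha : a <> 0).
  { intros ->. assert (-4 < b < 4) by (unfold one_class_disc in HD; nia).
    assert (Hb : b = -3 \/ b = -2 \/ b = -1 \/ b = 0 \/ b = 1 \/ b = 2 \/ b = 3) by lia.
    unfold one_class_disc in HD. destruct_or Hb; subst b; lia. }
  destruct (centered_residue a b Ha) as [k Hk].
  remember (b + 2 * a * k) as b' eqn:Hb'.
  remember (a * k * k + b * k + c) as c' eqn:Hc'.
  assert (E' : b' * b' - 4 * a * c' = D) by (subst b' c'; rewrite <- E; ring).
  assert (K : (exists x y, Z.abs (a * x * x + b' * x * y + c' * y * y) = 1) ->
    exists x y, Z.abs (a * x * x + b * x * y + c * y * y) = 1).
  { intros (x & y & H). exists (x + k * y), y. rewrite <- H. f_equal. subst b' c'. ring. }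
  apply K. clear K.
  destruct (Z.lt_ge_cases (Z.abs c') (Z.abs a)) as [Hlt | Hge].
  - destruct (IH (Z.to_nat (Z.abs c')) ltac:(lia) c' b' a eq_refl ltac:(lia)) as (x & y & H).
    exists y, x. rewrite <- H. f_equal. ring.
  (* Now [|b'| <= |a| <= |c'|]. The value [|a| = 2] passes the size bound only for [D = 12], where
     it would need [|c'| = 1]. *)
  - exists 1, 0. rewrite !Z.mul_0_r, !Z.mul_1_r, !Z.add_0_r.
    assert (Z.abs a <= 2 /\ Z.abs b' <= 2) as [H1 H2].
    { unfold one_class_disc in HD.
      assert (4 * Z.abs a * Z.abs c' <= Z.abs b' * Z.abs b' + 12).
      { rewrite <- Z.mul_assoc, <- !Z.abs_mul. lia. }
      split; nia. }
    assert (Ha2 : a = -2 \/ a = -1 \/ a = 1 \/ a = 2) by lia.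
    assert (Hb2 : b' = -2 \/ b' = -1 \/ b' = 0 \/ b' = 1 \/ b' = 2) by lia.
    unfold one_class_disc in HD.
    destruct_or Ha2; subst a; try reflexivity; destruct_or Hb2; subst b'; lia.
Qed.

(* Elements [x + y * om] of [Z[om]], where [om^2 = T * om - n0]; [disc = T^2 - 4 n0]. *)
Definition qmul1 (n0 x y x' y' : Z) : Z := x * x' - n0 * y * y'.
Definition qmul2 (T x y x' y' : Z) : Z := x * y' + y * x' + T * y * y'.
Definition qnorm (T n0 x y : Z) : Z := x * x + T * x * y + n0 * y * y.

(** [qcube1] and [qcube2] are the coordinates of [(g + h om)^3]. *)
Definition qcube1 (T n0 g h : Z) : Z := g ^ 3 - 3 * n0 * g * h ^ 2 - T * n0 * h ^ 3.
Definition qcube2 (T n0 g h : Z) : Z := 3 * g ^ 2 * h + 3 * T * g * h ^ 2 + (T * T - n0) * h ^ 3.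

Lemma qnorm_mul (T n0 x y x' y' : Z) :
  qnorm T n0 (qmul1 n0 x y x' y') (qmul2 T x y x' y') = qnorm T n0 x y * qnorm T n0 x' y'.
Proof. unfold qnorm, qmul1, qmul2. ring. Qed.

Lemma qnorm_cube (T n0 g h : Z) :
  qnorm T n0 (qcube1 T n0 g h) (qcube2 T n0 g h) = qnorm T n0 g h ^ 3.
Proof. unfold qnorm, qcube1, qcube2. ring. Qed.

Lemma invertible_mod (a m : Z) : rel_prime a m -> exists b, eqmod m (a * b) 1.
Proof.
  intros H. destruct (rel_prime_bezout a m H) as [u v E].
  exists u. exists (- v). lia.
Qed.

(* If [X + W om] generates [(rho) * I^3] with [I] of norm [U], then [I] is principal since the
   discriminant has one class; the norm form on [I], divided by [U], is [form_represents_unit]'s form. *)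
Lemma norm_eq_cube (T n0 X W U nu : Z) :
  one_class_disc (T * T - 4 * n0) -> U <> 0 ->
  rel_prime W U -> rel_prime (T * T - 4 * n0) U ->
  qnorm T n0 X W = nu * U ^ 3 ->
  exists P Q g h,
    Z.abs (qnorm T n0 g h) = Z.abs U /\ Z.abs (qnorm T n0 P Q) = Z.abs nu /\
    X = qmul1 n0 P Q (qcube1 T n0 g h) (qcube2 T n0 g h) /\
    W = qmul2 T P Q (qcube1 T n0 g h) (qcube2 T n0 g h).
Proof.
  intros HD HU HWU HDU HN.
  assert (HU3 : U ^ 3 <> 0) by (apply Z.pow_nonzero; lia).
  assert (HWU3 : rel_prime W (U ^ 3)) by (apply rel_prime_Zpower_r; [lia | exact HWU]).
  assert (HDU3 : rel_prime (T * T - 4 * n0) (U ^ 3)) by (apply rel_prime_Zpower_r; [lia | exact HDU]).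
  destruct (invertible_mod W (U ^ 3) HWU3) as [W' HW'].
  (* Sending [om] to [s] will be the ring homomorphism to the integers modulo [U ^ 3] that kills
     [X + W om]; this makes [s] a root of [om]'s polynomial there. *)
  set (s := - X * W').
  assert (Hs : eqmod (U ^ 3) (X + s * W) 0).
  { unfold s. replace (X + - X * W' * W) with (X * (1 - W * W')) by ring. rewrite HW'.
    rewrite Z.sub_diag, Z.mul_0_r. reflexivity. }
  assert (Hroot : eqmod (U ^ 3) (s * s - T * s + n0) 0).
  { assert (E : eqmod (U ^ 3) (W * W * (s * s - T * s + n0)) 0).
    { replace (W * W * (s * s - T * s + n0)) with
        ((X + s * W) * (s * W - X - T * W) + qnorm T n0 X W) by (unfold qnorm; ring).
      rewrite Hs, HN. exists nu. ring. }
    transitivity ((W * W') * (W * W') * (s * s - T * s + n0)).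
    - rewrite HW', !Z.mul_1_l. reflexivity.
    - replace (W * W' * (W * W') * (s * s - T * s + n0)) with
        (W' * W' * (W * W * (s * s - T * s + n0))) by ring.
      rewrite E, Z.mul_0_r. reflexivity. }
  apply eqmod_0_divide in Hroot. destruct Hroot as [r Hr].
  set (c := r * U ^ 2).
  assert (Hc : s * s - T * s + n0 = c * U) by (unfold c; rewrite Hr; ring).
  destruct (form_represents_unit (T * T - 4 * n0) U (T - 2 * s) c HD) as (x & y & Hxy).
  { replace (4 * U * c) with (4 * (c * U)) by ring. rewrite <- Hc. ring. }
  (* [g + y om = U x + y (om - s)] is an element of the ideal generated by [U] and [om - s], and the
     form is its norm divided by [U]. *)
  set (g := U * x - s * y).
  assert (Hgy : qnorm T n0 g y = U * (U * x * x + (T - 2 * s) * x * y + c * y * y)).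
  { transitivity (U * U * x * x + U * (T - 2 * s) * x * y + (s * s - T * s + n0) * y * y).
    - unfold qnorm, g. ring.
    - rewrite Hc. ring. }
  assert (Hnorm : Z.abs (qnorm T n0 g y) = Z.abs U) by (rewrite Hgy, Z.abs_mul, Hxy; lia).
  (* the conjugate of [g + y om] is [(g + T y) - y om] *)
  set (G := qcube1 T n0 (g + T * y) (- y)). set (H := qcube2 T n0 (g + T * y) (- y)).
  set (P := qmul1 n0 X W G H). set (Q := qmul2 T X W G H).
  (* [P + Q om] is [X + W om] times the cube of the conjugate of [g + y om]. It vanishes modulo
     [U ^ 3] at both roots: at [s] because [X + W om] does, at [T - s] because the conjugate takes
     the value [g + s y = U x] there. As [(T - 2 s)^2] is the discriminant modulo [U ^ 3], a unit,
     both [P] and [Q] are multiples of [U ^ 3]. *)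
  assert (E1 : eqmod (U ^ 3) (P + s * Q) 0).
  { replace (P + s * Q) with ((X + s * W) * (G + s * H) - (s * s - T * s + n0) * W * H)
      by (unfold P, Q, qmul1, qmul2; ring).
    rewrite Hs, Hr. exists (- (r * W * H)). ring. }
  assert (E2 : eqmod (U ^ 3) (P + (T - s) * Q) 0).
  { replace (P + (T - s) * Q) with
      ((X + (T - s) * W) * (G + (T - s) * H) - (s * s - T * s + n0) * W * H)
      by (unfold P, Q, qmul1, qmul2; ring).
    assert (K : exists e, G + (T - s) * H = (g + s * y) ^ 3 + (s * s - T * s + n0) * e).
    { exists (- (y ^ 2 * (3 * (g + T * y) - y * (2 * T - s)))).
      unfold G, H, qcube1, qcube2. ring. }
    destruct K as [e ->]. unfold g. rewrite Hr.
    exists ((X + (T - s) * W) * (x ^ 3 + r * e) - r * W * H). ring. }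
  assert (HQ : (U ^ 3 | Q)).
  { apply Gauss with (T * T - 4 * n0); [| apply rel_prime_sym; exact HDU3].
    apply eqmod_0_divide.
    replace ((T * T - 4 * n0) * Q) with
      ((T - 2 * s) * ((P + (T - s) * Q) - (P + s * Q)) - 4 * (s * s - T * s + n0) * Q) by ring.
    rewrite E1, E2, Hr. exists (- 4 * r * Q). ring. }
  assert (HP : (U ^ 3 | P)).
  { apply eqmod_0_divide. replace P with (P + s * Q - s * Q) by ring.
    apply divide_eqmod_0 in HQ. rewrite E1, HQ. rewrite Z.mul_0_r. reflexivity. }
  destruct HP as [P' HP]. destruct HQ as [Q' HQ].
  set (e := qnorm T n0 g y) in *.
  assert (He : exists f, e = f * U /\ (f = 1 \/ f = -1)).
  { exists (U * x * x + (T - 2 * s) * x * y + c * y * y). split; [rewrite Hgy; ring | lia]. }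
  destruct He as (f & He & Hf).
  assert (F1 : qmul1 n0 P Q (qcube1 T n0 g y) (qcube2 T n0 g y) = e ^ 3 * X)
    by (unfold P, Q, G, H, e, qmul1, qmul2, qcube1, qcube2, qnorm; ring).
  assert (F2 : qmul2 T P Q (qcube1 T n0 g y) (qcube2 T n0 g y) = e ^ 3 * W)
    by (unfold P, Q, G, H, e, qmul1, qmul2, qcube1, qcube2, qnorm; ring).
  assert (Hf3 : f ^ 3 = f) by (destruct Hf as [-> | ->]; reflexivity).
  assert (Hff : f * f = 1) by (destruct Hf as [-> | ->]; reflexivity).
  rewrite He, Z.pow_mul_l, Hf3 in F1, F2.
  assert (X1 : X = qmul1 n0 (f * P') (f * Q') (qcube1 T n0 g y) (qcube2 T n0 g y)).
  { apply (Z.mul_reg_l _ _ (U ^ 3) HU3).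
    transitivity (f * (f * U ^ 3 * X)); [rewrite !Z.mul_assoc, Hff; ring|].
    rewrite <- F1, HP, HQ. unfold qmul1. ring. }
  assert (W1 : W = qmul2 T (f * P') (f * Q') (qcube1 T n0 g y) (qcube2 T n0 g y)).
  { apply (Z.mul_reg_l _ _ (U ^ 3) HU3).
    transitivity (f * (f * U ^ 3 * W)); [rewrite !Z.mul_assoc, Hff; ring|].
    rewrite <- F2, HP, HQ. unfold qmul2. ring. }
  exists (f * P'), (f * Q'), g, y. split; [exact Hnorm|]. split; [| split; [exact X1 | exact W1]].
  assert (HN2 : qnorm T n0 X W = qnorm T n0 (f * P') (f * Q') * e ^ 3).
  { rewrite X1, W1, qnorm_mul, qnorm_cube. reflexivity. }
  apply (Z.mul_reg_r _ _ (Z.abs U ^ 3)); [apply Z.pow_nonzero; clear - HU; lia|].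
  rewrite <- Hnorm at 1. rewrite <- !Z.abs_pow, <- !Z.abs_mul, <- HN2, HN. reflexivity.
Qed.


(** * Hermite reduction of ternary forms *)

Definition vec : Type := (Z * Z * Z)%type.

Definition vadd (v : vec) (k : Z) (u : vec) : vec :=
  let '(x, y, z) := v in let '(x', y', z') := u in (x + k * x', y + k * y', z + k * z').

Definition det3 (u v w : vec) : Z :=
  let '(u1, u2, u3) := u in let '(v1, v2, v3) := v in let '(w1, w2, w3) := w in
  u1 * (v2 * w3 - v3 * w2) - u2 * (v1 * w3 - v3 * w1) + u3 * (v1 * w2 - v2 * w1).

Section Hermite.
Local Open Scope R_scope.

(** A decreasing real measure need not terminate, so every step has to gain a fixed factor; the
    number of steps is then bounded by the [N] with [(99/100)^N < c / f s0]. *)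
Lemma geometric_descent (S : Type) (P : S -> Prop) (f : S -> R) (c : R) (s0 : S) :
  0 < c -> P s0 ->
  (forall s, P s -> c < f s -> exists s', P s' /\ f s' <= 99 / 100 * f s) ->
  exists s, P s /\ f s <= c.
Proof.
  intros Hc HP step.
  assert (K : forall n s, P s -> f s * (99 / 100) ^ n <= c -> exists s', P s' /\ f s' <= c).
  { induction n as [|n IH]; intros s Hs Hn.
    - exists s. split; [exact Hs|]. simpl in Hn. lra.
    - destruct (Rle_lt_dec (f s) c) as [H | H]; [exists s; split; assumption|].
      destruct (step s Hs H) as (s' & Hs' & H').
      apply (IH s' Hs'). refine (Rle_trans _ _ _ _ Hn). simpl.
      assert (0 < (99 / 100) ^ n) by (apply pow_lt; lra). nra. }
  destruct (Rle_lt_dec (f s0) c) as [H | H]; [exists s0; split; assumption|].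
  destruct (pow_lt_1_zero (99 / 100)) with (y := c / f s0) as [N HN].
  - rewrite Rabs_pos_eq; lra.
  - apply Rdiv_lt_0_compat; lra.
  - apply (K N s0 HP). specialize (HN N (le_n N)).
    rewrite Rabs_pos_eq in HN by (apply pow_le; lra).
    apply Rlt_le. replace c with (f s0 * (c / f s0)) by (field; lra).
    apply Rmult_lt_compat_l; lra.
Qed.

Lemma centered_shift (a b : R) : 0 < a -> exists k : Z, (b + IZR k * a) ^ 2 <= a ^ 2 / 4.
Proof.
  intros Ha. exists (1 - up (b / a + 1 / 2))%Z.
  destruct (archimed (b / a + 1 / 2)) as [H1 H2].
  rewrite minus_IZR. set (n := IZR (up (b / a + 1 / 2))) in *.
  assert (E : b = b / a * a) by (field; lra). set (q := b / a) in *. rewrite E.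
  replace (q * a + (1 - n) * a) with ((q + 1 - n) * a) by ring.
  assert (- (1 / 2) <= q + 1 - n <= 1 / 2) by lra.
  assert ((q + 1 - n) ^ 2 <= 1 / 4) by nra.
  replace (((q + 1 - n) * a) ^ 2) with ((q + 1 - n) ^ 2 * (a ^ 2)) by ring.
  assert (0 < a ^ 2) by nra. nra.
Qed.

Variables a11 a22 a33 a12 a13 a23 : R.

Definition bil (u v : vec) : R :=
  let '(x, y, z) := u in let '(x', y', z') := v in
  IZR x * (a11 * IZR x' + a12 * IZR y' + a13 * IZR z') +
  IZR y * (a12 * IZR x' + a22 * IZR y' + a23 * IZR z') +
  IZR z * (a13 * IZR x' + a23 * IZR y' + a33 * IZR z').

Let F (u : vec) : R := bil u u.

Definition disc3 : R :=
  a11 * (a22 * a33 - a23 * a23) - a12 * (a12 * a33 - a23 * a13) + a13 * (a12 * a23 - a22 * a13).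

Lemma bil_sym u v : bil u v = bil v u.
Proof. destruct u as [[? ?] ?], v as [[? ?] ?]. unfold bil. ring. Qed.

Lemma bil_add u v k w : bil u (vadd v k w) = bil u v + IZR k * bil u w.
Proof.
  destruct u as [[? ?] ?], v as [[? ?] ?], w as [[? ?] ?]. unfold bil, vadd.
  rewrite !plus_IZR, !mult_IZR. ring.
Qed.

(** The left-hand side is the Gram determinant of [u], [v], [w]. *)
Lemma gram_det u v w :
  F u * (F v * F w - bil v w * bil v w) - bil u v * (bil u v * F w - bil v w * bil u w) +
  bil u w * (bil u v * bil v w - F v * bil u w) = disc3 * (IZR (det3 u v w)) ^ 2.
Proof.
  destruct u as [[? ?] ?], v as [[? ?] ?], w as [[? ?] ?]. unfold F, bil, disc3, det3.
  rewrite ?plus_IZR, ?minus_IZR, ?mult_IZR, ?plus_IZR, ?minus_IZR, ?mult_IZR. ring.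
Qed.

Definition is_basis (u v w : vec) : Prop := (det3 u v w * det3 u v w = 1)%Z.

(* Hermite's reduction: projecting orthogonally to [u], a short projected vector lifts to a vector
   shorter than [u] unless [u] is already within a factor [(4/3) disc3^(1/3)], relaxed to
   [2.5^(1/3) disc3^(1/3)] so that each step gains a fixed factor. *)
Lemma hermite_ternary (c : R) :
  0 < c -> disc3 <= 2 / 5 * c ^ 3 ->
  exists u, u <> (0, 0, 0)%Z /\ F u <= c.
Proof.
  intros Hc Hd.
  destruct (geometric_descent (vec * vec * vec) (fun b => is_basis (fst (fst b)) (snd (fst b)) (snd b))
    (fun b => F (fst (fst b))) c ((1, 0, 0), (0, 1, 0), (0, 0, 1))%Z) as ([[u v] w] & Hb & HF);
    [exact Hc | reflexivity | |].
  2:{ exists u. split; [|exact HF]. intros ->. destruct v as [[? ?] ?], w as [[? ?] ?].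
      unfold is_basis, det3 in Hb. simpl in Hb. lia. }
  intros [[u v] w] Hb Hu. cbn [fst snd] in *.
  set (a := F u) in *.
  assert (Ha : 0 < a) by lra.
  assert (Hda : disc3 <= 2 / 5 * a ^ 3).
  { apply (Rle_trans _ _ _ Hd). apply Rmult_le_compat_l; [lra|]. apply pow_incr. lra. }
  (* The binary form of the projections orthogonal to [u]. *)
  pose (g := fun x y : vec => bil x y - bil u x * bil u y / a).
  (* The threshold 74/100 serves both reductions: [1/4 + 74/100 = 99/100] is the factor gained by a
     step, and [(74/100)^3 > 2/5] bounds the contribution of the discriminant to the binary step. *)
  destruct (geometric_descent (vec * vec) (fun b => is_basis u (fst b) (snd b))
    (fun b => g (fst b) (fst b)) (74 / 100 * a) (v, w)) as ([v1 w1] & Hb1 & Hg1);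
    [lra | exact Hb | |].
  - intros [x y] Hxy Hgx. cbn [fst snd] in *.
    set (a2 := g x x) in *.
    assert (Ha2 : 0 < a2) by lra.
    destruct (centered_shift a2 (g x y) Ha2) as [k Hk].
    exists (vadd y k x, x). cbn [fst snd]. split.
    { unfold is_basis in *. rewrite <- Hxy. destruct u as [[? ?] ?], x as [[? ?] ?], y as [[? ?] ?].
      unfold det3, vadd. ring. }
    assert (Hdet : disc3 = a * (a2 * g y y - g x y ^ 2)).
    { pose proof (gram_det u x y) as G.
      replace (IZR (det3 u x y) ^ 2) with 1 in G
        by (simpl; rewrite Rmult_1_r, <- mult_IZR, Hxy; reflexivity).
      rewrite Rmult_1_r in G. rewrite <- G. fold a. unfold a2, g, F. field. lra. }
    assert (Hg : g (vadd y k x) (vadd y k x) = (g x y + IZR k * a2) ^ 2 / a2 + disc3 / (a * a2)).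
    { assert (Hx : bil x x = a2 + bil u x ^ 2 / a) by (unfold a2, g; field; lra).
      rewrite Hdet. unfold g.
      rewrite !bil_add, !(bil_sym (vadd y k x)), !bil_add, (bil_sym y x), Hx. field. lra. }
    rewrite Hg.
    assert (H1 : (g x y + IZR k * a2) ^ 2 / a2 <= a2 / 4).
    { apply Rmult_le_reg_r with a2; [lra|]. unfold Rdiv at 1. rewrite Rmult_assoc, Rinv_l by lra. nra. }
    assert (H2 : disc3 / (a * a2) <= 74 / 100 * a2).
    { apply Rmult_le_reg_r with (a * a2); [nra|].
      unfold Rdiv at 1. rewrite Rmult_assoc, Rinv_l by nra. rewrite Rmult_1_r.
      apply (Rle_trans _ _ _ Hda).
      replace (74 / 100 * a2 * (a * a2)) with (a * (74 / 100 * (a2 * a2))) by ring.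
      replace (2 / 5 * a ^ 3) with (a * (2 / 5 * (a * a))) by ring.
      apply Rmult_le_compat_l; [lra|]. nra. }
    lra.
  - cbn [fst snd] in *.
    destruct (centered_shift a (bil u v1) Ha) as [k Hk].
    exists (vadd v1 k u, u, w1). cbn [fst snd]. split.
    { unfold is_basis in *. rewrite <- Hb1. destruct u as [[? ?] ?], v1 as [[? ?] ?], w1 as [[? ?] ?].
      unfold det3, vadd. ring. }
    assert (E : F (vadd v1 k u) = g v1 v1 + (bil u v1 + IZR k * a) ^ 2 / a).
    { unfold F, g. rewrite bil_add, (bil_sym (vadd v1 k u) v1), (bil_sym (vadd v1 k u) u), !bil_add.
      rewrite (bil_sym v1 u). fold (F u). fold a. field. lra. }
    rewrite E.
    assert ((bil u v1 + IZR k * a) ^ 2 / a <= a / 4).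
    { apply Rmult_le_reg_r with a; [lra|]. unfold Rdiv at 1. rewrite Rmult_assoc, Rinv_l by lra. nra. }
    lra.
Qed.

End Hermite.

(** * Square roots in pure cubic rings *)

(* [(x, y, z)] stands for [x + y th + z ph], where [th^2 = e ph], [ph^2 = f th], [th ph = e f],
   so that [th^3 = e^2 f]. *)
Definition cmul (e f : Z) (u v : vec) : vec :=
  let '(x, y, z) := u in let '(x', y', z') := v in
  (x * x' + e * f * (y * z' + z * y'), x * y' + y * x' + f * z * z', x * z' + z * x' + e * y * y').

Definition cnorm (e f : Z) (u : vec) : Z :=
  let '(x, y, z) := u in x * x * x + e * e * f * (y * y * y) + e * f * f * (z * z * z) - 3 * e * f * x * y * z.

Lemma cnorm_mul e f u v : cnorm e f (cmul e f u v) = cnorm e f u * cnorm e f v.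
Proof. destruct u as [[x y] z], v as [[x' y'] z']. unfold cnorm, cmul. ring. Qed.

Lemma cmul_assoc e f u v w : cmul e f (cmul e f u v) w = cmul e f u (cmul e f v w).
Proof.
  destruct u as [[x y] z], v as [[x' y'] z'], w as [[x'' y''] z'']. unfold cmul.
  f_equal; [f_equal|]; ring.
Qed.

Lemma cmul_comm e f u v : cmul e f u v = cmul e f v u.
Proof.
  destruct u as [[x y] z], v as [[x' y'] z']. unfold cmul. f_equal; [f_equal|]; ring.
Qed.

Section RealEmbedding.
Local Open Scope R_scope.
Variables (e f : Z) (t s : R).
Hypotheses (Htt : t * t = IZR e * s) (Hss : s * s = IZR f * t) (Hts : t * s = IZR e * IZR f).

Definition val (u : vec) : R := let '(x, y, z) := u in IZR x + IZR y * t + IZR z * s.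

(* the squared modulus of the complex embedding *)
Definition cmod2 (u : vec) : R :=
  let '(x, y, z) := u in
  IZR x * IZR x + IZR e * s * (IZR y * IZR y) + IZR f * t * (IZR z * IZR z)
  - t * (IZR x * IZR y) - s * (IZR x * IZR z) - IZR e * IZR f * (IZR y * IZR z).

Ltac push_IZR := rewrite ?pow_IZR, ?minus_IZR, ?plus_IZR, ?mult_IZR, ?minus_IZR, ?plus_IZR, ?mult_IZR.

Lemma val_mul u v : val (cmul e f u v) = val u * val v.
Proof.
  destruct u as [[x y] z], v as [[x' y'] z']. unfold val, cmul. push_IZR.
  ring [Htt Hss Hts].
Qed.

Lemma cmod2_mul u v : cmod2 (cmul e f u v) = cmod2 u * cmod2 v.
Proof.
  destruct u as [[x y] z], v as [[x' y'] z']. unfold cmod2, cmul. push_IZR.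
  ring [Htt Hss Hts].
Qed.

Lemma val_cmod2 u : IZR (cnorm e f u) = val u * cmod2 u.
Proof.
  destruct u as [[x y] z]. unfold val, cmod2, cnorm. push_IZR.
  ring [Htt Hss Hts].
Qed.

(** One form written in three ways as a sum of squares. Each singles out one coordinate, and from
    each comes the bound on that coordinate of [beta]. *)
Lemma cmod2_four_x x y z :
  4 * cmod2 (x, y, z) =
    (2 * IZR x - IZR y * t - IZR z * s) ^ 2 + 3 * (IZR y * t - IZR z * s) ^ 2.
Proof. unfold cmod2. ring [Htt Hss Hts]. Qed.

Lemma cmod2_four_y x y z :
  4 * cmod2 (x, y, z) =
    (2 * (IZR y * t) - IZR x - IZR z * s) ^ 2 + 3 * (IZR x - IZR z * s) ^ 2.
Proof. unfold cmod2. ring [Htt Hss Hts]. Qed.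

Lemma cmod2_four_z x y z :
  4 * cmod2 (x, y, z) =
    (2 * (IZR z * s) - IZR x - IZR y * t) ^ 2 + 3 * (IZR x - IZR y * t) ^ 2.
Proof. unfold cmod2. ring [Htt Hss Hts]. Qed.

Lemma cmod2_nonneg u : 0 <= cmod2 u.
Proof.
  destruct u as [[x y] z]. pose proof (cmod2_four_x x y z).
  pose proof (pow2_ge_0 (2 * IZR x - IZR y * t - IZR z * s)).
  pose proof (pow2_ge_0 (IZR y * t - IZR z * s)). lra.
Qed.

(* Weighting the real and complex embeddings of [w] by those of [alpha = w^2 / beta] makes both
   embeddings of [beta] bounded, which takes care of ideal classes and units at the same time. *)
Lemma short_square_multiple (alpha : vec) (M r1 r2 : Z) (C : R) :
  (0 < M)%Z -> cnorm e f alpha = (M * M)%Z ->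
  0 < C -> 27 * (IZR e * IZR f) ^ 2 <= 2 / 5 * C ^ 3 ->
  (forall x y z, (M | x + r1 * y + r2 * z)%Z ->
     exists beta, cmul e f (x, y, z) (x, y, z) = cmul e f alpha beta) ->
  exists w P Q R,
    w <> (0, 0, 0)%Z /\ cmul e f w w = cmul e f alpha (P, Q, R) /\
    3 * Rabs (IZR P) <= C /\ 3 * Rabs (IZR Q * t) <= C /\ 3 * Rabs (IZR R * s) <= C.
Proof.
  intros HM HN HC HD Hdiv.
  pose proof (val_cmod2 alpha) as Hvm. rewrite HN, mult_IZR in Hvm.
  assert (HM' : 0 < IZR M) by (apply IZR_lt; lia).
  pose proof (cmod2_nonneg alpha) as Hn0.
  set (a := val alpha) in *. set (n := cmod2 alpha) in *.
  assert (Hn : 0 < n) by (destruct Hn0 as [H | H]; [exact H | rewrite <- H in Hvm; nra]).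
  assert (Ha : 0 < a) by nra.
  set (q := sqrt n). assert (Hq : 0 < q) by (apply sqrt_lt_R0; exact Hn).
  assert (Hqq : q * q = n) by (apply sqrt_sqrt; lra).
  (* coordinates on the lattice [M | x + r1 y + r2 z]: [x = M k - r1 y - r2 z] *)
  set (W := fun v : vec => let '(k, y, z) := v in ((M * k - r1 * y - r2 * z)%Z, y, z)).
  set (m := IZR M) in *. set (p1 := t - IZR r1). set (p2 := s - IZR r2).
  set (o1 := - t - 2 * IZR r1). set (o2 := - s - 2 * IZR r2).
  set (c1 := / a). set (c2 := / (2 * q)). set (c3 := 3 * / (2 * q)).
  (* The form is [val w ^ 2 / a + 2 * cmod2 w / q], with [cmod2] expanded by [cmod2_four_x], in the
     lattice coordinates [k, y, z]. Its discriminant is [27 (e f)^2 M^2 / (a n)], and [a n = M^2] by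
     the norm of [alpha], so it does not depend on [alpha]. *)
  destruct (hermite_ternary
    (c1 * m * m + c2 * (2 * m) * (2 * m))
    (c1 * p1 * p1 + c2 * o1 * o1 + c3 * t * t)
    (c1 * p2 * p2 + c2 * o2 * o2 + c3 * s * s)
    (c1 * m * p1 + c2 * (2 * m) * o1)
    (c1 * m * p2 + c2 * (2 * m) * o2)
    (c1 * p1 * p2 + c2 * o1 * o2 - c3 * t * s) C HC) as ([[k y] z] & Hne & HF).
  { refine (Rle_trans _ _ _ _ HD). apply Req_le. unfold disc3.
    transitivity (c1 * c2 * c3 * (m * (6 * (t * s))) ^ 2).
    - unfold p1, p2, o1, o2. ring.
    - rewrite Hts. unfold c1, c2, c3.
      transitivity (27 * (m * m) * (IZR e * IZR f) ^ 2 * (/ a * / (q * q))).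
      + field. lra.
      + rewrite Hqq, Hvm. field. lra. }
  set (w := W (k, y, z)).
  destruct (Hdiv (M * k - r1 * y - r2 * z)%Z y z) as [[[P Q] R] Hbeta].
  { exists k. ring. }
  change ((M * k - r1 * y - r2 * z)%Z, y, z) with w in Hbeta.
  exists w, P, Q, R.
  split.
  { intros Hw. apply Hne. unfold w, W in Hw. injection Hw as Hx -> ->.
    replace k with 0%Z; [reflexivity|]. nia. }
  split; [exact Hbeta|].
  assert (HFw : val w * val w / a + 2 * (cmod2 w / q) <= C).
  { refine (Rle_trans _ _ _ _ HF). apply Req_le.
    replace (cmod2 w) with (4 * cmod2 w / 4) by field.
    unfold w, W. rewrite cmod2_four_x. unfold val, bil. push_IZR. fold m.
    unfold c1, c2, c3, p1, p2, o1, o2. field. lra. }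
  assert (Hv2 : val w * val w = a * val (P, Q, R)) by (rewrite <- val_mul, Hbeta, val_mul; reflexivity).
  assert (Hm2 : cmod2 w * cmod2 w = n * cmod2 (P, Q, R))
    by (rewrite <- cmod2_mul, Hbeta, cmod2_mul; reflexivity).
  set (b := val (P, Q, R)) in *.
  assert (Eb : val w * val w / a = b) by (rewrite Hv2; field; lra).
  assert (Hb : 0 <= b) by (rewrite <- Eb; apply Rmult_le_pos; [nra | left; apply Rinv_0_lt_compat; lra]).
  set (d := cmod2 w / q) in *.
  assert (Hd : 0 <= d)
    by (apply Rmult_le_pos; [apply cmod2_nonneg | left; apply Rinv_0_lt_compat; lra]).
  assert (Edd : d * d = cmod2 (P, Q, R)).
  { unfold d. transitivity (cmod2 w * cmod2 w / (q * q)); [field; lra|].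
    rewrite Hm2, Hqq. field. lra. }
  rewrite Eb in HFw.
  (* Here [b + 2 d <= C], where [b] and [d] are the absolute values of [beta] at the two embeddings.
     Then [3 P = b + (2 P - Q t - R s)] with a bracket of size at most [2 d], and likewise for [Q t]
     and [R s]. *)
  assert (Hsq : forall h, h ^ 2 <= 4 * (d * d) -> - (2 * d) <= h <= 2 * d) by (intros h Hh; split; nra).
  assert (Hbe : b = IZR P + IZR Q * t + IZR R * s) by reflexivity.
  rewrite Edd in Hsq.
  split; [|split].
  - destruct (Hsq (2 * IZR P - IZR Q * t - IZR R * s)).
    { rewrite cmod2_four_x. pose proof (pow2_ge_0 (IZR Q * t - IZR R * s)). lra. }
    unfold Rabs. destruct (Rcase_abs (IZR P)); lra.
  - destruct (Hsq (2 * (IZR Q * t) - IZR P - IZR R * s)).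
    { rewrite cmod2_four_y. pose proof (pow2_ge_0 (IZR P - IZR R * s)). lra. }
    unfold Rabs. destruct (Rcase_abs (IZR Q * t)); lra.
  - destruct (Hsq (2 * (IZR R * s) - IZR P - IZR Q * t)).
    { rewrite cmod2_four_z. pose proof (pow2_ge_0 (IZR P - IZR Q * t)). lra. }
    unfold Rabs. destruct (Rcase_abs (IZR R * s)); lra.
Qed.

End RealEmbedding.

Lemma square_quotient (n M k : Z) : M <> 0 -> n * (M * M) = k * k -> exists m, n = m * m.
Proof.
  intros HM E. set (g := Z.gcd M k).
  assert (Hg : g <> 0) by (intros H; apply Z.gcd_eq_0_l in H; lia).
  destruct (Z.gcd_divide_l M k) as [M' HM']. destruct (Z.gcd_divide_r M k) as [k' Hk'].
  fold g in HM', Hk'.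
  assert (Hcop : rel_prime M' k').
  { apply Zgcd_1_rel_prime. apply (Z.mul_reg_r _ _ (Z.abs g)); [lia|].
    rewrite <- Z.gcd_mul_mono_r, <- HM', <- Hk'. fold g. pose proof (Z.gcd_nonneg M k). lia. }
  assert (E' : n * (M' * M') = k' * k').
  { apply (Z.mul_reg_l _ _ (g * g)); [nia|].
    transitivity (n * (M * M)); [rewrite HM'; ring | rewrite E, Hk'; ring]. }
  assert (D : (M' | k')).
  { apply Gauss with k'; [exists (n * M'); rewrite <- E'; ring | exact Hcop]. }
  assert (D1 : (M' | 1)).
  { destruct Hcop as [_ _ H]. apply H; [apply Z.divide_refl | exact D]. }
  apply Z.divide_1_r in D1. exists k'. destruct D1 as [-> | ->]; lia.
Qed.

Definition cadj (e f : Z) (u : vec) : vec :=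
  let '(x, y, z) := u in (x * x - e * f * (y * z), f * z * z - x * y, e * y * y - x * z).

Definition vscale (k : Z) (u : vec) : vec := let '(x, y, z) := u in (k * x, k * y, k * z).

Lemma cmul_cadj e f u : cmul e f u (cadj e f u) = vscale (cnorm e f u) (1, 0, 0).
Proof.
  destruct u as [[x y] z]. unfold cmul, cadj, cnorm, vscale. f_equal; [f_equal|]; ring.
Qed.

Lemma cmul_scale_r e f k u v : cmul e f u (vscale k v) = vscale k (cmul e f u v).
Proof.
  destruct u as [[x y] z], v as [[x' y'] z']. unfold cmul, vscale. f_equal; [f_equal|]; ring.
Qed.

Lemma cmul_1_r e f u : cmul e f u (1, 0, 0) = u.
Proof. destruct u as [[x y] z]. unfold cmul. f_equal; [f_equal|]; ring. Qed.

Lemma cmul_square e f u v :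
  cmul e f (cmul e f u v) (cmul e f u v) = cmul e f (cmul e f u u) (cmul e f v v).
Proof.
  rewrite !cmul_assoc. f_equal. rewrite <- !cmul_assoc, (cmul_comm e f v u). reflexivity.
Qed.

Lemma vscale_inj k u v : k <> 0 -> vscale k u = vscale k v -> u = v.
Proof.
  intros Hk. destruct u as [[x y] z], v as [[x' y'] z']. unfold vscale. intros E.
  injection E as E1 E2 E3.
  apply Z.mul_reg_l in E1, E2, E3; congruence.
Qed.

Lemma vscale_scale k l u : vscale k (vscale l u) = vscale (k * l) u.
Proof. destruct u as [[x y] z]. unfold vscale. f_equal; [f_equal|]; ring. Qed.

(** Multiplying the last two coordinate equations and eliminating [x^2] by the first gives
    [(y z)^2 = -8 (y z)^2]. *)
Lemma square_eq_0 e f w :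
  e * f <> 0 -> cmul e f w w = (0, 0, 0) -> w = (0, 0, 0).
Proof.
  destruct w as [[x y] z]. unfold cmul. intros Hef E. injection E as E1 E2 E3.
  assert (Y : y * z = 0).
  { assert (H : e * f * ((y * z) * (y * z)) = 4 * (x * x) * (y * z)).
    { transitivity ((- (e * y * y)) * (- (f * z * z))); [ring|].
      replace (- (e * y * y)) with (x * z + z * x) by lia.
      replace (- (f * z * z)) with (x * y + y * x) by lia. ring. }
    replace (x * x) with (- (2 * (e * f) * (y * z))) in H by lia.
    assert (H' : e * f * ((y * z) * (y * z)) = 0) by lia.
    apply Z.mul_eq_0_r in H'; [nia | exact Hef]. }
  rewrite (Z.mul_comm z y), Y in E1. assert (x = 0) by nia. subst x.
  assert (Hz : f * (z * z) = 0) by lia. assert (Hy : e * (y * y) = 0) by lia.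
  apply Z.mul_eq_0_r in Hz; [|lia]. apply Z.mul_eq_0_r in Hy; [|lia].
  assert (y = 0) by nia. assert (z = 0) by nia. subst. reflexivity.
Qed.

(** [t0] is a rational lower bound for the real cube root [th]. It replaces [th] in the bounds on
    [Q] and [R], which become inequalities between explicit rationals. *)
Lemma short_square_multiple_box (e f : Z) (alpha : vec) (M r1 r2 : Z) (C t0 : R) :
  0 < e -> 0 < f -> 0 < M -> cnorm e f alpha = M * M ->
  (0 < C)%R -> (27 * (IZR e * IZR f) ^ 2 <= 2 / 5 * C ^ 3)%R ->
  (0 < t0)%R -> (t0 ^ 3 <= IZR e * IZR e * IZR f)%R ->
  (forall x y z, (M | x + r1 * y + r2 * z) ->
     exists beta, cmul e f (x, y, z) (x, y, z) = cmul e f alpha beta) ->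
  exists w P Q R,
    cmul e f w w = cmul e f alpha (P, Q, R) /\ (P, Q, R) <> (0, 0, 0) /\
    (exists m, cnorm e f (P, Q, R) = m * m) /\
    (3 * Rabs (IZR P) <= C)%R /\ (3 * Rabs (IZR Q) * t0 <= C)%R /\
    (3 * Rabs (IZR R) * (t0 * t0) <= C * IZR e)%R.
Proof.
  intros He Hf HM HN HC HD Ht0 Ht03 Hdiv.
  assert (He' : (0 < IZR e)%R) by (apply IZR_lt; lia).
  assert (Hf' : (0 < IZR f)%R) by (apply IZR_lt; lia).
  set (T := (IZR e * IZR e * IZR f)%R).
  assert (HT : (0 < T)%R) by (apply Rmult_lt_0_compat; [apply Rmult_lt_0_compat|]; assumption).
  set (t := Rpower T (/ 3)).
  assert (Ht : (0 < t)%R) by apply exp_pos.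
  assert (Ht3 : (t ^ 3 = T)%R).
  { rewrite <- Rpower_pow by exact Ht. unfold t. rewrite Rpower_mult.
    replace (/ 3 * INR 3)%R with 1%R by (simpl; field). apply Rpower_1; exact HT. }
  set (s := (t * t / IZR e)%R).
  assert (Hs : (0 < s)%R) by (apply Rdiv_lt_0_compat; nra).
  assert (Htt : (t * t = IZR e * s)%R) by (unfold s; field; lra).
  assert (Hts : (t * s = IZR e * IZR f)%R).
  { unfold s. apply Rmult_eq_reg_r with (IZR e); [|lra].
    transitivity (t ^ 3)%R; [field; lra | rewrite Ht3; unfold T; ring]. }
  assert (Hss : (s * s = IZR f * t)%R).
  { apply Rmult_eq_reg_l with t; [|lra].
    transitivity (t * s * s)%R; [ring|]. rewrite Hts.
    transitivity (IZR f * (IZR e * s))%R; [ring|]. rewrite <- Htt. ring. }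
  assert (Hle : (t0 <= t)%R).
  { apply Rnot_lt_le. intros H. assert (t ^ 3 < t0 ^ 3)%R; [|fold T in Ht03; lra].
    assert (t * t < t0 * t0)%R by nra. simpl. rewrite !Rmult_1_r. nra. }
  destruct (short_square_multiple e f t s Htt Hss Hts alpha M r1 r2 C HM HN HC HD Hdiv)
    as (w & P & Q & R & Hw & Hsq & B1 & B2 & B3).
  exists w, P, Q, R.
  split; [exact Hsq|]. split.
  { intros E. apply Hw. apply (square_eq_0 e f); [nia|]. rewrite Hsq, E.
    destruct alpha as [[? ?] ?]. unfold cmul. f_equal; [f_equal|]; ring. }
  split.
  { apply (square_quotient _ M (cnorm e f w)); [lia|].
    rewrite <- cnorm_mul, Hsq, cnorm_mul, HN. ring. }
  split; [exact B1|]. split.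
  - refine (Rle_trans _ _ _ _ B2). rewrite Rabs_mult, (Rabs_pos_eq t) by lra.
    pose proof (Rabs_pos (IZR Q)). nra.
  - rewrite Rabs_mult, (Rabs_pos_eq s) in B3 by lra.
    apply (Rmult_le_compat_r (IZR e)) in B3; [|lra].
    refine (Rle_trans _ _ _ _ B3).
    replace (3 * (Rabs (IZR R) * s) * IZR e)%R with (3 * Rabs (IZR R) * (IZR e * s))%R by ring.
    rewrite <- Htt. apply Rmult_le_compat_l; [pose proof (Rabs_pos (IZR R)); lra | nra].
Qed.

Lemma IZR_abs_bound (n b : Z) : (Rabs (IZR n) < IZR (b + 1))%R -> - b <= n <= b.
Proof. rewrite <- abs_IZR. intros H. apply lt_IZR in H. lia. Qed.

(* With [alpha = a - b th] and [th = a / b] modulo [A], the hypothesis says that [w] vanishes. *)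
Lemma lattice_square (e f a b A x y z : Z) :
  rel_prime (e * b) A -> (A * A | cnorm e f (a, - b, 0)) ->
  (A | e * b * b * x + e * a * b * y + a * a * z) ->
  exists g, cmul e f (cmul e f (x, y, z) (x, y, z)) (cadj e f (a, - b, 0)) = vscale (A * A) g.
Proof.
  intros Hcop [N HN] [l HL].
  assert (Hcop2 : rel_prime (A * A) (e * e * (b * b * (b * b)))).
  { assert (K : rel_prime (A * A) (e * b)) by (apply rel_prime_sym, rel_prime_mult; exact Hcop).
    assert (Kb : rel_prime (A * A) b).
    { apply rel_prime_sym. apply rel_prime_div with (e * b); [apply rel_prime_sym; exact K|]. exists e; ring. }
    replace (e * e * (b * b * (b * b))) with ((e * b) * (e * b) * (b * b)) by ring.
    apply rel_prime_mult; apply rel_prime_mult; assumption. }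
  set (k1 := - (e * b * y) - z * a). set (k2 := - z * b).
  set (L := l * A).
  pose proof (cmul_cadj e f (a, - b, 0)) as Hadj.
  (* e b^2 w = L + alpha kappa *)
  assert (Hw : vscale (e * b * b) (x, y, z) =
    let '(m1, m2, m3) := cmul e f (a, - b, 0) (k1, k2, 0) in (L + m1, m2, m3)).
  { unfold L. rewrite <- HL. unfold vscale, cmul, k1, k2. f_equal; [f_equal|]; ring. }
  assert (D : forall m c, e * e * (b * b * (b * b)) * m = A * A * c -> (A * A | m)).
  { intros m c E. apply Gauss with (e * e * (b * b * (b * b))); [rewrite E; apply Z.divide_factor_l | exact Hcop2]. }
  set (W := cmul e f (cmul e f (x, y, z) (x, y, z)) (cadj e f (a, - b, 0))).
  (* If [w] stands for [L + alpha kappa], then [w^2 adj(alpha) = L^2 adj(alpha) + N(alpha) (2 L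
     kappa + alpha kappa^2)], and [A^2] divides both [L^2] and [N(alpha)]. The scalar in front is
     coprime to [A]. *)
  assert (E : exists c1 c2 c3, vscale (e * e * (b * b * (b * b))) W = vscale (A * A) (c1, c2, c3)).
  { assert (E1 : vscale (e * e * (b * b * (b * b))) W =
      let '(q1, q2, q3) := cmul e f (2 * L * k1, 2 * L * k2, 0) (1, 0, 0) in
      let '(s1, s2, s3) := cmul e f (a, - b, 0) (cmul e f (k1, k2, 0) (k1, k2, 0)) in
      let '(j1, j2, j3) := cadj e f (a, - b, 0) in
      (L * L * j1 + cnorm e f (a, - b, 0) * (q1 + s1),
       L * L * j2 + cnorm e f (a, - b, 0) * (q2 + s2),
       L * L * j3 + cnorm e f (a, - b, 0) * (q3 + s3))).
    { unfold W, L. rewrite <- HL. unfold vscale, cmul, cadj, cnorm, k1, k2. f_equal; [f_equal|]; ring. }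
    rewrite E1, HN. unfold L.
    destruct (cmul e f (2 * (l * A) * k1, 2 * (l * A) * k2, 0) (1, 0, 0)) as [[q1 q2] q3].
    destruct (cmul e f (a, - b, 0) (cmul e f (k1, k2, 0) (k1, k2, 0))) as [[s1 s2] s3].
    destruct (cadj e f (a, - b, 0)) as [[j1 j2] j3].
    exists (l * l * j1 + N * (q1 + s1)), (l * l * j2 + N * (q2 + s2)), (l * l * j3 + N * (q3 + s3)).
    unfold vscale. f_equal; [f_equal|]; ring. }
  destruct E as (c1 & c2 & c3 & E). destruct W as [[m1 m2] m3].
  unfold vscale in E. injection E as E1 E2 E3.
  destruct (D _ _ E1) as [g1 ->]. destruct (D _ _ E2) as [g2 ->]. destruct (D _ _ E3) as [g3 ->].
  exists (g1, g2, g3). unfold vscale. f_equal; [f_equal|]; ring.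
Qed.

(** * Finite search for the quotient beta, and divisibility of square roots *)

Definition vmod (q : Z) (u : vec) : vec := let '(x, y, z) := u in (x mod q, y mod q, z mod q).

Definition veqb (u v : vec) : bool :=
  let '(x, y, z) := u in let '(x', y', z') := v in (x =? x') && (y =? y') && (z =? z').

Lemma veqb_eq u v : veqb u v = true <-> u = v.
Proof.
  destruct u as [[x y] z], v as [[x' y'] z']. unfold veqb.
  rewrite !andb_true_iff, !Z.eqb_eq. split; [intros [[-> ->] ->]; reflexivity | intros E; injection E; auto].
Qed.

Lemma vmod_cmul e f q u v : q <> 0 -> vmod q (cmul e f u v) = vmod q (cmul e f (vmod q u) (vmod q v)).
Proof.
  intros Hq. destruct u as [[x y] z], v as [[x' y'] z']. unfold vmod, cmul.
  f_equal; [f_equal|]; apply eqmod_iff; try assumption;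
    rewrite <- !(eqmod_mod q _ Hq); reflexivity.
Qed.

Definition residue_vecs (q : Z) : list vec := list_prod (list_prod (residues q) (residues q)) (residues q).

Lemma vmod_in_residue_vecs q u : 0 < q -> In (vmod q u) (residue_vecs q).
Proof.
  intros Hq. destruct u as [[x y] z]. unfold vmod, residue_vecs.
  repeat apply in_prod; apply mod_in_residues; exact Hq.
Qed.

(** Roots modulo [q / 2] are enough when 4 divides [q]: [(w + (q/2) v)^2 = w^2 + q w v + (q^2/4)
    v^2]. This cuts the search by a factor of 8. *)
Definition is_square_mod (e f q : Z) (v : vec) : bool :=
  existsb (fun w => veqb (vmod q v) (vmod q (cmul e f w w))) (residue_vecs (q / 2)).

Lemma is_square_mod_true e f q v w :
  0 < q -> (4 | q) -> vmod q v = vmod q (cmul e f w w) -> is_square_mod e f q v = true.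
Proof.
  intros Hq [h Hh] H. apply existsb_exists. exists (vmod (q / 2) w).
  assert (E : q / 2 = 2 * h) by (rewrite Hh; replace (h * 4) with (2 * h * 2) by ring; apply Z.div_mul; discriminate).
  split; [apply vmod_in_residue_vecs; lia|].
  apply veqb_eq. rewrite H, E. clear E H. destruct w as [[x y] z]. unfold vmod, cmul.
  assert (D : forall n, exists k, n = n mod (2 * h) + 2 * h * k).
  { intros n. exists (n / (2 * h)). pose proof (Z.div_mod n (2 * h) ltac:(lia)). clear - H. lia. }
  destruct (D x) as [k1 Hx], (D y) as [k2 Hy], (D z) as [k3 Hz].
  set (x0 := x mod (2 * h)) in *. set (y0 := y mod (2 * h)) in *. set (z0 := z mod (2 * h)) in *.
  clearbody x0 y0 z0. subst x y z.
  f_equal; [f_equal|]; (apply eqmod_iff; [clear - Hq; lia|]); rewrite Hh.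
  - exists (x0 * k1 + h * k1 * k1 + e * f * (y0 * k3 + k2 * z0 + 2 * h * k2 * k3)). ring.
  - exists (x0 * k2 + k1 * y0 + 2 * h * k1 * k2 + f * (z0 * k3 + h * k3 * k3)). ring.
  - exists (x0 * k3 + k1 * z0 + 2 * h * k1 * k3 + e * (y0 * k2 + h * k2 * k2)). ring.
Qed.

Definition interval (b : Z) : list Z := map (fun i => i - b) (residues (2 * b + 1)).

Lemma in_interval b n : - b <= n <= b -> In n (interval b).
Proof.
  intros H. apply in_map_iff. exists (n + b). split; [lia|].
  rewrite <- (Z.mod_small (n + b) (2 * b + 1)) by lia. apply mod_in_residues. lia.
Qed.

(* The possible [beta] in the box: nonzero of square norm and such that [alpha beta] is a square
   modulo [q], where [alpha] is a square multiple of [ahat] modulo [q]. *)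
Definition candidates (e f q : Z) (ahat : vec) (b1 b2 b3 : Z) : list vec :=
  filter (fun v => is_square_mod e f q (cmul e f ahat v))
    (filter (fun v => negb (veqb v (0, 0, 0)) &&
        (Z.sqrt (cnorm e f v) * Z.sqrt (cnorm e f v) =? cnorm e f v))
      (list_prod (list_prod (interval b1) (interval b2)) (interval b3))).

Lemma in_candidates (e f q : Z) (alpha ahat : vec) (k b1 b2 b3 P Q R : Z) (w : vec) :
  0 < q -> (4 | q) -> rel_prime k q ->
  vmod q alpha = vmod q (vscale (k * k) ahat) ->
  cmul e f w w = cmul e f alpha (P, Q, R) -> (P, Q, R) <> (0, 0, 0) ->
  (exists m, cnorm e f (P, Q, R) = m * m) ->
  - b1 <= P <= b1 -> - b2 <= Q <= b2 -> - b3 <= R <= b3 ->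
  In (P, Q, R) (candidates e f q ahat b1 b2 b3).
Proof.
  intros Hq Hq4 Hk Ha Hw Hne [m Hm] H1 H2 H3.
  apply filter_In. split; [apply filter_In; split|].
  - repeat apply in_prod; apply in_interval; assumption.
  - apply andb_true_iff. split.
    + apply negb_true_iff. apply not_true_is_false. rewrite veqb_eq. exact Hne.
    + rewrite Hm, <- (Z.abs_square m), Z.sqrt_square by lia. apply Z.eqb_refl.
  - destruct (invertible_mod k q Hk) as [k' Hk'].
    apply (is_square_mod_true e f q _ (vscale k' w)); [exact Hq | exact Hq4 |].
    assert (E : cmul e f (vscale k' w) (vscale k' w) =
      cmul e f (vscale (k' * k') (1, 0, 0)) (cmul e f alpha (P, Q, R))).
    { rewrite <- Hw. destruct w as [[x y] z]. unfold cmul, vscale. f_equal; [f_equal|]; ring. }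
    rewrite E, <- cmul_assoc, (vmod_cmul _ _ _ (cmul _ _ _ alpha)) by lia.
    rewrite (vmod_cmul _ _ _ ahat) by lia. f_equal. f_equal.
    rewrite (vmod_cmul _ _ _ (vscale (k' * k') (1, 0, 0))), Ha, <- vmod_cmul by lia.
    destruct ahat as [[x y] z]. unfold vmod, vscale, cmul.
    assert (U : forall n, eqmod q n (k' * k' * (k * k * n))).
    { intros n. replace (k' * k' * (k * k * n)) with (k * k' * (k * k') * n) by ring.
      rewrite Hk'. rewrite !Z.mul_1_l. reflexivity. }
    f_equal; [f_equal|]; (apply eqmod_iff; [lia|]); etransitivity; try apply U;
      match goal with |- eqmod _ ?a ?b => replace b with a by ring; reflexivity end.
Qed.

(* Integral closedness of [Z[th, ph]] at [p], in the form needed to divide a square root. *)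
Definition square_closed_at (e f p : Z) : bool :=
  forallb (fun v => veqb (vmod p v) (0, 0, 0))
    (filter (fun v => veqb (vmod (p * p) (cmul e f v v)) (0, 0, 0)) (residue_vecs (p * p))).

Lemma divide_square_root (e f p : Z) (u v : vec) :
  0 < p -> square_closed_at e f p = true ->
  cmul e f v v = vscale (p * p) u -> exists v', cmul e f v' v' = u.
Proof.
  intros Hp Hc E. unfold square_closed_at in Hc. rewrite forallb_forall in Hc.
  specialize (Hc (vmod (p * p) v)).
  assert (Hp2 : 0 < p * p) by nia.
  assert (Hv : In (vmod (p * p) v)
    (filter (fun v => veqb (vmod (p * p) (cmul e f v v)) (0, 0, 0)) (residue_vecs (p * p)))).
  { apply filter_In. split; [apply vmod_in_residue_vecs; exact Hp2|].
    rewrite <- vmod_cmul, E by lia. apply veqb_eq. destruct u as [[x y] z]. unfold vmod, vscale.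
    rewrite !(Z.mul_comm (p * p)), !Z.mod_mul by lia. reflexivity. }
  specialize (Hc Hv).
- apply veqb_eq in Hc. destruct v as [[x y] z]. unfold vmod in Hc. injection Hc as H1 H2 H3.
    assert (K : forall n, (n mod (p * p)) mod p = 0 -> (p | n)).
    { intros n H. apply Z.mod_divide; [lia|].
      rewrite (Zmod_div_mod p (p * p)); [exact H | exact Hp | apply Z.mul_pos_pos; exact Hp |].
      apply Z.divide_factor_l. }
    destruct (K _ H1) as [x' ->]. destruct (K _ H2) as [y' ->]. destruct (K _ H3) as [z' ->].
    exists (x', y', z'). apply (vscale_inj (p * p)); [clear - Hp; nia|]. rewrite <- E.
    unfold cmul, vscale. f_equal; [f_equal|]; ring.
Qed.

(** * Explicit square roots for the cubic roots of 7, 28 and 5 *)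

Lemma vec_inj (x y z x' y' z' : Z) : (x, y, z) = (x', y', z') -> x = x' /\ y = y' /\ z = z'.
Proof. intros E. injection E. auto. Qed.

(** Divides the linear form by its leading coefficient [e b^2] modulo [A], to reach the shape
    [x + r1 y + r2 z] in which lattices enter [short_square_multiple]. *)
Lemma lattice_coordinates (e a b A : Z) :
  rel_prime (e * b) A ->
  exists j, forall x y z, (A | x + j * (e * a * b) * y + j * (a * a) * z) ->
    (A | e * b * b * x + e * a * b * y + a * a * z).
Proof.
  intros H.
  assert (Hb : rel_prime (e * b * b) A).
  { apply rel_prime_sym, rel_prime_mult; apply rel_prime_sym; [exact H|].
    apply rel_prime_div with (e * b); [exact H | exists e; ring]. }
  destruct (invertible_mod _ _ Hb) as [j Hj]. exists j. intros x y z D.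
  apply divide_eqmod_0 in D. apply eqmod_0_divide.
  transitivity (e * b * b * (x + j * (e * a * b) * y + j * (a * a) * z)).
  - replace (e * b * b * (x + j * (e * a * b) * y + j * (a * a) * z)) with
      (e * b * b * x + e * b * b * j * (e * a * b * y) + e * b * b * j * (a * a * z)) by ring.
    rewrite Hj, !Z.mul_1_l. reflexivity.
  - rewrite D, Z.mul_0_r. reflexivity.
Qed.

Lemma cadj_quotient (e f k m : Z) (alpha w g : vec) :
  m <> 0 -> cnorm e f alpha = m * k ->
  cmul e f (cmul e f w w) (cadj e f alpha) = vscale m g ->
  vscale k (cmul e f w w) = cmul e f alpha g.
Proof.
  intros Hm HN E. apply (vscale_inj m); [exact Hm|].
  rewrite <- (cmul_scale_r e f m alpha g), <- E, vscale_scale, <- HN.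
  rewrite (cmul_comm _ _ alpha), cmul_assoc, (cmul_comm _ _ (cadj _ _ _)), cmul_cadj, cmul_scale_r, cmul_1_r.
  reflexivity.
Qed.

(* If [w^2 = alpha sigma^2] then [w] times the adjoint of [sigma] is [cnorm sigma] times a root. *)
Lemma divide_out_square (e f n : Z) (alpha sigma w : vec) :
  cnorm e f sigma = n ->
  cmul e f w w = cmul e f alpha (cmul e f sigma sigma) ->
  exists v, cmul e f v v = vscale (n * n) alpha.
Proof.
  intros Hn E. exists (cmul e f w (cadj e f sigma)).
  rewrite cmul_square, E, cmul_assoc, <- cmul_square, cmul_cadj, Hn.
  destruct alpha as [[x y] z]. unfold cmul, vscale. f_equal; [f_equal|]; ring.
Qed.

(** The five [beta] that survive modulo 8 are [th^2], [(1 - th)^2], [1], [(1 + th)^2] and [4], all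
    squares. So [w] divided by a root of [beta] is the root sought, and closedness at 2 and 3
    removes the denominators, the norms of the roots being -6 and 8. *)
Lemma square_root_th7 (A B c : Z) :
  rel_prime A B -> A <> 0 -> B mod 2 = 1 -> c mod 2 = 0 ->
  A ^ 2 = 8 * c ^ 6 - 7 * B ^ 6 ->
  exists v, cmul 1 7 v v = (2 * c ^ 2, - B ^ 2, 0).
Proof.
  intros Hcop HA HB Hc E.
  set (a := 2 * c ^ 2). set (b := B ^ 2).
  assert (HN : cnorm 1 7 (a, - b, 0) = A * A).
  { unfold cnorm, a, b. transitivity (8 * c ^ 6 - 7 * B ^ 6); [ring | rewrite <- E; ring]. }
  assert (Hb : rel_prime (1 * b) A).
  { rewrite Z.mul_1_l. unfold b. apply rel_prime_sym, rel_prime_Zpower_r; [lia | exact Hcop]. }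
  destruct (lattice_coordinates 1 a b A Hb) as [j Hj].
  (* 149/10 is just above the cube root of [27 * 7^2 * 5/2], and 19/10 just below that of 7. *)
  destruct (short_square_multiple_box 1 7 (a, - b, 0) (Z.abs A) (j * (1 * a * b)) (j * (a * a)) (149 / 10) (19 / 10))
    as (w & P & Q & R & Hw & Hne & Hm & B1 & B2 & B3);
    [reflexivity | reflexivity | clear - HA; lia | | lra | lra | lra | lra | |].
  { rewrite HN. symmetry. apply Z.abs_square. }
  { intros x y z D. apply Z.divide_abs_l, Hj in D.
    destruct (lattice_square 1 7 a b A x y z Hb) as [g Hg]; [exists 1; rewrite HN; ring | exact D |].
    exists g. rewrite <- (cadj_quotient 1 7 1 (A * A) _ _ _ ltac:(clear - HA; nia) ltac:(rewrite HN; ring) Hg).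
    destruct (cmul 1 7 (x, y, z) (x, y, z)) as [[? ?] ?]. unfold vscale. f_equal; [f_equal|]; ring. }
  assert (HP : - 4 <= P <= 4) by (apply (IZR_abs_bound P 4); simpl; lra).
  assert (HQ : - 2 <= Q <= 2) by (apply (IZR_abs_bound Q 2); simpl; lra).
  assert (HR : - 1 <= R <= 1) by (apply (IZR_abs_bound R 1); simpl; lra).
  assert (Hin : In (P, Q, R) (candidates 1 7 8 (0, -1, 0) 4 2 1)).
  { apply (in_candidates 1 7 8 (a, - b, 0) (0, -1, 0) B 4 2 1 P Q R w); try assumption.
    - reflexivity.
    - exists 2; reflexivity.
    - change 8 with (2 ^ 3). apply rel_prime_Zpower_r; [discriminate|]. apply rel_prime_sym, prime_rel_prime; [exact prime_2|].
      intros D. apply Z.mod_divide in D; [congruence | discriminate].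
    - assert (Ha8 : (8 | a)).
      { unfold a. apply Z.mod_divide in Hc; [|discriminate]. destruct Hc as [c' ->]. exists (c' ^ 2). ring. }
      destruct Ha8 as [a' Ha8]. rewrite Ha8. unfold vmod, vscale, b.
      rewrite Z.mod_mul, !Z.mul_0_r by lia. f_equal. f_equal. f_equal. ring. }
  assert (Hlist : candidates 1 7 8 (0, -1, 0) 4 2 1 =
    (0, 0, 1) :: (1, -2, 1) :: (1, 0, 0) :: (1, 2, 1) :: (4, 0, 0) :: nil) by (vm_compute; reflexivity).
  rewrite Hlist in Hin. set (beta := (P, Q, R)) in *. clearbody beta. clear - Hin Hw.
  assert (C2 : square_closed_at 1 7 2 = true) by (vm_compute; reflexivity).
  assert (C3 : square_closed_at 1 7 3 = true) by (vm_compute; reflexivity).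
  destruct Hin as [<- | [<- | [<- | [<- | [<- | []]]]]].
  - (* beta = th^2: th divides w *)
    destruct w as [[x y] z].
    assert (Dx : (7 | x)).
    { unfold cmul in Hw. apply vec_inj in Hw as (E1 & _ & _).
      assert (D : (7 | x * x)) by (exists (- b - 2 * (y * z)); lia).
      apply prime_mult in D; [tauto | exact prime_7]. }
    destruct Dx as [x' ->]. exists (y, z, x').
    unfold cmul in Hw. apply vec_inj in Hw as (E1 & E2 & E3). unfold cmul. f_equal; [f_equal|]; lia.
  - destruct (divide_out_square 1 7 (-6) (a, - b, 0) (1, -1, 0) w eq_refl Hw) as [v Hv].
    destruct (divide_square_root 1 7 2 (vscale 9 (a, - b, 0)) v) as [v1 Hv1]; [lia | exact C2 | |].
    { rewrite Hv, vscale_scale. reflexivity. }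
    exact (divide_square_root 1 7 3 (a, - b, 0) v1 ltac:(lia) C3 Hv1).
  - exists w. rewrite Hw, cmul_1_r. reflexivity.
  - destruct (divide_out_square 1 7 8 (a, - b, 0) (1, 1, 0) w eq_refl Hw) as [v Hv].
    destruct (divide_square_root 1 7 2 (vscale 16 (a, - b, 0)) v) as [v1 Hv1]; [lia | exact C2 | |].
    { rewrite Hv, vscale_scale. reflexivity. }
    destruct (divide_square_root 1 7 2 (vscale 4 (a, - b, 0)) v1) as [v2 Hv2]; [lia | exact C2 | |].
    { rewrite Hv1, vscale_scale. reflexivity. }
    exact (divide_square_root 1 7 2 (a, - b, 0) v2 ltac:(lia) C2 Hv2).
  - apply (divide_square_root 1 7 2 (a, - b, 0) w); [lia | exact C2 |].
    rewrite Hw. unfold cmul, vscale. f_equal; [f_equal|]; ring.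
Qed.

(* Here [th^3 = 28] and [ph = th^2 / 2]. *)
Lemma square_root_th28 (A B c : Z) :
  rel_prime A B -> A mod 2 = 1 -> B mod 2 = 1 -> c mod 4 = 0 ->
  A ^ 2 = 2 * c ^ 6 - 7 * B ^ 6 ->
  exists v, cmul 2 7 v v = vscale 9 (2 * c ^ 2, - B ^ 2, 0).
Proof.
  intros Hcop HA HB Hc E.
  set (a := 2 * c ^ 2). set (b := B ^ 2).
  assert (HN : cnorm 2 7 (a, - b, 0) = (A * A) * 4).
  { unfold cnorm, a, b. transitivity (4 * (2 * c ^ 6 - 7 * B ^ 6)); [ring | rewrite <- E; ring]. }
  assert (HA2 : rel_prime 2 A).
  { apply prime_rel_prime; [exact prime_2|]. intros D. apply Z.mod_divide in D; [congruence | discriminate]. }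
  assert (Hb : rel_prime (2 * b) A).
  { apply rel_prime_sym, rel_prime_mult; [apply rel_prime_sym; exact HA2|].
    unfold b. apply rel_prime_Zpower_r; [lia | exact Hcop]. }
  destruct (lattice_coordinates 2 a b A Hb) as [j Hj].
  assert (Ha2 : exists a', a = 2 * a') by (exists (c ^ 2); reflexivity).
  (* The norm is [(2 A)^2], so the lattice has index [2 |A|]. The constant 2366/100 is just above
     the cube root of [27 * 14^2 * 5/2], and [3^3 < 28]. *)
  destruct (short_square_multiple_box 2 7 (a, - b, 0) (Z.abs (2 * A)) (j * (2 * a * b)) (j * (a * a)) (2366 / 100) 3)
    as (w & P & Q & R & Hw & Hne & Hm & B1 & B2 & B3);
    [reflexivity | reflexivity | clear - HA; lia | | lra | lra | lra | lra | |].
  { rewrite HN, Z.abs_square. ring. }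
  { intros x y z D. apply (proj1 (Z.divide_abs_l _ _)) in D.
    (* Since [a] is even, the part of the lattice condition modulo 2 says that [x] is even. Together
       with [a] even this makes [w^2 adj(alpha)] divisible by 4, which [lattice_square] does not
       provide. *)
    assert (Hx : exists x', x = 2 * x').
    { destruct D as [d Hd], Ha2 as [a' Ha']. rewrite Ha' in Hd.
      exists (d * A - j * (2 * a' * b) * y - 2 * j * (a' * a') * z).
      transitivity (d * (2 * A) - j * (2 * (2 * a') * b) * y - j * (2 * a' * (2 * a')) * z); [clear - Hd; lia | ring]. }
    assert (D' : (A | x + j * (2 * a * b) * y + j * (a * a) * z))
      by (apply Z.divide_trans with (2 * A); [exists 2; ring | exact D]).
    apply Hj in D'.
    destruct (lattice_square 2 7 a b A x y z Hb) as [g Hg]; [exists 4; rewrite HN; ring | exact D' |].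
    assert (H4 : exists g4, g = vscale 4 g4).
    { assert (K : forall m n, A * A * m = 4 * n -> exists k, m = 4 * k).
      { intros m n K. assert (D4 : (4 | m)); [|destruct D4 as [k ->]; exists k; ring].
        apply Gauss with (A * A); [exists n; rewrite K; ring|].
        replace (A * A) with (A ^ 2) by ring. change 4 with (2 ^ 2).
        apply rel_prime_Zpower; [lia | lia | exact HA2]. }
      destruct Hx as [x' ->], Ha2 as [a' Ha']. rewrite Ha' in Hg.
      destruct g as [[g1 g2] g3]. unfold cmul, cadj, vscale in Hg. apply vec_inj in Hg as (G1 & G2 & G3).
      set (X' := x' * x' + 7 * (y * z)). set (Y := 4 * x' * y + 7 * (z * z)).
      set (Z' := 2 * x' * z + y * y).
      destruct (K g1 (4 * a' * a' * X' + 7 * Y * b * b + 14 * a' * b * Z')) as [k1 ->];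
        [rewrite <- G1; unfold X', Y, Z'; ring|].
      destruct (K g2 (2 * X' * a' * b + a' * a' * Y + 7 * Z' * b * b)) as [k2 ->];
        [rewrite <- G2; unfold X', Y, Z'; ring|].
      destruct (K g3 (2 * X' * b * b + 2 * Z' * a' * a' + Y * a' * b)) as [k3 ->];
        [rewrite <- G3; unfold X', Y, Z'; ring|].
      exists (k1, k2, k3). reflexivity. }
    destruct H4 as [g4 ->]. exists g4. apply (vscale_inj 4); [lia|].
    transitivity (cmul 2 7 (a, - b, 0) (vscale 4 g4)); [| apply cmul_scale_r].
    apply (cadj_quotient 2 7 4 (A * A)); [clear - HA; nia | exact HN | exact Hg]. }
  assert (HP : - 7 <= P <= 7) by (apply (IZR_abs_bound P 7); simpl; lra).
  assert (HQ : - 2 <= Q <= 2) by (apply (IZR_abs_bound Q 2); simpl; lra).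
  assert (HR : - 1 <= R <= 1) by (apply (IZR_abs_bound R 1); simpl; lra).
  assert (Hin : In (P, Q, R) (candidates 2 7 16 (0, -1, 0) 7 2 1)).
  { apply (in_candidates 2 7 16 (a, - b, 0) (0, -1, 0) B 7 2 1 P Q R w); try assumption.
    - reflexivity.
    - exists 4; reflexivity.
    - change 16 with (2 ^ 4). apply rel_prime_Zpower_r; [discriminate|]. apply rel_prime_sym, prime_rel_prime; [exact prime_2|].
      intros D. apply Z.mod_divide in D; [congruence | discriminate].
    - assert (Ha16 : (16 | a)).
      { unfold a. apply Z.mod_divide in Hc; [|discriminate]. destruct Hc as [c' ->]. exists (2 * c' ^ 2). ring. }
      destruct Ha16 as [a' Ha16]. rewrite Ha16. unfold vmod, vscale, b.
      rewrite Z.mod_mul, !Z.mul_0_r by lia. f_equal. f_equal. f_equal. ring. }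
  assert (Hlist : candidates 2 7 16 (0, -1, 0) 7 2 1 = (-3, 1, 0) :: (1, 0, 0) :: (4, 0, 0) :: nil)
    by (vm_compute; reflexivity).
  rewrite Hlist in Hin. set (beta := (P, Q, R)) in *. clearbody beta. clear - Hin Hw.
  assert (C2 : square_closed_at 2 7 2 = true) by (vm_compute; reflexivity).
  (* As 28 is 1 modulo 9, the order has index 3 in the maximal order, and a factor 3 cannot always
     be divided out of a square root. The factor 9 of the conclusion keeps it. *)
  assert (K3 : forall v, cmul 2 7 v v = (a, - b, 0) ->
    exists v', cmul 2 7 v' v' = vscale 9 (a, - b, 0)).
  { intros v Hv. exists (vscale 3 v). rewrite <- Hv. destruct v as [[x y] z].
    unfold cmul, vscale. f_equal; [f_equal|]; ring. }
  destruct Hin as [<- | [<- | [<- | []]]].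
  - (* [beta = th - 3] is a unit, and [9 / beta = (5 + 2 th + ph)^2] *)
    exists (cmul 2 7 w (-5, -2, -1)).
    rewrite cmul_square, Hw, cmul_assoc. unfold cmul, vscale. f_equal; [f_equal|]; ring.
  - apply (K3 w). rewrite Hw, cmul_1_r. reflexivity.
  - destruct (divide_square_root 2 7 2 (a, - b, 0) w ltac:(lia) C2) as [v Hv]; [|exact (K3 v Hv)].
    rewrite Hw. unfold cmul, vscale. f_equal; [f_equal|]; ring.
Qed.

(** The norm of [2 c^2 - th u^2] is [3 v^6], not a square. The conditions modulo 3 make it divisible
    by [2 - th], an element of norm 3 with [(2 - th) (4 + 2 th + th^2) = 3], and the search applies
    to the quotient [alpha], of norm [v^6]. Undoing the division leaves the 3 of the conclusion. *)
Lemma square_root_th5 (c u v : Z) :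
  rel_prime u v -> v <> 0 -> u mod 2 = 1 -> c mod 2 = 0 -> u mod 3 <> 0 -> c mod 3 <> 0 -> v mod 3 <> 0 ->
  8 * c ^ 6 = 5 * u ^ 6 + 3 * v ^ 6 ->
  exists d, cmul 1 5 d d = vscale 3 (2 * c ^ 2, - u ^ 2, 0).
Proof.
  intros Hcop Hv0 Hu Hc Hu3 Hc3 Hv3 E.
  set (a := 2 * c ^ 2). set (b := u ^ 2). set (A := v ^ 3).
  assert (HA : A <> 0) by (apply Z.pow_nonzero; [exact Hv0 | discriminate]).
  assert (HN : cnorm 1 5 (a, - b, 0) = (A * A) * 3).
  { unfold cnorm, a, b, A. transitivity (8 * c ^ 6 - 5 * u ^ 6); [ring | rewrite E; ring]. }
  assert (Hb : rel_prime (1 * b) A).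
  { rewrite Z.mul_1_l. unfold b, A. apply rel_prime_Zpower; [lia | lia | exact Hcop]. }
  assert (HA3 : rel_prime 3 (A * A)).
  { replace (A * A) with (v ^ 6) by (unfold A; ring).
    apply rel_prime_Zpower_r; [lia|]. apply prime_rel_prime; [exact prime_3|].
    intros D. apply Z.mod_divide in D; [congruence | discriminate]. }
  assert (Hl : exists l, a = 2 * b + 3 * l).
  { assert (Hsq : forall n, n mod 3 <> 0 -> n ^ 2 mod 3 = 1).
    { intros n Hn. assert (Hn' : n mod 3 = 1 \/ n mod 3 = 2) by (clear - Hn; lia).
      rewrite <- Z.mod_pow_l. destruct Hn' as [-> | ->]; reflexivity. }
    pose proof (Hsq u Hu3) as H1. pose proof (Hsq c Hc3) as H2. fold b in H1.
    unfold a. clear - H1 H2. clearbody b. revert H2. generalize (c ^ 2). intros n H2.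
    exists ((2 * n - 2 * b) / 3). lia. }
  destruct Hl as [l Hl].
  (* alpha = (4 + 2 th + th^2) (a - b th) / 3 *)
  set (alpha := (b + 4 * l, 2 * l, l)).
  assert (Halpha : cmul 1 5 (4, 2, 1) (a, - b, 0) = vscale 3 alpha).
  { rewrite Hl. unfold cmul, vscale, alpha. f_equal; [f_equal|]; ring. }
  assert (HNa : cnorm 1 5 alpha = A * A).
  { assert (H : cnorm 1 5 (vscale 3 alpha) = 27 * (A * A)).
    { rewrite <- Halpha, cnorm_mul, HN. unfold cnorm. ring. }
    unfold cnorm, vscale, alpha in *. clear - H. lia. }
  destruct (lattice_coordinates 1 a b A Hb) as [j Hj].
  (* 1191/100 is just above the cube root of [27 * 5^2 * 5/2], and 17/10 just below that of 5. *)
  destruct (short_square_multiple_box 1 5 alpha (Z.abs A) (j * (1 * a * b)) (j * (a * a)) (1191 / 100) (17 / 10))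
    as (w & P & Q & R & Hw & Hne & Hm & B1 & B2 & B3);
    [reflexivity | reflexivity | clear - HA; lia | | lra | lra | lra | lra | |].
  { rewrite HNa. symmetry. apply Z.abs_square. }
  { intros x y z D. apply Z.divide_abs_l, Hj in D.
    destruct (lattice_square 1 5 a b A x y z Hb) as [g Hg]; [exists 3; rewrite HN; ring | exact D |].
    pose proof (cadj_quotient 1 5 3 (A * A) _ _ _ ltac:(clear - HA; nia) HN Hg) as Hg3.
    (* Because [2 - th] divides [a - b th], the product of [2 - th] with the adjoint of [a - b th]
       is divisible by 3. The same follows for [g], as 3 does not divide [A]. *)
    assert (H3 : exists h, cmul 1 5 g (2, -1, 0) = vscale 3 h).
    { assert (Hpi : exists h, cmul 1 5 (cadj 1 5 (a, - b, 0)) (2, -1, 0) = vscale 3 h).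
      { exists (b * b + 8 * (b * l) + 6 * (l * l), - (2 * (b * l)) - 3 * (l * l), - (b * l)).
        rewrite Hl. unfold cmul, cadj, vscale. f_equal; [f_equal|]; ring. }
      destruct Hpi as [h Hh].
      assert (EE : vscale (A * A) (cmul 1 5 g (2, -1, 0)) =
        vscale 3 (cmul 1 5 (cmul 1 5 (x, y, z) (x, y, z)) h)).
      { rewrite <- (cmul_scale_r 1 5 3), <- Hh, <- cmul_assoc, Hg.
        rewrite (cmul_comm 1 5 (vscale (A * A) g)), cmul_scale_r, (cmul_comm 1 5 g). reflexivity. }
      assert (K : forall m n, A * A * m = 3 * n -> exists k, m = 3 * k).
      { intros m n K. assert (D3 : (3 | m)); [|destruct D3 as [k ->]; exists k; ring].
        apply Gauss with (A * A); [exists n; rewrite K; ring | exact HA3]. }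
      destruct (cmul 1 5 g (2, -1, 0)) as [[g1 g2] g3].
      destruct (cmul 1 5 (cmul 1 5 (x, y, z) (x, y, z)) h) as [[n1 n2] n3].
      unfold vscale in EE. apply vec_inj in EE as (E1 & E2 & E3).
      destruct (K _ _ E1) as [k1 ->], (K _ _ E2) as [k2 ->], (K _ _ E3) as [k3 ->].
      exists (k1, k2, k3). reflexivity. }
    destruct H3 as [h Hh]. exists h.
    (* 9 alpha h = 3 alpha g (2 - th) = (4 + 2 th + th^2) (2 - th) (a - b th) g = 9 w^2 *)
    apply (vscale_inj 9); [lia|].
    transitivity (cmul 1 5 (vscale 3 alpha) (vscale 3 h)).
    2:{ destruct alpha as [[? ?] ?], h as [[? ?] ?]. unfold cmul, vscale. f_equal; [f_equal|]; ring. }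
    rewrite <- Hh, <- Halpha, cmul_assoc, <- (cmul_assoc _ _ (a, - b, 0)), <- Hg3.
    destruct (cmul 1 5 (x, y, z) (x, y, z)) as [[? ?] ?]. unfold cmul, vscale. f_equal; [f_equal|]; ring. }
  assert (HP : - 3 <= P <= 3) by (apply (IZR_abs_bound P 3); simpl; lra).
  assert (HQ : - 2 <= Q <= 2) by (apply (IZR_abs_bound Q 2); simpl; lra).
  assert (HR : - 1 <= R <= 1) by (apply (IZR_abs_bound R 1); simpl; lra).
  assert (Hin : In (P, Q, R) (candidates 1 5 8 (-15, -12, -6) 3 2 1)).
  { apply (in_candidates 1 5 8 alpha (-15, -12, -6) u 3 2 1 P Q R w); try assumption.
    - reflexivity.
    - exists 2; reflexivity.
    - change 8 with (2 ^ 3). apply rel_prime_Zpower_r; [discriminate|]. apply rel_prime_sym, prime_rel_prime; [exact prime_2|].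
      intros D. apply Z.mod_divide in D; [congruence | discriminate].
    - assert (Ha8 : (8 | a)).
      { unfold a. apply Z.mod_divide in Hc; [|discriminate]. destruct Hc as [c' ->]. exists (c' ^ 2). ring. }
      destruct Ha8 as [a' Ha8].
      (* 3 l = a - 2 b, so l = - 6 b modulo 8 *)
      assert (Hl8 : eqmod 8 l (- 6 * b)).
      { exists (3 * a' - l). rewrite Ha8 in Hl. clear - Hl. lia. }
      replace (u * u) with b by (unfold b; ring).
      unfold vmod, vscale, alpha. f_equal; [f_equal|]; (apply eqmod_iff; [lia|]); rewrite Hl8.
      + exists (- b). ring.
      + exists 0. ring.
      + exists 0. ring. }
  assert (Hlist : candidates 1 5 8 (-15, -12, -6) 3 2 1 = (-1, 1, 0) :: (1, 1, 1) :: nil)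
    by (vm_compute; reflexivity).
  rewrite Hlist in Hin. set (beta := (P, Q, R)) in *. clearbody beta. clear - Hin Hw Halpha.
  assert (C2 : square_closed_at 1 5 2 = true) by (vm_compute; reflexivity).
  assert (C3 : square_closed_at 1 5 3 = true) by (vm_compute; reflexivity).
  (* (4 + 2 th + th^2) beta = sigma^2, hence (3 w)^2 = 3 (a - b th) sigma^2 *)
  assert (K : forall tau sigma, cmul 1 5 w w = cmul 1 5 alpha tau ->
    cmul 1 5 (4, 2, 1) tau = cmul 1 5 sigma sigma ->
    cmul 1 5 (vscale 3 w) (vscale 3 w) = cmul 1 5 (vscale 3 (a, - b, 0)) (cmul 1 5 sigma sigma)).
  { intros tau sigma H1 H2. rewrite <- H2.
    transitivity (vscale 3 (cmul 1 5 (cmul 1 5 (4, 2, 1) (a, - b, 0)) tau)).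
    - rewrite Halpha. transitivity (vscale 9 (cmul 1 5 w w)).
      + destruct w as [[? ?] ?]. unfold cmul, vscale. f_equal; [f_equal|]; ring.
      + rewrite H1. destruct alpha as [[? ?] ?], tau as [[? ?] ?]. unfold cmul, vscale.
        f_equal; [f_equal|]; ring.
    - destruct tau as [[? ?] ?]. unfold cmul, vscale. f_equal; [f_equal|]; ring. }
  destruct Hin as [<- | [<- | []]].
  - destruct (divide_out_square 1 5 6 (vscale 3 (a, - b, 0)) (1, 1, 0) (vscale 3 w) eq_refl (K _ (1, 1, 0) Hw eq_refl)) as [d Hd].
    destruct (divide_square_root 1 5 2 (vscale 9 (vscale 3 (a, - b, 0))) d) as [d1 Hd1]; [lia | exact C2 | |].
    { rewrite Hd, !vscale_scale. reflexivity. }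
    exact (divide_square_root 1 5 3 _ d1 ltac:(lia) C3 Hd1).
  - destruct (divide_out_square 1 5 12 (vscale 3 (a, - b, 0)) (3, 1, 1) (vscale 3 w) eq_refl (K _ (3, 1, 1) Hw eq_refl)) as [d Hd].
    destruct (divide_square_root 1 5 2 (vscale 36 (vscale 3 (a, - b, 0))) d) as [d1 Hd1]; [lia | exact C2 | |].
    { rewrite Hd, !vscale_scale. reflexivity. }
    destruct (divide_square_root 1 5 2 (vscale 9 (vscale 3 (a, - b, 0))) d1) as [d2 Hd2]; [lia | exact C2 | |].
    { rewrite Hd1, !vscale_scale. reflexivity. }
    exact (divide_square_root 1 5 3 _ d2 ltac:(lia) C3 Hd2).
Qed.

Lemma odd_rel_prime_pow2 (x k : Z) : 0 <= k -> x mod 2 = 1 -> rel_prime x (2 ^ k).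
Proof.
  intros Hk Hx. apply rel_prime_Zpower_r; [exact Hk|].
  apply rel_prime_sym, prime_rel_prime; [exact prime_2|].
  intros D. apply Z.mod_divide in D; [congruence | discriminate].
Qed.

(** * Quadrics attached to the cubic square roots *)

Lemma odd_divide_pow2 (x m k : Z) : 0 <= k -> x mod 2 = 1 -> (x | m * 2 ^ k) -> (x | m).
Proof.
  intros Hk Hx D. apply Gauss with (2 ^ k); [rewrite Z.mul_comm; exact D|].
  apply odd_rel_prime_pow2; assumption.
Qed.

Lemma odd_divide_odd (x y : Z) : (x | y) -> y mod 2 = 1 -> x mod 2 = 1.
Proof.
  intros [k ->] H. rewrite <- Z.mul_mod_idemp_r in H by discriminate.
  assert (Hx : x mod 2 = 0 \/ x mod 2 = 1) by (clear; lia).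
  destruct Hx as [Hx | Hx]; [|exact Hx]. rewrite Hx, Z.mul_0_r in H. discriminate.
Qed.

Lemma divide_1_abs (x : Z) : (x | 1) -> x = 1 \/ x = -1.
Proof. apply Z.divide_1_r. Qed.

Lemma divide_3_cases (x : Z) : (x | 3) -> x = 1 \/ x = -1 \/ x = 3 \/ x = -3.
Proof. intros D. apply (prime_divisors 3 prime_3) in D. lia. Qed.

Lemma divide_9_cases (x : Z) : (x | 9) -> x = 1 \/ x = -1 \/ x = 3 \/ x = -3 \/ x = 9 \/ x = -9.
Proof.
  intros D.
  pose proof (Z.divide_pos_le x 9 ltac:(lia) D).
  pose proof (Z.divide_pos_le (- x) 9 ltac:(lia) (proj2 (Z.divide_opp_l x 9) D)).
  destruct D as [k Hk].
  assert (Hx : x = -9 \/ x = -8 \/ x = -7 \/ x = -6 \/ x = -5 \/ x = -4 \/ x = -3 \/ x = -2 \/ x = -1 \/ x = 0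
    \/ x = 1 \/ x = 2 \/ x = 3 \/ x = 4 \/ x = 5 \/ x = 6 \/ x = 7 \/ x = 8 \/ x = 9) by lia.
  destruct_or Hx; subst x; lia.
Qed.

Lemma rel_prime_opp_r (a b : Z) : rel_prime a b -> rel_prime a (- b).
Proof.
  intros [H1 H2 H3]. constructor; [exact H1 | apply Z.divide_opp_r; exact H2 |].
  intros d D1 D2. apply H3; [exact D1 | apply Z.divide_opp_r; exact D2].
Qed.

Lemma cone_parametrization (X Y Z : Z) :
  rel_prime X Z -> Y * Y = - (X * Z) ->
  exists p q t, (t = 1 \/ t = -1) /\ X = t * (p * p) /\ Y = t * (p * q) /\ Z = - t * (q * q).
Proof.
  intros H E.
  destruct (rel_prime_mul_pow X (- Z) Y 2) as (p & Hp0 & Hp);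
    [lia | apply rel_prime_opp_r; exact H | clear H; nia |].
  destruct (rel_prime_mul_pow (- Z) X Y 2) as (q & Hq0 & Hq);
    [lia | apply rel_prime_sym, rel_prime_opp_r; exact H | clear H Hp; nia |].
  rewrite Z.pow_2_r in Hp, Hq.
  assert (HXZ : X * Z <= 0) by nia.
  assert (HYY : Y * Y = (p * q) * (p * q)).
  { rewrite <- Z.abs_square, <- Z.abs_mul, E. transitivity (Z.abs X * Z.abs (- Z)).
    - rewrite <- Z.abs_mul. f_equal. ring.
    - rewrite Hp, Hq. ring. }
  assert (HY : Y = p * q \/ Y = - (p * q)).
  { assert (K : (Y - p * q) * (Y + p * q) = 0) by lia. apply Z.mul_eq_0 in K. lia. }
  assert (HXs : (X = p * p /\ Z = - (q * q)) \/ (X = - (p * p) /\ Z = q * q)).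
  { destruct (Z.abs_spec X) as [[HX EX] | [HX EX]]; rewrite EX in Hp;
    destruct (Z.abs_spec (- Z)) as [[HZ EZ] | [HZ EZ]]; rewrite EZ in Hq; clear - Hp Hq HX HZ HXZ; nia. }
  destruct HXs as [[-> ->] | [-> ->]], HY as [-> | ->].
  - exists p, q, 1. repeat split; ring || (left; reflexivity).
  - exists p, (- q), 1. repeat split; ring || (left; reflexivity).
  - exists p, (- q), (-1). repeat split; ring || (right; reflexivity).
  - exists p, q, (-1). repeat split; ring || (right; reflexivity).
Qed.

(** Serves to enclose a variable: instances at chosen integers are handed to [lia] together with
    linear information on the cube. *)
Lemma cube_mono (a b : Z) : a <= b -> a ^ 3 <= b ^ 3.
Proof.
  intros H. assert (E : b ^ 3 - a ^ 3 = (b - a) * (a * a + a * b + b * b)) by ring.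
  assert (0 <= a * a + a * b + b * b) by nia.
  assert (0 <= (b - a) * (a * a + a * b + b * b)) by (apply Z.mul_nonneg_nonneg; lia). lia.
Qed.

Lemma mul_pos_cases (a b : Z) : 0 < a * b -> (0 < a /\ 0 < b) \/ (a < 0 /\ b < 0).
Proof. intros H. apply Z.lt_0_mul in H. tauto. Qed.

Lemma odd_sqr_pos (B : Z) : B mod 2 = 1 -> 0 < B ^ 2.
Proof.
  intros H. assert (B <> 0) by (intros ->; discriminate). clear H. nia.
Qed.

Lemma rel_prime_intro (a b : Z) : (forall d, (d | a) -> (d | b) -> (d | 1)) -> rel_prime a b.
Proof. intros H. constructor; [apply Z.divide_1_l | apply Z.divide_1_l | exact H]. Qed.

(* The quadric of the case [alpha = v^2] of the descent in [Z[7^(1/3)]]. *)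
Lemma th7_quadrics (x y z B i : Z) :
  0 <= i -> B mod 2 = 1 ->
  cmul 1 7 (x, y, z) (x, y, z) = (2 * (2 ^ i) ^ 2, - B ^ 2, 0) -> 2 ^ i = 4.
Proof.
  intros Hi HB E. unfold cmul in E. apply vec_inj in E as (E1 & E2 & E3).
  set (c := 2 ^ i) in *.
  assert (Hc : 0 < c) by (apply Z.pow_pos_nonneg; lia).
  assert (Hcc : 2 * c ^ 2 = 1 * 2 ^ (2 * i + 1)).
  { rewrite Z.pow_add_r, Z.mul_comm, Z.mul_1_l by lia. f_equal. unfold c.
    rewrite <- Z.pow_mul_r by lia. f_equal. lia. }
  assert (Hz : z mod 2 = 1).
  { assert (HBB : B ^ 2 mod 2 = 1) by (rewrite <- Z.mod_pow_l, HB; reflexivity).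
    assert (Hzz : (z * z) mod 2 = 1) by (clear - E2 HBB; lia).
    apply (odd_divide_odd z (z * z)); [apply Z.divide_factor_l | exact Hzz]. }
  assert (Hy : (2 | y)).
  { assert (D : (2 | y * y)) by (exists (- (x * z)); clear - E3; lia).
    apply (prime_mult 2 prime_2) in D. tauto. }
  destruct Hy as [Y ->].
  assert (Hx : (2 | x)).
  { assert (D : (2 | x * z)) by (exists (- (Y * Y)); clear - E3; lia).
    apply (prime_mult 2 prime_2) in D. destruct D as [D | D]; [exact D|].
    apply Z.mod_divide in D; [congruence | discriminate]. }
  destruct Hx as [X ->].
  assert (Hcop : rel_prime X z).
  { apply rel_prime_intro. intros d [k1 D1] [k2 D2].
    apply (odd_divide_pow2 d 1 (2 * i + 1)); [clear - Hi; lia | apply (odd_divide_odd d z); [exists k2; exact D2 | exact Hz]|].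
    rewrite <- Hcc, <- E1. exists (4 * k1 * X + 28 * Y * k2). rewrite D1 at 1. rewrite D2. ring. }
  destruct (cone_parametrization X Y z Hcop) as (p & q & t & Ht & -> & -> & ->); [clear - E3; lia|].
  assert (Htt : t * t = 1) by (destruct Ht as [-> | ->]; reflexivity).
  assert (F1 : c ^ 2 = 2 * p * (p ^ 3 - 7 * q ^ 3)).
  { apply (Z.mul_reg_l _ _ 2); [lia|]. rewrite <- E1. transitivity (t * t * (2 * (2 * p * (p ^ 3 - 7 * q ^ 3)))); [ring | rewrite Htt; ring]. }
  assert (F2 : B ^ 2 = - q * (8 * p ^ 3 + 7 * q ^ 3)).
  { apply Z.opp_inj. rewrite <- E2. transitivity (t * t * (- (- q * (8 * p ^ 3 + 7 * q ^ 3)))); [ring | rewrite Htt; ring]. }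
  pose proof (odd_sqr_pos B HB) as HB2.
  assert (Hq : q mod 2 = 1).
  { apply (odd_divide_odd q (- t * (q * q))); [exists (- t * q); ring | exact Hz]. }
  (* As [q] is odd, exactly one of [p] and [p^3 - 7 q^3] is odd; dividing a power of 2, it is 1 or
     -1. The sign of [B^2 = - q (8 p^3 + 7 q^3)] contradicts [p] even, and for [p] odd leaves
     [q = - p], hence [c^2 = 16]. *)
  assert (Hp : p mod 2 = 0 \/ p mod 2 = 1) by (clear; lia).
  assert (Hc2 : 2 * (p * (p ^ 3 - 7 * q ^ 3)) = 1 * 2 ^ (2 * i)).
  { unfold c in F1. rewrite <- Z.pow_mul_r, (Z.mul_comm i) in F1 by (clear - Hi; lia). clear - F1. lia. }
  destruct Hp as [Hp | Hp].
  - exfalso.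
    assert (HT : (p ^ 3 - 7 * q ^ 3) mod 2 = 1).
    { assert (H1 : p ^ 3 mod 2 = 0) by (rewrite <- Z.mod_pow_l, Hp; reflexivity).
      assert (H2 : q ^ 3 mod 2 = 1) by (rewrite <- Z.mod_pow_l, Hq; reflexivity). clear - H1 H2. lia. }
    assert (D : p ^ 3 - 7 * q ^ 3 = 1 \/ p ^ 3 - 7 * q ^ 3 = -1).
    { apply divide_1_abs, (odd_divide_pow2 _ 1 (2 * i)); [clear - Hi; lia | exact HT |].
      exists (2 * p). rewrite <- Hc2. ring. }
    assert (Hcp : 0 < c ^ 2) by (clear - Hc; nia).
    assert (Hp1 : p <> 1 /\ p <> -1) by (split; intros ->; discriminate).
    rewrite F2 in HB2. apply mul_pos_cases in HB2.
    clear - D F1 Hcp HB2 Hp1. pose proof (cube_mono 0 q). pose proof (cube_mono q 0).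
    destruct D as [D | D]; rewrite D in F1.
    + pose proof (cube_mono 2 p). lia.
    + pose proof (cube_mono p (-2)). lia.
  - assert (D : p = 1 \/ p = -1).
    { apply divide_1_abs, (odd_divide_pow2 _ 1 (2 * i)); [clear - Hi; lia | exact Hp |].
      exists (2 * (p ^ 3 - 7 * q ^ 3)). rewrite <- Hc2. ring. }
    assert (G : c ^ 2 = 16).
    { rewrite F2 in HB2. apply mul_pos_cases in HB2. clear - D F1 HB2.
      destruct D as [-> | ->].
      - pose proof (cube_mono q (-2)). pose proof (cube_mono 0 q).
        assert (q = -1) by lia. subst q. lia.
      - pose proof (cube_mono 2 q). pose proof (cube_mono q 0).
        assert (q = 1) by lia. subst q. lia. }
    clear - G Hc. nia.
Qed.

(** The conic gives [p = 2 P] and [4 P T = k c^2] with [T = 2 P^3 - 7 q^3] odd, so [T] divides [k].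
    The signs of [P T] and of [k B^2 = - q (2 p^3 + 7 q^3)] force [|P| = 1], and [4 |T| = k c^2] is
    impossible because [c^2 >= 16]. *)
Lemma th28_core (k x y z B i : Z) :
  k = 1 \/ k = 9 -> 2 <= i -> B mod 2 = 1 -> rel_prime x z -> y * y = - (x * z) ->
  x * x + 28 * (y * z) = 2 * k * (2 ^ i) ^ 2 -> 2 * (x * y) + 7 * (z * z) = - k * B ^ 2 -> False.
Proof.
  intros Hk Hi HB Hcop E3 E1 E2.
  set (c := 2 ^ i) in *.
  assert (Hc : 16 <= c ^ 2).
  { unfold c. rewrite <- Z.pow_mul_r by (clear - Hi; lia). change 16 with (2 ^ 4).
    apply Z.pow_le_mono_r; clear - Hi; lia. }
  destruct (cone_parametrization x y z Hcop E3) as (p & q & t & Ht & -> & -> & ->).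
  assert (Htt : t * t = 1) by (destruct Ht as [-> | ->]; reflexivity).
  assert (F1 : p * (p ^ 3 - 28 * q ^ 3) = 2 * k * c ^ 2).
  { rewrite <- E1. transitivity (t * t * (p * (p ^ 3 - 28 * q ^ 3))); [rewrite Htt; ring | ring]. }
  assert (F2 : k * B ^ 2 = - q * (2 * p ^ 3 + 7 * q ^ 3)).
  { apply Z.opp_inj. rewrite <- Z.mul_opp_l, <- E2.
    transitivity (t * t * (- (- q * (2 * p ^ 3 + 7 * q ^ 3)))); [ring | rewrite Htt; ring]. }
  pose proof (odd_sqr_pos B HB) as HB2.
  assert (Hkodd : k mod 2 = 1) by (destruct Hk as [-> | ->]; reflexivity).
  assert (Hq : q mod 2 = 1).
  { apply (odd_divide_odd q (k * B ^ 2)).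
    - rewrite F2. exists (- (2 * p ^ 3 + 7 * q ^ 3)). ring.
    - rewrite Z.mul_mod, Hkodd, <- Z.mod_pow_l, HB by discriminate. reflexivity. }
  assert (Hp : (2 | p)).
  { assert (D : (2 | p * (p ^ 3 - 28 * q ^ 3))) by (rewrite F1; exists (k * c ^ 2); ring).
    apply (prime_mult 2 prime_2) in D. destruct D as [D | D]; [exact D|].
    assert (D' : (2 | p * (p * p))).
    { destruct D as [m Hm]. exists (m + 14 * q ^ 3).
      replace (p * (p * p)) with (p ^ 3 - 28 * q ^ 3 + 28 * q ^ 3) by ring. rewrite Hm. ring. }
    apply (prime_mult 2 prime_2) in D'. destruct D' as [D' | D']; [exact D'|].
    apply (prime_mult 2 prime_2) in D'. tauto. }
  destruct Hp as [P ->].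
  assert (G1 : 4 * P * (2 * P ^ 3 - 7 * q ^ 3) = k * c ^ 2).
  { apply (Z.mul_reg_l _ _ 4); [discriminate|]. transitivity (2 * (2 * k * c ^ 2)); [rewrite <- F1|]; ring. }
  assert (HT : (2 * P ^ 3 - 7 * q ^ 3) mod 2 = 1).
  { assert (H2 : q ^ 3 mod 2 = 1) by (rewrite <- Z.mod_pow_l, Hq; reflexivity). clear - H2. lia. }
  assert (D : (2 * P ^ 3 - 7 * q ^ 3 | k)).
  { apply (odd_divide_pow2 _ k (i * 2)); [clear - Hi; lia | exact HT |].
    exists (4 * P). rewrite Z.pow_mul_r by (clear - Hi; lia). fold c. rewrite <- G1. ring. }
  assert (D9 : (2 * P ^ 3 - 7 * q ^ 3 | 9)).
  { apply (Z.divide_trans _ _ _ D). destruct Hk as [-> | ->]; [exists 9 | exists 1]; reflexivity. }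
  apply divide_9_cases in D9.
  assert (HBk : 0 < k * B ^ 2) by (destruct Hk as [-> | ->]; clear - HB2; lia).
  rewrite F2 in HBk. apply mul_pos_cases in HBk.
  assert (Hkc : k * c ^ 2 = c ^ 2 \/ k * c ^ 2 = 9 * c ^ 2) by (destruct Hk as [-> | ->]; clear; lia).
  assert (HkT : k = 9 \/ (2 * P ^ 3 - 7 * q ^ 3 = 1 \/ 2 * P ^ 3 - 7 * q ^ 3 = -1)).
  { destruct Hk as [-> | ->]; [right; apply divide_1_abs; exact D | left; reflexivity]. }
  assert (HPT : 0 < P * (2 * P ^ 3 - 7 * q ^ 3)) by (clear - G1 Hc Hkc; lia).
  apply mul_pos_cases in HPT.
  clear - D9 G1 Hc HBk Hkc Hk HkT HPT.
  remember (2 * P ^ 3 - 7 * q ^ 3) as T eqn:ET.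
  assert (HP : P = 1 \/ P = -1).
  { assert (HT : -9 <= T <= 9) by (clear - D9; lia). clear - HT HPT HBk ET.
    pose proof (cube_mono 0 q). pose proof (cube_mono q 0).
    pose proof (cube_mono 2 P). pose proof (cube_mono P (-2)). lia. }
  clear - HP D9 G1 Hc Hkc Hk HkT HPT.
  assert (HT : k * c ^ 2 = 4 * T \/ k * c ^ 2 = - 4 * T) by (clear - G1 HP; destruct HP; subst P; lia).
  clear - HT D9 Hc Hk HkT. destruct Hk; subst k; lia.
Qed.

(** Common divisors of [x] and [z] divide 9. Either 3 divides the whole root and is removed, leaving
    [k = 1], or [x] and [z] are coprime already and [k = 9]. *)
Lemma th28_quadrics (x y z B i : Z) :
  2 <= i -> B mod 2 = 1 ->
  cmul 2 7 (x, y, z) (x, y, z) = vscale 9 (2 * (2 ^ i) ^ 2, - B ^ 2, 0) -> False.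
Proof.
  intros Hi HB E. unfold cmul, vscale in E. apply vec_inj in E as (E1 & E2 & E3).
  assert (F3 : y * y = - (x * z)) by (clear - E3; lia).
  assert (Hz : z mod 2 = 1).
  { assert (HBB : B ^ 2 mod 2 = 1) by (rewrite <- Z.mod_pow_l, HB; reflexivity).
    assert (Hzz : (z * z) mod 2 = 1) by (clear - E2 HBB; lia).
    apply (odd_divide_odd z (z * z)); [apply Z.divide_factor_l | exact Hzz]. }
  assert (Hcc : 2 * (2 ^ i) ^ 2 = 1 * 2 ^ (2 * i + 1)).
  { rewrite Z.pow_add_r, Z.mul_comm, Z.mul_1_l by (clear - Hi; lia). f_equal.
    rewrite <- Z.pow_mul_r by (clear - Hi; lia). f_equal. clear; lia. }
  assert (K : forall d, (d | x) -> (d | z) -> (d | 9)).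
  { intros d [k1 D1] [k2 D2].
    apply (odd_divide_pow2 d 9 (2 * i + 1));
      [clear - Hi; lia | apply (odd_divide_odd d z); [exists k2; exact D2 | exact Hz]|].
    rewrite <- (Z.mul_1_l (2 ^ _)), <- Hcc, <- E1. exists (k1 * x + 28 * y * k2). rewrite D1 at 1. rewrite D2. ring. }
  destruct (Zdivide_dec 3 x) as [Dx | Dx], (Zdivide_dec 3 z) as [Dz | Dz].
  - destruct Dx as [x' ->], Dz as [z' ->].
    assert (Dy : (3 | y)).
    { assert (D : (3 | y * y)) by (exists (- (x' * (z' * 3))); rewrite F3; ring).
      apply (prime_mult 3 prime_3) in D. tauto. }
    destruct Dy as [y' ->].
    apply (th28_core 1 x' y' z' B i); [left; reflexivity | exact Hi | exact HB | | clear - F3; lia | clear - E1; lia | clear - E2; lia].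
    apply rel_prime_intro. intros d [k1 D1] [k2 D2].
    apply (odd_divide_pow2 d 1 (2 * i + 1)); [clear - Hi; lia | |].
    + apply (odd_divide_odd d (z' * 3)); [exists (k2 * 3); rewrite D2; ring | exact Hz].
    + rewrite <- Hcc. exists (k1 * x' + 28 * y' * k2).
      transitivity (x' * x' + 28 * (y' * z')); [clear - E1; lia | rewrite D1 at 1; rewrite D2; ring].
  - apply (th28_core 9 x y z B i); [right; reflexivity | exact Hi | exact HB | | exact F3 | clear - E1; lia | clear - E2; lia].
    apply rel_prime_intro. intros d D1 D2. pose proof (K d D1 D2) as D.
    apply divide_9_cases in D. destruct_or D; subst d; try (exists 1; reflexivity); try (exists (-1); reflexivity);
      exfalso; apply Dz; apply Z.divide_trans with (2 := D2);
      ((exists 1; reflexivity) || (exists (-1); reflexivity) || (exists 3; reflexivity) || (exists (-3); reflexivity)).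
  - apply (th28_core 9 x y z B i); [right; reflexivity | exact Hi | exact HB | | exact F3 | clear - E1; lia | clear - E2; lia].
    apply rel_prime_intro. intros d D1 D2. pose proof (K d D1 D2) as D.
    apply divide_9_cases in D. destruct_or D; subst d; try (exists 1; reflexivity); try (exists (-1); reflexivity);
      exfalso; apply Dx; apply Z.divide_trans with (2 := D1);
      ((exists 1; reflexivity) || (exists (-1); reflexivity) || (exists 3; reflexivity) || (exists (-3); reflexivity)).
  - apply (th28_core 9 x y z B i); [right; reflexivity | exact Hi | exact HB | | exact F3 | clear - E1; lia | clear - E2; lia].
    apply rel_prime_intro. intros d D1 D2. pose proof (K d D1 D2) as D.
    apply divide_9_cases in D. destruct_or D; subst d; try (exists 1; reflexivity); try (exists (-1); reflexivity);
      exfalso; apply Dx; apply Z.divide_trans with (2 := D1);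
      ((exists 1; reflexivity) || (exists (-1); reflexivity) || (exists 3; reflexivity) || (exists (-3); reflexivity)).
Qed.

Lemma th5_quadrics (x y z u i : Z) :
  0 <= i -> u mod 2 = 1 -> u mod 3 <> 0 ->
  cmul 1 5 (x, y, z) (x, y, z) = vscale 3 (2 * (2 ^ i) ^ 2, - u ^ 2, 0) -> (2 ^ i) ^ 2 = 4 /\ u ^ 2 = 1.
Proof.
  intros Hi HB Hu3 E. unfold cmul, vscale in E. apply vec_inj in E as (E1 & E2 & E3).
  set (c := 2 ^ i) in *.
  assert (Hc : 0 < c) by (apply Z.pow_pos_nonneg; clear - Hi; lia).
  assert (Hcc : 2 * c ^ 2 = 1 * 2 ^ (2 * i + 1)).
  { rewrite Z.pow_add_r, Z.mul_comm, Z.mul_1_l by (clear - Hi; lia). f_equal. unfold c.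
    rewrite <- Z.pow_mul_r by (clear - Hi; lia). f_equal. clear; lia. }
  assert (Hz : z mod 2 = 1).
  { assert (HBB : u ^ 2 mod 2 = 1) by (rewrite <- Z.mod_pow_l, HB; reflexivity).
    assert (Hzz : (z * z) mod 2 = 1) by (clear - E2 HBB; lia).
    apply (odd_divide_odd z (z * z)); [apply Z.divide_factor_l | exact Hzz]. }
  assert (Hy : (2 | y)).
  { assert (D : (2 | y * y)) by (exists (- (x * z)); clear - E3; lia).
    apply (prime_mult 2 prime_2) in D. tauto. }
  destruct Hy as [Y ->].
  assert (Hx : (2 | x)).
  { assert (D : (2 | x * z)) by (exists (- (Y * Y)); clear - E3; lia).
    apply (prime_mult 2 prime_2) in D. destruct D as [D | D]; [exact D|].
    apply Z.mod_divide in D; [congruence | discriminate]. }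
  destruct Hx as [X ->].
  assert (F3 : Y * Y = - (X * z)) by (clear - E3; lia).
  assert (Hcop : rel_prime X z).
  { apply rel_prime_intro. intros d D1' D2'.
    assert (D3 : (d | 3)).
    { destruct D1' as [k1 D1], D2' as [k2 D2].
      apply (odd_divide_pow2 d 3 (2 * i + 1));
        [clear - Hi; lia | apply (odd_divide_odd d z); [exists k2; exact D2 | exact Hz]|].
      rewrite <- (Z.mul_1_l (2 ^ _)), <- Hcc, <- E1. exists (4 * k1 * X + 20 * Y * k2).
      rewrite D1 at 1. rewrite D2. ring. }
    assert (D33 : (3 | X) -> (3 | z) -> (3 | 1)).
    { intros [X' ->] [z' ->]. exfalso. apply Hu3.
      assert (DY : (3 | Y)).
      { assert (D : (3 | Y * Y)) by (exists (- (X' * (z' * 3))); rewrite F3; ring).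
        apply (prime_mult 3 prime_3) in D. tauto. }
      destruct DY as [Y' ->]. apply Z.mod_divide; [discriminate|].
      assert (D : (3 | u * u)) by (exists (- (8 * X' * Y' + 5 * z' * z')); clear - E2; lia).
      apply (prime_mult 3 prime_3) in D. tauto. }
    apply divide_3_cases in D3. destruct_or D3; subst d.
    - exists 1; reflexivity.
    - exists (-1); reflexivity.
    - apply D33; assumption.
    - apply Z.divide_opp_l, D33; apply Z.divide_opp_l; assumption. }
  destruct (cone_parametrization X Y z Hcop F3) as (p & q & t & Ht & -> & -> & ->).
  assert (Htt : t * t = 1) by (destruct Ht as [-> | ->]; reflexivity).
  assert (F1 : 3 * c ^ 2 = 2 * p * (p ^ 3 - 5 * q ^ 3)).
  { apply (Z.mul_reg_l _ _ 2); [discriminate|]. transitivity (3 * (2 * c ^ 2)); [ring|]. rewrite <- E1.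
    transitivity (t * t * (2 * (2 * p * (p ^ 3 - 5 * q ^ 3)))); [ring | rewrite Htt; ring]. }
  assert (F2 : 3 * u ^ 2 = - q * (8 * p ^ 3 + 5 * q ^ 3)).
  { apply Z.opp_inj. transitivity (3 * - u ^ 2); [ring|]. rewrite <- E2.
    transitivity (t * t * (- (- q * (8 * p ^ 3 + 5 * q ^ 3)))); [ring | rewrite Htt; ring]. }
  pose proof (odd_sqr_pos u HB) as HB2.
  assert (HB3 : 0 < 3 * u ^ 2) by (clear - HB2; lia).
  assert (Hq : q mod 2 = 1).
  { apply (odd_divide_odd q (- t * (q * q))); [exists (- t * q); ring | exact Hz]. }
  assert (Hc2 : 2 * (p * (p ^ 3 - 5 * q ^ 3)) = 3 * 2 ^ (2 * i)).
  { unfold c in F1. rewrite <- Z.pow_mul_r, (Z.mul_comm i) in F1 by (clear - Hi; lia). clear - F1. lia. }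
  assert (Hcp : 0 < c ^ 2) by (clear - Hc; nia).
  (* The value to be excluded comes from [p = 3], [q = -3] and its opposite, where both quadrics are
     solvable with [c^2 = 324]. *)
  assert (Hu3' : u ^ 2 <> 81).
  { intros H. apply Hu3. assert (K : (u - 9) * (u + 9) = 0) by (clear - H; lia).
    apply Z.mul_eq_0 in K. clear - K. lia. }
  rewrite F2 in HB3. apply mul_pos_cases in HB3.
  assert (Hp : p mod 2 = 0 \/ p mod 2 = 1) by (clear; lia).
  destruct Hp as [Hp | Hp].
  - exfalso.
    assert (HT : (p ^ 3 - 5 * q ^ 3) mod 2 = 1).
    { assert (H1 : p ^ 3 mod 2 = 0) by (rewrite <- Z.mod_pow_l, Hp; reflexivity).
      assert (H2 : q ^ 3 mod 2 = 1) by (rewrite <- Z.mod_pow_l, Hq; reflexivity). clear - H1 H2. lia. }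
    assert (D : (p ^ 3 - 5 * q ^ 3 | 3)).
    { apply (odd_divide_pow2 _ 3 (2 * i)); [clear - Hi; lia | exact HT |].
      exists (2 * p). rewrite <- Hc2. ring. }
    apply divide_3_cases in D.
    assert (Hp1 : p <> 1 /\ p <> -1) by (split; intros ->; discriminate).
    clear - D F1 Hcp HB3 Hp1. pose proof (cube_mono 0 q). pose proof (cube_mono q 0).
    pose proof (cube_mono 2 p). pose proof (cube_mono p (-2)).
    destruct_or D; rewrite D in F1; lia.
  - assert (D : (p | 3)).
    { apply (odd_divide_pow2 _ 3 (2 * i)); [clear - Hi; lia | exact Hp |].
      exists (2 * (p ^ 3 - 5 * q ^ 3)). rewrite <- Hc2. ring. }
    apply divide_3_cases in D.
    assert (Hq2 : q <> -2 /\ q <> 2) by (split; intros ->; discriminate).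
    clear - D F1 F2 HB3 Hq2 Hu3'.
    pose proof (cube_mono q (-2)). pose proof (cube_mono 2 q).
    pose proof (cube_mono q 0). pose proof (cube_mono 0 q).
    pose proof (cube_mono q (-4)). pose proof (cube_mono 4 q).
    assert (Hqb : -4 < q < 4) by (destruct_or D; subst p; lia).
    assert (Hqc : q = -3 \/ q = -2 \/ q = -1 \/ q = 0 \/ q = 1 \/ q = 2 \/ q = 3) by lia.
    destruct_or D; subst p; destruct_or Hqc; subst q; lia.
Qed.

(** * Cubes in real quadratic orders *)

(* Multiplying [gamma] by a unit and [rho] by the inverse of its cube keeps [rho * gamma^3]. *)
Lemma unit_reduction (n0 e1 e2 nu b P Q g h : Z) :
  Z.abs (qnorm 0 n0 e1 e2) = 1 ->
  (forall P Q, Z.abs (qnorm 0 n0 P Q) = nu -> b < Z.abs Q ->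
     Z.abs (qcube1 0 n0 e1 e2 * Q - qcube2 0 n0 e1 e2 * P) < Z.abs Q \/
     Z.abs (qcube1 0 n0 e1 e2 * Q + qcube2 0 n0 e1 e2 * P) < Z.abs Q) ->
  Z.abs (qnorm 0 n0 P Q) = nu ->
  exists P' Q' g' h',
    Z.abs Q' <= b /\ Z.abs (qnorm 0 n0 P' Q') = nu /\
    Z.abs (qnorm 0 n0 g' h') = Z.abs (qnorm 0 n0 g h) /\
    qmul1 n0 P' Q' (qcube1 0 n0 g' h') (qcube2 0 n0 g' h') =
      qmul1 n0 P Q (qcube1 0 n0 g h) (qcube2 0 n0 g h) /\
    qmul2 0 P' Q' (qcube1 0 n0 g' h') (qcube2 0 n0 g' h') =
      qmul2 0 P Q (qcube1 0 n0 g h) (qcube2 0 n0 g h).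
Proof.
  intros He Hstep. remember (Z.to_nat (Z.abs Q)) as n eqn:Hn. revert P Q g h Hn.
  induction n as [n IH] using lt_wf_ind. intros P Q g h Hn HN.
  destruct (Z.le_gt_cases (Z.abs Q) b) as [Hle | Hgt].
  { exists P, Q, g, h. repeat split; assumption. }
  set (E1 := qcube1 0 n0 e1 e2) in *. set (E2 := qcube2 0 n0 e1 e2) in *.
  set (eta := qnorm 0 n0 e1 e2) in *.
  assert (Heta : eta = 1 \/ eta = -1) by lia.
  assert (Heta2 : eta * eta = 1) by (destruct Heta as [-> | ->]; reflexivity).
  assert (Heta4 : eta * (eta * (eta * eta)) = 1) by (rewrite !Heta2, Z.mul_1_r; exact Heta2).
  assert (HE : qnorm 0 n0 E1 E2 = eta ^ 3) by (unfold E1, E2, eta; apply qnorm_cube).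
  (* [E1 + E2 om] is the cube of the unit. In the first case [rho] is multiplied by the inverse of
     this cube and [gamma] by the unit; in the second it is the other way round, the inverse being
     [eta] times the conjugate. *)
  destruct (Hstep P Q HN Hgt) as [H | H].
  - destruct (IH (Z.to_nat (Z.abs (E1 * Q - E2 * P)))) with (P := eta * (E1 * P + n0 * E2 * Q))
      (Q := eta * (E1 * Q - E2 * P)) (g := qmul1 n0 g h e1 e2) (h := qmul2 0 g h e1 e2)
      as (P' & Q' & g' & h' & B1 & B2 & B3 & B4 & B5).
    + lia.
    + rewrite Z.abs_mul. destruct Heta as [-> | ->]; rewrite Z.mul_1_l; reflexivity.
    + replace (qnorm 0 n0 (eta * (E1 * P + n0 * E2 * Q)) (eta * (E1 * Q - E2 * P)))
        with (eta * eta * (qnorm 0 n0 E1 E2 * qnorm 0 n0 P Q)) by (unfold qnorm; ring).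
      rewrite Heta2, HE, !Z.abs_mul, HN. destruct Heta as [-> | ->]; simpl Z.abs; lia.
    + exists P', Q', g', h'. split; [exact B1|]. split; [exact B2|]. split.
      { rewrite B3, qnorm_mul, Z.abs_mul. fold eta. rewrite He. lia. }
      split.
      * rewrite B4.
        transitivity (eta * (eta * (eta * eta)) * qmul1 n0 P Q (qcube1 0 n0 g h) (qcube2 0 n0 g h)).
        { unfold eta, E1, E2, qmul1, qmul2, qcube1, qcube2, qnorm. ring. }
        rewrite Heta4. ring.
      * rewrite B5.
        transitivity (eta * (eta * (eta * eta)) * qmul2 0 P Q (qcube1 0 n0 g h) (qcube2 0 n0 g h)).
        { unfold eta, E1, E2, qmul1, qmul2, qcube1, qcube2, qnorm. ring. }
        rewrite Heta4. ring.
  - destruct (IH (Z.to_nat (Z.abs (E1 * Q + E2 * P)))) with (P := E1 * P - n0 * E2 * Q)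
      (Q := E1 * Q + E2 * P) (g := eta * qmul1 n0 g h e1 (- e2)) (h := eta * qmul2 0 g h e1 (- e2))
      as (P' & Q' & g' & h' & B1 & B2 & B3 & B4 & B5).
    + lia.
    + reflexivity.
    + replace (qnorm 0 n0 (E1 * P - n0 * E2 * Q) (E1 * Q + E2 * P))
        with (qnorm 0 n0 E1 E2 * qnorm 0 n0 P Q) by (unfold qnorm; ring).
      rewrite HE, !Z.abs_mul, HN. destruct Heta as [-> | ->]; simpl Z.abs; lia.
    + exists P', Q', g', h'. split; [exact B1|]. split; [exact B2|]. split.
      { rewrite B3.
        replace (qnorm 0 n0 (eta * qmul1 n0 g h e1 (- e2)) (eta * qmul2 0 g h e1 (- e2)))
          with (eta * eta * (qnorm 0 n0 g h * qnorm 0 n0 e1 e2)) by (unfold qnorm, qmul1, qmul2; ring).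
        rewrite Heta2, Z.mul_1_l, Z.abs_mul. fold eta. rewrite He. lia. }
      assert (Heta6 : eta * eta * (eta * (eta * (eta * eta))) = 1) by (rewrite Heta4, Heta2; reflexivity).
      split.
      * rewrite B4.
        transitivity (eta * eta * (eta * (eta * (eta * eta))) * qmul1 n0 P Q (qcube1 0 n0 g h) (qcube2 0 n0 g h)).
        { unfold eta, E1, E2, qmul1, qmul2, qcube1, qcube2, qnorm. ring. }
        rewrite Heta6. ring.
      * rewrite B5.
        transitivity (eta * eta * (eta * (eta * (eta * eta))) * qmul2 0 P Q (qcube1 0 n0 g h) (qcube2 0 n0 g h)).
        { unfold eta, E1, E2, qmul1, qmul2, qcube1, qcube2, qnorm. ring. }
        rewrite Heta6. ring.
Qed.

Lemma cube_residue_check (m n0 P Q : Z) (T : Z -> Z -> Z -> Z -> bool) :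
  0 < m ->
  forallb (fun g => forallb (fun h =>
      T (qmul1 n0 P Q (qcube1 0 n0 g h) (qcube2 0 n0 g h) mod m)
        (qmul2 0 P Q (qcube1 0 n0 g h) (qcube2 0 n0 g h) mod m) g h) (residues m)) (residues m) = true ->
  forall g h, T (qmul1 n0 P Q (qcube1 0 n0 g h) (qcube2 0 n0 g h) mod m)
    (qmul2 0 P Q (qcube1 0 n0 g h) (qcube2 0 n0 g h) mod m) (g mod m) (h mod m) = true.
Proof.
  intros Hm H g h. rewrite forallb_forall in H.
  specialize (H _ (mod_in_residues m g Hm)). rewrite forallb_forall in H.
  specialize (H _ (mod_in_residues m h Hm)). rewrite <- H.
  f_equal; apply eqmod_iff; try (clear - Hm; lia); unfold qmul1, qmul2, qcube1, qcube2;
    rewrite <- (eqmod_mod m g), <- (eqmod_mod m h) by (clear - Hm; lia); reflexivity.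
Qed.

(* All six classes of [rho] of norm [-17 (u^2)^3] are excluded: four modulo 9, two modulo 7. *)
Lemma sqrt2_no_cube (u v j : Z) :
  2 <= j -> j mod 3 = 1 -> u mod 2 = 1 -> u mod 3 <> 0 ->
  2 * (3 ^ j) ^ 2 = 17 * u ^ 6 + v ^ 6 -> False.
Proof.
  intros Hj Hj3 Hu2 Hu3 E.
  set (W := 3 ^ j) in *. set (V := v ^ 3). set (U := u ^ 2).
  assert (Hu3' : rel_prime u 3).
  { apply rel_prime_sym, prime_rel_prime; [exact prime_3|].
    intros D. apply Z.mod_divide in D; [contradiction | discriminate]. }
  assert (HU : U <> 0) by (pose proof (odd_sqr_pos u Hu2) as K; fold U in K; clear - K; lia).
  assert (HUodd : rel_prime U 2).
  { apply rel_prime_sym, rel_prime_Zpower_r; [discriminate|]. apply prime_rel_prime; [exact prime_2|].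
    intros D. apply Z.mod_divide in D; [congruence | discriminate]. }
  assert (HU3 : rel_prime U 3) by (apply rel_prime_sym, rel_prime_Zpower_r; [discriminate | apply rel_prime_sym; exact Hu3']).
  destruct (norm_eq_cube 0 (-2) V W U (-17)) as (P & Q & g & h & N1 & N2 & EV & EW).
  { left. reflexivity. }
  { exact HU. }
  { apply rel_prime_sym. apply rel_prime_Zpower_r; [clear - Hj; lia | exact HU3]. }
  { apply rel_prime_sym. change (0 * 0 - 4 * -2) with (2 ^ 3). apply rel_prime_Zpower_r; [discriminate | exact HUodd]. }
  { unfold qnorm, V, U. transitivity (v ^ 6 - 2 * W ^ 2); [ring | rewrite E; ring]. }
  (* The unit is [1 + sqrt 2], with cube [7 + 5 sqrt 2]. Once [|Q| <= 5], norm 17 up to sign leaves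
     [5 + 2 sqrt 2], [1 + 3 sqrt 2] and [7 + 4 sqrt 2], up to signs of the coordinates. *)
  destruct (unit_reduction (-2) 1 1 17 5 P Q g h) as (P' & Q' & g' & h' & B1 & B2 & B3 & B4 & B5);
    [reflexivity | | exact N2 |].
  { intros p q Hpq Hq. unfold qnorm in Hpq. unfold qcube1, qcube2.
    ring_simplify (1 ^ 3 - 3 * -2 * 1 * 1 ^ 2 - 0 * -2 * 1 ^ 3).
    ring_simplify (3 * 1 ^ 2 * 1 + 3 * 0 * 1 * 1 ^ 2 + (0 * 0 - -2) * 1 ^ 3).
    clear - Hpq Hq. nia. }
  rewrite <- B4 in EV. rewrite <- B5 in EW. rewrite N1 in B3.
  clear P Q g h N1 N2 B4 B5.
  (* The hypothesis [2 <= j] enters only through this residue modulo 9, and [j mod 3 = 1] only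
     through the next one modulo 7. *)
  assert (HW9 : W mod 9 = 0) by (apply pow3_mod9; exact Hj).
  assert (HW7 : W mod 7 = 3 \/ W mod 7 = 4).
  { unfold W. destruct (pow3_mod7 j ltac:(clear - Hj; lia)) as [K | [K | [K | [K | [K | K]]]]];
      clear - K Hj3; lia. }
  assert (HV7 : V mod 7 = 1 \/ V mod 7 = 6).
  { pose proof (cube_mod7 v) as K. fold V in K.
    destruct K as [K | [K | K]]; [exfalso | left; exact K | right; exact K].
    assert (Hv6 : v ^ 6 mod 7 = 0).
    { replace (v ^ 6) with (V ^ 2) by (unfold V; ring). rewrite <- Z.mod_pow_l, K. reflexivity. }
    assert (HW2 : W ^ 2 mod 7 = 2) by (rewrite <- Z.mod_pow_l; destruct HW7 as [-> | ->]; reflexivity).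
    pose proof (sixth_mod7 u) as Hu6. clear - E Hv6 HW2 Hu6. lia. }
  assert (Hgh : ~ ((3 | g') /\ (3 | h'))).
  { intros [[k1 D1] [k2 D2]]. destruct HU3 as [_ _ HU3'].
    assert (D : (3 | 1)).
    { apply HU3'; [|apply Z.divide_refl]. apply Z.divide_abs_r. rewrite <- B3. apply Z.divide_abs_r.
      exists (3 * (k1 * k1) - 6 * (k2 * k2)). rewrite D1, D2. unfold qnorm. ring. }
    destruct D as [k Hk]. clear - Hk. lia. }
  assert (T9 : forall P Q, V = qmul1 (-2) P Q (qcube1 0 (-2) g' h') (qcube2 0 (-2) g' h') ->
    W = qmul2 0 P Q (qcube1 0 (-2) g' h') (qcube2 0 (-2) g' h') ->
    forallb (fun g => forallb (fun h =>
      negb (qmul2 0 P Q (qcube1 0 (-2) g h) (qcube2 0 (-2) g h) mod 9 =? 0) ||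
      ((g mod 3 =? 0) && (h mod 3 =? 0))) (residues 9)) (residues 9) = true -> False).
  { intros P Q _ HW Hchk.
    pose proof (cube_residue_check 9 (-2) P Q
      (fun _ w g h => negb (w =? 0) || ((g mod 3 =? 0) && (h mod 3 =? 0)))%bool eq_refl Hchk g' h') as K.
    cbv beta in K. rewrite <- HW, HW9 in K. apply andb_true_iff in K. rewrite !Z.eqb_eq in K.
    apply Hgh. destruct K as [K1 K2].
    rewrite <- (Zmod_div_mod 3 9) in K1, K2 by (reflexivity || (exists 3; reflexivity)).
    split; apply Z.mod_divide; (discriminate || assumption). }
  assert (T7 : forall P Q, V = qmul1 (-2) P Q (qcube1 0 (-2) g' h') (qcube2 0 (-2) g' h') ->
    W = qmul2 0 P Q (qcube1 0 (-2) g' h') (qcube2 0 (-2) g' h') ->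
    forallb (fun g => forallb (fun h =>
      let V := qmul1 (-2) P Q (qcube1 0 (-2) g h) (qcube2 0 (-2) g h) mod 7 in
      let W := qmul2 0 P Q (qcube1 0 (-2) g h) (qcube2 0 (-2) g h) mod 7 in
      negb (((W =? 3) || (W =? 4)) && ((V =? 1) || (V =? 6)))) (residues 7)) (residues 7) = true -> False).
  { intros P Q HV HW Hchk.
    pose proof (cube_residue_check 7 (-2) P Q
      (fun v w _ _ => negb (((w =? 3) || (w =? 4)) && ((v =? 1) || (v =? 6))))%bool eq_refl Hchk g' h') as K.
    cbv beta in K. rewrite <- HW, <- HV in K.
    destruct HW7 as [HW7 | HW7], HV7 as [HV7 | HV7]; rewrite HW7, HV7 in K; discriminate. }
  assert (HQ : (Q' = 2 \/ Q' = -2) /\ (P' = 5 \/ P' = -5) \/ (Q' = 3 \/ Q' = -3) /\ (P' = 1 \/ P' = -1) \/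
    (Q' = 4 \/ Q' = -4) /\ (P' = 7 \/ P' = -7)).
  { clear - B1 B2. unfold qnorm in B2.
    assert (HP : -9 <= P' <= 9) by nia.
    assert (HQ : Q' = -5 \/ Q' = -4 \/ Q' = -3 \/ Q' = -2 \/ Q' = -1 \/ Q' = 0 \/ Q' = 1 \/ Q' = 2 \/ Q' = 3 \/
      Q' = 4 \/ Q' = 5) by lia.
    assert (HP' : P' = -9 \/ P' = -8 \/ P' = -7 \/ P' = -6 \/ P' = -5 \/ P' = -4 \/ P' = -3 \/ P' = -2 \/ P' = -1 \/
      P' = 0 \/ P' = 1 \/ P' = 2 \/ P' = 3 \/ P' = 4 \/ P' = 5 \/ P' = 6 \/ P' = 7 \/ P' = 8 \/ P' = 9) by lia.
    clear HP B1. destruct_or HQ; subst Q'; destruct_or HP'; subst P'; simpl in B2; lia. }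
  destruct HQ as [[HQ HP] | [[HQ HP] | [HQ HP]]]; destruct HQ, HP; subst P' Q';
    first [ exact (T9 _ _ EV EW eq_refl) | exact (T7 _ _ EV EW eq_refl) ].
Qed.

Lemma rel_prime_not_divide (p u : Z) : prime p -> u mod p <> 0 -> rel_prime u p.
Proof.
  intros Hp Hu. apply rel_prime_sym, prime_rel_prime; [exact Hp|].
  intros D. apply Hu, Z.mod_divide; [destruct Hp as [K _]; clear - K; lia | exact D].
Qed.

(** [V + W sqrt 3] has norm [- nu (u^2)^3], so [norm_eq_cube] applies with [U = u^2]. The bound [b]
    is what reduction by the cube [26 + 15 sqrt 3] of the unit [2 + sqrt 3] achieves for norm [nu].
    A factor 3 of [g] would divide the norm of [g + h sqrt 3], which is [u^2] up to sign. *)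
Lemma sqrt3_representation (nu b u V W : Z) :
  (nu = 2 /\ b = 3) \/ (nu = 11 /\ b = 7) ->
  u mod 2 = 1 -> u mod 3 <> 0 -> rel_prime u W ->
  V ^ 2 + nu * u ^ 6 = 3 * W ^ 2 ->
  exists P Q g h, Z.abs Q <= b /\ Z.abs (qnorm 0 (-3) P Q) = nu /\ ~ (3 | g) /\
    V = qmul1 (-3) P Q (qcube1 0 (-3) g h) (qcube2 0 (-3) g h) /\
    W = qmul2 0 P Q (qcube1 0 (-3) g h) (qcube2 0 (-3) g h).
Proof.
  intros Hnu Hu2 Hu3 HuW E.
  set (U := u ^ 2).
  assert (HU : U <> 0) by (pose proof (odd_sqr_pos u Hu2) as K; fold U in K; clear - K; lia).
  assert (HU2 : rel_prime U 2).
  { apply rel_prime_sym, rel_prime_Zpower_r; [discriminate|].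
    apply rel_prime_sym, rel_prime_not_divide; [exact prime_2 | rewrite Hu2; discriminate]. }
  assert (HU3 : rel_prime U 3).
  { apply rel_prime_sym, rel_prime_Zpower_r; [discriminate|].
    apply rel_prime_sym, rel_prime_not_divide; [exact prime_3 | exact Hu3]. }
  destruct (norm_eq_cube 0 (-3) V W U (- nu)) as (P & Q & g & h & N1 & N2 & EV & EW).
  { right. left. reflexivity. }
  { exact HU. }
  { apply rel_prime_Zpower_r; [discriminate | apply rel_prime_sym; exact HuW]. }
  { apply rel_prime_sym. change (0 * 0 - 4 * -3) with (2 * (2 * 3)). repeat apply rel_prime_mult; assumption. }
  { unfold qnorm, U. transitivity (V ^ 2 - 3 * W ^ 2); [ring | rewrite <- E; ring]. }
  rewrite Z.abs_opp in N2.
  replace (Z.abs nu) with nu in N2 by (destruct Hnu as [[-> _] | [-> _]]; reflexivity).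
  destruct (unit_reduction (-3) 2 1 nu b P Q g h) as (P' & Q' & g' & h' & B1 & B2 & B3 & B4 & B5);
    [reflexivity | | exact N2 |].
  { intros p q Hpq Hq. unfold qnorm in Hpq. unfold qcube1, qcube2.
    ring_simplify (2 ^ 3 - 3 * -3 * 2 * 1 ^ 2 - 0 * -3 * 1 ^ 3).
    ring_simplify (3 * 2 ^ 2 * 1 + 3 * 0 * 2 * 1 ^ 2 + (0 * 0 - -3) * 1 ^ 3).
    destruct Hnu as [[-> ->] | [-> ->]]; clear - Hpq Hq; nia. }
  exists P', Q', g', h'. split; [exact B1|]. split; [exact B2|].
  split; [| split; congruence].
  intros [k D1]. destruct HU3 as [_ _ HU3'].
  assert (D : (3 | 1)).
  { apply HU3'; [|apply Z.divide_refl]. apply Z.divide_abs_r. rewrite <- N1, <- B3. apply Z.divide_abs_r.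
    exists (3 * (k * k) - h' * h'). rewrite D1. unfold qnorm. ring. }
  destruct D as [k' Hk]. clear - Hk. lia.
Qed.

(** Modulo 3 the second coordinate of [(P + Q sqrt 3) (g + h sqrt 3)^3] is [Q g^3]. *)
Lemma sqrt3_class_mod3 (P Q g h V W : Z) :
  ~ (3 | g) -> W mod 3 = 0 ->
  W = qmul2 0 P Q (qcube1 0 (-3) g h) (qcube2 0 (-3) g h) -> (3 | Q).
Proof.
  intros Hg HW E.
  assert (D : (3 | Q * (g * (g * g)))).
  { apply Z.mod_divide in HW; [|discriminate]. destruct HW as [w Hw].
    exists (w - P * h * (g ^ 2 + h ^ 2) - 3 * Q * g * h ^ 2). rewrite E in Hw. unfold qmul2, qcube1, qcube2 in Hw.
    transitivity (w * 3 - 3 * (P * h * (g ^ 2 + h ^ 2)) - 3 * (3 * Q * g * h ^ 2)); [rewrite <- Hw|]; ring. }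
  repeat (apply (prime_mult 3 prime_3) in D; destruct D as [D | D]; [tauto || exact D|]); tauto.
Qed.

(** For [m > 0] the coefficient [Q] is divisible by 3, which removes the class of [1 + sqrt 3]
    belonging to the solution [A = B = 1], [m = 0]. What is left is [5 + 3 sqrt 3] up to signs,
    excluded modulo 13, where [3^m = 1] because [3^3 = 27]. *)
Lemma sqrt3_no_cube_norm2 (A B m : Z) :
  0 <= m -> m mod 3 = 0 -> B mod 2 = 1 -> B mod 3 <> 0 ->
  A ^ 2 + 2 * B ^ 6 = 3 * (3 ^ m) ^ 2 -> m = 0.
Proof.
  intros Hm Hm3 HB2 HB3 E.
  destruct (Z.eq_dec m 0) as [H0 | H0]; [exact H0 | exfalso].
  destruct (sqrt3_representation 2 3 B A (3 ^ m)) as (P & Q & g & h & B1 & B2 & Hg & EV & EW);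
    [left; split; reflexivity | exact HB2 | exact HB3 | | exact E |].
  { apply rel_prime_Zpower_r; [exact Hm | apply rel_prime_not_divide; [exact prime_3 | exact HB3]]. }
  set (W := 3 ^ m) in *.
  assert (HW3 : W mod 3 = 0).
  { unfold W. replace m with (m - 1 + 1) by ring. rewrite Z.pow_add_r by (clear - Hm H0; lia). apply Z.mod_mul. discriminate. }
  assert (HQ3 : (3 | Q)) by exact (sqrt3_class_mod3 P Q g h A W Hg HW3 EW).
  assert (HW13 : W mod 13 = 1).
  { unfold W. destruct (pow3_mod13 m Hm) as [K | [K | K]]; clear - K Hm3; lia. }
  assert (HV13 : A ^ 2 mod 13 = 3 \/ A ^ 2 mod 13 = 1 \/ A ^ 2 mod 13 = 5).
  { assert (HW2 : W ^ 2 mod 13 = 1) by (rewrite <- Z.mod_pow_l, HW13; reflexivity).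
    pose proof (sixth_mod13 B) as HB. clear - E HW2 HB. lia. }
  assert (T13 : forall P Q, A = qmul1 (-3) P Q (qcube1 0 (-3) g h) (qcube2 0 (-3) g h) ->
    W = qmul2 0 P Q (qcube1 0 (-3) g h) (qcube2 0 (-3) g h) ->
    forallb (fun g => forallb (fun h =>
      let V := qmul1 (-3) P Q (qcube1 0 (-3) g h) (qcube2 0 (-3) g h) mod 13 in
      let W := qmul2 0 P Q (qcube1 0 (-3) g h) (qcube2 0 (-3) g h) mod 13 in
      negb ((W =? 1) && ((V ^ 2 mod 13 =? 3) || (V ^ 2 mod 13 =? 1) || (V ^ 2 mod 13 =? 5))))
      (residues 13)) (residues 13) = true -> False).
  { intros P' Q' HV HW Hchk.
    pose proof (cube_residue_check 13 (-3) P' Q'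
      (fun v w _ _ => negb ((w =? 1) && ((v ^ 2 mod 13 =? 3) || (v ^ 2 mod 13 =? 1) || (v ^ 2 mod 13 =? 5))))%bool
      eq_refl Hchk g h) as K.
    cbv beta in K. rewrite <- HW, <- HV, HW13, Z.mod_pow_l in K.
    destruct_or HV13; rewrite HV13 in K; discriminate. }
  assert (HQ : (Q = 3 \/ Q = -3) /\ (P = 5 \/ P = -5)).
  { clear - B1 B2 HQ3. destruct HQ3 as [q ->]. unfold qnorm in B2.
    assert (Hq : q = -1 \/ q = 0 \/ q = 1) by lia.
    assert (HP : -6 <= P <= 6) by nia.
    assert (HP' : P = -6 \/ P = -5 \/ P = -4 \/ P = -3 \/ P = -2 \/ P = -1 \/ P = 0 \/ P = 1 \/ P = 2 \/
      P = 3 \/ P = 4 \/ P = 5 \/ P = 6) by lia.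
    clear HP B1. destruct_or Hq; subst q; destruct_or HP'; subst P; simpl in B2; lia. }
  destruct HQ as [HQ HP]; destruct HQ, HP; subst P Q; exact (T13 _ _ EV EW eq_refl).
Qed.

(** Here [4 + 3 sqrt 3] up to signs is the only class with 3 dividing [Q]. The second equation,
    involving a cube, forces [s^6 = 1] and hence [R^2 = 1] modulo 13, which excludes this class. *)
Lemma sqrt3_no_cube_norm11 (R s t m : Z) :
  0 <= m -> m mod 3 = 0 -> s mod 2 = 1 -> s mod 3 <> 0 ->
  R ^ 2 + 11 * s ^ 6 = 3 * (2 * 3 ^ m) ^ 2 -> (3 * 3 ^ m) ^ 2 = 11 * s ^ 6 + 2 * t ^ 3 -> m = 0.
Proof.
  intros Hm Hm3 Hs2 Hs3 E F.
  destruct (Z.eq_dec m 0) as [H0 | H0]; [exact H0 | exfalso].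
  set (W := 2 * 3 ^ m) in *.
  destruct (sqrt3_representation 11 7 s R W) as (P & Q & g & h & B1 & B2 & Hg & EV & EW);
    [right; split; reflexivity | exact Hs2 | exact Hs3 | | exact E |].
  { apply rel_prime_mult; [apply rel_prime_not_divide; [exact prime_2 | rewrite Hs2; discriminate]|].
    apply rel_prime_Zpower_r; [exact Hm | apply rel_prime_not_divide; [exact prime_3 | exact Hs3]]. }
  assert (HW3 : W mod 3 = 0).
  { unfold W. replace m with (m - 1 + 1) by ring. rewrite Z.pow_add_r, Z.mul_assoc by (clear - Hm H0; lia).
    apply Z.mod_mul. discriminate. }
  assert (HQ3 : (3 | Q)) by exact (sqrt3_class_mod3 P Q g h R W Hg HW3 EW).
  assert (H13 : 3 ^ m mod 13 = 1).
  { destruct (pow3_mod13 m Hm) as [K | [K | K]]; clear - K Hm3; lia. }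
  assert (HW13 : W mod 13 = 2) by (unfold W; clear - H13; lia).
  assert (HV13 : R mod 13 = 1 \/ R mod 13 = 12).
  { assert (HW2 : W ^ 2 mod 13 = 4) by (rewrite <- Z.mod_pow_l, HW13; reflexivity).
    assert (HF : (3 * 3 ^ m) ^ 2 mod 13 = 9).
    { replace ((3 * 3 ^ m) ^ 2) with (9 * (3 ^ m) ^ 2) by ring.
      assert (K : (3 ^ m) ^ 2 mod 13 = 1) by (rewrite <- Z.mod_pow_l, H13; reflexivity). clear - K. lia. }
    pose proof (sixth_mod13 s) as Hs. pose proof (cube_mod13 t) as Ht.
    assert (HS : s ^ 6 mod 13 = 1).
    { rewrite F in HF. clear - HF Hs Ht. revert HF Hs Ht. generalize (s ^ 6) (t ^ 3). intros S T HF Hs Ht.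
      destruct_or Hs; destruct_or Ht; lia. }
    assert (HR : R ^ 2 mod 13 = 1).
    { clear - E HW2 HS. revert E HW2 HS. generalize (s ^ 6) (R ^ 2) (W ^ 2). intros; lia. }
    rewrite <- Z.mod_pow_l in HR. pose proof (Z.mod_pos_bound R 13 ltac:(lia)) as HRb.
    remember (R mod 13) as r. clear - HR HRb.
    assert (K : r = 0 \/ r = 1 \/ r = 2 \/ r = 3 \/ r = 4 \/ r = 5 \/ r = 6 \/ r = 7 \/ r = 8 \/ r = 9 \/ r = 10 \/
      r = 11 \/ r = 12) by lia.
    destruct_or K; subst r; try discriminate; [left | right]; reflexivity. }
  assert (T13 : forall P Q, R = qmul1 (-3) P Q (qcube1 0 (-3) g h) (qcube2 0 (-3) g h) ->
    W = qmul2 0 P Q (qcube1 0 (-3) g h) (qcube2 0 (-3) g h) ->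
    forallb (fun g => forallb (fun h =>
      let V := qmul1 (-3) P Q (qcube1 0 (-3) g h) (qcube2 0 (-3) g h) mod 13 in
      let W := qmul2 0 P Q (qcube1 0 (-3) g h) (qcube2 0 (-3) g h) mod 13 in
      negb ((W =? 2) && ((V =? 1) || (V =? 12)))) (residues 13)) (residues 13) = true -> False).
  { intros P' Q' HV HW Hchk.
    pose proof (cube_residue_check 13 (-3) P' Q'
      (fun v w _ _ => negb ((w =? 2) && ((v =? 1) || (v =? 12))))%bool eq_refl Hchk g h) as K.
    cbv beta in K. rewrite <- HW, <- HV, HW13 in K.
    destruct HV13 as [HV13 | HV13]; rewrite HV13 in K; discriminate. }
  assert (HQ : (Q = 3 \/ Q = -3) /\ (P = 4 \/ P = -4)).
  { clear - B1 B2 HQ3. destruct HQ3 as [q ->]. unfold qnorm in B2.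
    assert (Hq : q = -2 \/ q = -1 \/ q = 0 \/ q = 1 \/ q = 2) by lia.
    assert (HP : -11 <= P <= 11) by nia.
    assert (HP' : P = -11 \/ P = -10 \/ P = -9 \/ P = -8 \/ P = -7 \/ P = -6 \/ P = -5 \/ P = -4 \/ P = -3 \/ P = -2 \/
      P = -1 \/ P = 0 \/ P = 1 \/ P = 2 \/
      P = 3 \/ P = 4 \/ P = 5 \/ P = 6 \/ P = 7 \/ P = 8 \/ P = 9 \/ P = 10 \/ P = 11) by lia.
    clear HP B1. destruct_or Hq; subst q; destruct_or HP'; subst P; simpl in B2; lia. }
  destruct HQ as [HQ HP]; destruct HQ, HP; subst P Q; exact (T13 _ _ EV EW eq_refl).
Qed.

Lemma sixth_mod4 : forall x, x ^ 6 mod 4 = 0 \/ x ^ 6 mod 4 = 1.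
Proof. residue_lemma 4 (fun a => a ^ 6) (fun r => (r =? 0) || (r =? 1))%bool. Qed.

Lemma sqr_mod4 : forall x, x ^ 2 mod 4 = 0 \/ x ^ 2 mod 4 = 1.
Proof. residue_lemma 4 (fun a => a ^ 2) (fun r => (r =? 0) || (r =? 1))%bool. Qed.

Lemma sixth_mod16 : forall x, x ^ 6 mod 16 = 0 \/ x ^ 6 mod 16 = 1 \/ x ^ 6 mod 16 = 9.
Proof. residue_lemma 16 (fun a => a ^ 6) (fun r => (r =? 0) || (r =? 1) || (r =? 9))%bool. Qed.

Lemma pow_odd (x k : Z) : 0 <= k -> x mod 2 = 1 -> x ^ k mod 2 = 1.
Proof. intros Hk Hx. rewrite <- Z.mod_pow_l, Hx, Z.pow_1_l by exact Hk. reflexivity. Qed.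

Lemma odd_root (x k : Z) : 0 < k -> x ^ k mod 2 = 1 -> x mod 2 = 1.
Proof.
  intros Hk H. apply (odd_divide_odd x (x ^ k)); [|exact H].
  exists (x ^ (k - 1)). rewrite Z.mul_comm, <- Z.pow_succ_r by lia. f_equal. lia.
Qed.

(** * Powers of 3 *)

Lemma base_rel_prime (q d A B n : Z) :
  prime q -> ~ (q | d) -> rel_prime A B -> 0 < n -> A ^ 2 + d * B ^ 6 = q ^ n ->
  rel_prime A q /\ rel_prime B q.
Proof.
  intros Hq Hd HAB Hn E.
  assert (Dn : (q | q ^ n)).
  { exists (q ^ (n - 1)). rewrite Z.mul_comm, <- Z.pow_succ_r by lia. f_equal. lia. }
  assert (H1q : ~ (q | 1)).
  { intros K. apply Z.divide_1_r in K. destruct Hq as [Hq1 _]. clear - K Hq1. lia. }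
  assert (Hpow : forall x k, 0 <= k -> (q | x ^ k) -> (q | x)).
  { intros x k Hk. revert k Hk. refine (natlike_ind _ _ _).
    - intros D. exfalso. exact (H1q D).
    - intros k Hk IH D. rewrite Z.pow_succ_r in D by exact Hk.
      apply prime_mult in D; [tauto | exact Hq]. }
  assert (HA : ~ (q | A)).
  { intros DA. assert (DB : (q | d * B ^ 6)).
    { replace (d * B ^ 6) with (q ^ n - A * A) by (rewrite <- E; ring).
      apply Z.divide_sub_r; [exact Dn | apply Z.divide_mul_l; exact DA]. }
    apply prime_mult in DB; [|exact Hq]. destruct DB as [DB | DB]; [contradiction|].
    apply Hpow in DB; [|lia]. apply H1q. destruct HAB as [_ _ K]. exact (K q DA DB). }
  split; apply rel_prime_sym, prime_rel_prime; try exact Hq; [exact HA|].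
  intros DB. apply HA. apply (Hpow A 2); [lia|].
  replace (A ^ 2) with (q ^ n - B * (d * B ^ 5)) by (rewrite <- E; ring).
  apply Z.divide_sub_r; [exact Dn | apply Z.divide_mul_l; exact DB].
Qed.

Lemma abs_lt_of_sqr (A Q D : Z) : 0 < Q -> 0 < D -> A ^ 2 + D = Q ^ 2 -> - Q < A < Q.
Proof. nia. Qed.

Lemma split_both_odd (A Q D : Z) :
  A mod 2 = 1 -> Q mod 2 = 1 -> rel_prime A Q -> 0 < Q -> 0 < D -> A ^ 2 + D = Q ^ 2 ->
  exists x y, 0 < x /\ 0 < y /\ rel_prime x y /\ x + y = Q /\ y - x = A /\ 4 * (x * y) = D.
Proof.
  intros HA HQ Hcop HQ0 HD E. pose proof (abs_lt_of_sqr A Q D HQ0 HD E) as HAQ.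
  exists ((Q - A) / 2), ((Q + A) / 2).
  assert (H1 : Q - A = 2 * ((Q - A) / 2)) by (clear - HA HQ; lia).
  assert (H2 : Q + A = 2 * ((Q + A) / 2)) by (clear - HA HQ; lia).
  set (x := (Q - A) / 2) in *. set (y := (Q + A) / 2) in *. clearbody x y.
  split; [clear - H1 HAQ; lia|]. split; [clear - H2 HAQ; lia|].
  split.
  { apply rel_prime_intro. intros d D1 D2. destruct Hcop as [_ _ K]. apply K.
    - replace A with (y - x) by (clear - H1 H2; lia). apply Z.divide_sub_r; assumption.
    - replace Q with (y + x) by (clear - H1 H2; lia). apply Z.divide_add_r; assumption. }
  split; [clear - H1 H2; lia|]. split; [clear - H1 H2; lia|].
  transitivity ((Q - A) * (Q + A)); [rewrite H1, H2; ring|].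
  transitivity (Q ^ 2 - A ^ 2); [ring | rewrite <- E; ring].
Qed.

Lemma split_opposite_parity (A Q D : Z) :
  (Q + A) mod 2 = 1 -> rel_prime A Q -> 0 < Q -> 0 < D -> A ^ 2 + D = Q ^ 2 ->
  exists x y, 0 < x /\ 0 < y /\ rel_prime x y /\ x + y = 2 * Q /\ y - x = 2 * A /\ x * y = D /\ x mod 2 = 1 /\ y mod 2 = 1.
Proof.
  intros HA Hcop HQ0 HD E. pose proof (abs_lt_of_sqr A Q D HQ0 HD E) as HAQ.
  exists (Q - A), (Q + A).
  split; [clear - HAQ; lia|]. split; [clear - HAQ; lia|].
  assert (Hx : (Q - A) mod 2 = 1) by (clear - HA; lia).
  split.
  { apply rel_prime_intro. intros d D1 D2.
    assert (Hd : d mod 2 = 1) by (apply (odd_divide_odd d (Q - A)); assumption).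
    assert (K : forall n, (d | 2 * n) -> (d | n)).
    { intros n Dn. apply (odd_divide_pow2 d n 1); [discriminate | exact Hd | rewrite Z.mul_comm; exact Dn]. }
    destruct Hcop as [_ _ H]. apply H; apply K.
    - replace (2 * A) with ((Q + A) - (Q - A)) by ring. apply Z.divide_sub_r; assumption.
    - replace (2 * Q) with ((Q + A) + (Q - A)) by ring. apply Z.divide_add_r; assumption. }
  split; [ring|]. split; [ring|]. split; [|split; assumption].
  transitivity (Q ^ 2 - A ^ 2); [ring | rewrite <- E; ring].
Qed.

Lemma sixths_of_product (c e x y b : Z) :
  0 < c -> 0 < e -> 0 < x -> 0 < y -> rel_prime x y -> (c | x) -> (e | y) -> x * y = c * e * b ^ 6 ->
  exists u v, x = c * u ^ 6 /\ y = e * v ^ 6.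
Proof.
  intros Hc He Hx Hy Hcop [x' Dx] [y' Dy] E.
  destruct (rel_prime_mul_sixth x' y' b) as (u & v & Hu & Hv).
  - clear - Dx Hx Hc. nia.
  - clear - Dy Hy He. nia.
  - apply rel_prime_div with x; [|exists c; rewrite Dx; ring].
    apply rel_prime_sym. apply rel_prime_div with y; [|exists e; rewrite Dy; ring].
    apply rel_prime_sym. exact Hcop.
  - apply (Z.mul_reg_l _ _ (c * e)); [clear - Hc He; nia|].
    rewrite <- E, Dx, Dy. ring.
  - exists u, v. rewrite Dx, Dy, Hu, Hv. split; ring.
Qed.

(** A sixth power is 0 or 1 modulo 9. If either one were 0, then 9 would divide both terms, against
    coprimality. *)
Lemma coprime_sixths_mod9 (c e u v : Z) :
  rel_prime (c * u ^ 6) (e * v ^ 6) -> (c * u ^ 6 + e * v ^ 6) mod 9 = 0 -> (c + e) mod 9 = 0.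
Proof.
  intros Hcop H.
  assert (K : forall a b, (9 | a) -> (9 | a + b) -> (9 | b)).
  { intros a b Da Dab. replace b with (a + b - a) by ring. apply Z.divide_sub_r; assumption. }
  assert (D : (9 | c * u ^ 6 + e * v ^ 6)) by (apply Z.mod_divide; [discriminate | exact H]).
  assert (N : ~ ((9 | c * u ^ 6) /\ (9 | e * v ^ 6))).
  { intros [D1 D2]. destruct Hcop as [_ _ G]. specialize (G 9 D1 D2). destruct G as [k Hk]. clear - Hk. lia. }
  assert (Hu : u ^ 6 mod 9 = 1).
  { destruct (sixth_mod9 u) as [Hu | Hu]; [exfalso | exact Hu].
    assert (D1 : (9 | c * u ^ 6)) by (apply Z.divide_mul_r, Z.mod_divide; [discriminate | exact Hu]).
    apply N. split; [exact D1 | exact (K _ _ D1 D)]. }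
  assert (Hv : v ^ 6 mod 9 = 1).
  { destruct (sixth_mod9 v) as [Hv | Hv]; [exfalso | exact Hv].
    assert (D2 : (9 | e * v ^ 6)) by (apply Z.divide_mul_r, Z.mod_divide; [discriminate | exact Hv]).
    apply N. split; [|exact D2]. rewrite Z.add_comm in D. exact (K _ _ D2 D). }
  rewrite <- H. apply eqmod_iff; [discriminate|].
  assert (Eu : eqmod 9 (u ^ 6) 1) by (apply eqmod_iff; [discriminate | exact Hu]).
  assert (Ev : eqmod 9 (v ^ 6) 1) by (apply eqmod_iff; [discriminate | exact Hv]).
  rewrite Eu, Ev, !Z.mul_1_r. reflexivity.
Qed.

(** The sign [s] records which of the two factors carries [l]; sum and product do not depend on it,
    only the difference does. *)
Lemma prime_coefficient_sixths (l x y b : Z) :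
  prime l -> 0 < x -> 0 < y -> rel_prime x y -> x * y = l * b ^ 6 ->
  exists u v s, (s = 1 \/ s = -1) /\ 0 < l * u ^ 6 /\ 0 < v ^ 6 /\ rel_prime (l * u ^ 6) (v ^ 6) /\
    x + y = l * u ^ 6 + v ^ 6 /\ y - x = s * (v ^ 6 - l * u ^ 6) /\ (x * y) = (l * u ^ 6) * v ^ 6.
Proof.
  intros Hl Hx Hy Hcop E.
  assert (Hl0 : 0 < l) by (destruct Hl as [K _]; clear - K; lia).
  assert (D : (l | x * y)) by (exists (b ^ 6); rewrite E; ring).
  apply prime_mult in D; [|exact Hl]. destruct D as [D | D].
  - destruct (sixths_of_product l 1 x y b) as (u & v & -> & ->); try assumption; try reflexivity.
    { apply Z.divide_1_l. } { rewrite E. ring. }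
    rewrite Z.mul_1_l in *. exists u, v, 1.
    split; [left; reflexivity|]. do 3 (split; [assumption|]). split; [|split]; ring.
  - destruct (sixths_of_product l 1 y x b) as (u & v & -> & ->); try assumption; try reflexivity.
    { apply rel_prime_sym. exact Hcop. } { apply Z.divide_1_l. } { rewrite Z.mul_comm, E. ring. }
    rewrite Z.mul_1_l in *. exists u, v, (-1).
    split; [right; reflexivity|]. do 2 (split; [assumption|]).
    split; [apply rel_prime_sym; assumption|]. split; [|split]; ring.
Qed.

Lemma two_prime_coefficient_sixths_odd (e l x y b : Z) :
  0 <= e -> prime l -> l mod 2 = 1 -> 0 < x -> 0 < y -> rel_prime x y -> y mod 2 = 1 ->
  x * y = 2 ^ e * l * b ^ 6 ->
  exists u v c f, ((c = 2 ^ e * l /\ f = 1) \/ (c = 2 ^ e /\ f = l)) /\ x = c * u ^ 6 /\ y = f * v ^ 6.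
Proof.
  intros He Hl Hl2 Hx Hy Hcop Hy2 E.
  assert (Hl0 : 0 < l) by (destruct Hl as [K _]; clear - K; lia).
  assert (Hp : 0 < 2 ^ e) by (apply Z.pow_pos_nonneg; [reflexivity | exact He]).
  assert (D2 : (2 ^ e | x)).
  { apply Gauss with y; [exists (l * b ^ 6); rewrite Z.mul_comm, E; ring|].
    apply rel_prime_sym, odd_rel_prime_pow2; assumption. }
  assert (D : (l | x * y)) by (exists (2 ^ e * b ^ 6); rewrite E; ring).
  apply prime_mult in D; [|exact Hl]. destruct D as [D | D].
  - destruct (sixths_of_product (2 ^ e * l) 1 x y b) as (u & v & Eu & Ev); try assumption; try reflexivity.
    { clear - Hp Hl0. nia. }
    { destruct D2 as [x' ->]. destruct (Gauss l (2 ^ e) x') as [x'' ->].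
      - rewrite Z.mul_comm. exact D.
      - apply odd_rel_prime_pow2; assumption.
      - exists x''. ring. }
    { apply Z.divide_1_l. } { rewrite E. ring. }
    exists u, v, (2 ^ e * l), 1. split; [left; split; reflexivity | split; assumption].
  - destruct (sixths_of_product (2 ^ e) l x y b) as (u & v & Eu & Ev); try assumption.
    exists u, v, (2 ^ e), l. split; [right; split; reflexivity | split; assumption].
Qed.

Lemma two_prime_coefficient_sixths (e l x y b : Z) :
  0 <= e -> prime l -> l mod 2 = 1 -> 0 < x -> 0 < y -> rel_prime x y -> (x + y) mod 2 = 1 ->
  x * y = 2 ^ e * l * b ^ 6 ->
  exists u v c f s, ((c = 2 ^ e * l /\ f = 1) \/ (c = 2 ^ e /\ f = l)) /\ (s = 1 \/ s = -1) /\
    0 < c * u ^ 6 /\ 0 < f * v ^ 6 /\ rel_prime (c * u ^ 6) (f * v ^ 6) /\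
    x + y = c * u ^ 6 + f * v ^ 6 /\ y - x = s * (f * v ^ 6 - c * u ^ 6) /\ v mod 2 = 1.
Proof.
  intros He Hl Hl2 Hx Hy Hcop Hxy E.
  assert (Hodd : forall f v, f * v ^ 6 mod 2 = 1 -> v mod 2 = 1).
  { intros f v H. apply (odd_root v 6); [reflexivity|].
    apply (odd_divide_odd (v ^ 6) (f * v ^ 6)); [apply Z.divide_factor_r | exact H]. }
  assert (Hpar : y mod 2 = 1 \/ x mod 2 = 1) by (clear - Hxy; lia).
  destruct Hpar as [Hy2 | Hx2].
  - destruct (two_prime_coefficient_sixths_odd e l x y b) as (u & v & c & f & Hcf & -> & ->); try assumption.
    exists u, v, c, f, 1. split; [exact Hcf|]. split; [left; reflexivity|].
    do 3 (split; [assumption|]). split; [ring|]. split; [ring | exact (Hodd _ _ Hy2)].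
  - destruct (two_prime_coefficient_sixths_odd e l y x b) as (u & v & c & f & Hcf & -> & ->); try assumption.
    { apply rel_prime_sym. exact Hcop. } { rewrite Z.mul_comm. exact E. }
    exists u, v, c, f, (-1). split; [exact Hcf|]. split; [right; reflexivity|].
    do 2 (split; [assumption|]). split; [apply rel_prime_sym; exact Hcop|].
    split; [ring|]. split; [ring | exact (Hodd _ _ Hx2)].
Qed.

Lemma pow3_odd k : 0 <= k -> 3 ^ k mod 2 = 1.
Proof. intros Hk. apply pow_odd; [exact Hk | reflexivity]. Qed.

Lemma pow3_pos k : 0 <= k -> 0 < 3 ^ k.
Proof. intros Hk. apply Z.pow_pos_nonneg; [reflexivity | exact Hk]. Qed.

Lemma pow3_large k : 0 <= k -> 3 < 3 ^ k -> 2 <= k.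
Proof.
  intros Hk H. destruct (Z.lt_ge_cases k 2) as [Hlt | Hge]; [exfalso | exact Hge].
  assert (Hk' : k = 0 \/ k = 1) by (clear - Hk Hlt; lia). destruct Hk' as [-> | ->]; simpl in H; lia.
Qed.

Lemma pow3_double n k : 0 <= k -> n = 2 * k -> 3 ^ n = (3 ^ k) ^ 2.
Proof. intros Hk ->. rewrite (Z.mul_comm 2), Z.pow_mul_r by lia. reflexivity. Qed.

Lemma pow3_sum_sixths (m k c f u v : Z) :
  0 <= k -> rel_prime (c * u ^ 6) (f * v ^ 6) -> m * 3 ^ k = c * u ^ 6 + f * v ^ 6 ->
  (c + f) mod 9 <> 0 -> k < 2.
Proof.
  intros Hk Hcop E Hcf. destruct (Z.lt_ge_cases k 2) as [Hlt | Hge]; [exact Hlt | exfalso].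
  apply Hcf, (coprime_sixths_mod9 c f u v Hcop). rewrite <- E.
  rewrite Z.mul_mod, pow3_mod9, Z.mul_0_r by (discriminate || assumption). reflexivity.
Qed.

Lemma even_exponent (d A B n : Z) :
  d mod 4 = 1 -> 0 <= n -> A ^ 2 + d * B ^ 6 = 3 ^ n -> exists k, 0 <= k /\ n = 2 * k.
Proof.
  intros Hd Hn E.
  assert (Hpar : n mod 2 = 0 \/ n mod 2 = 1) by (clear; lia). destruct Hpar as [Hn2 | Hn2].
  - exists (n / 2). clear - Hn Hn2. lia.
  - exfalso.
    assert (K : 3 ^ n mod 4 = 3).
    { rewrite (pow_mod_cycle 4 3 2 n) by (reflexivity || assumption). rewrite Hn2. reflexivity. }
    rewrite <- E in K. pose proof (sqr_mod4 A) as HA. pose proof (sixth_mod4 B) as HB.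
    assert (Hd' : exists d', d = 4 * d' + 1) by (exists (d / 4); clear - Hd; lia). destruct Hd' as [d' ->].
    replace (A ^ 2 + (4 * d' + 1) * B ^ 6) with (A ^ 2 + B ^ 6 + (d' * B ^ 6) * 4) in K by ring.
    rewrite Z.mod_add in K by discriminate. clear - K HA HB. lia.
Qed.

Lemma parity_cases (d A B Q : Z) :
  d mod 2 = 1 -> Q mod 2 = 1 -> A ^ 2 + d * B ^ 6 = Q ->
  (A mod 2 = 1 /\ exists b, B = 2 * b) \/ (A mod 2 = 0 /\ B mod 2 = 1).
Proof.
  intros Hd HQ E.
  assert (HB : B mod 2 = 0 \/ B mod 2 = 1) by (clear; lia).
  assert (HA : A mod 2 = 0 \/ A mod 2 = 1) by (clear; lia).
  assert (Hsum : eqmod 2 (A ^ 2 + d * B ^ 6) 1) by (apply eqmod_iff; [discriminate | rewrite E; exact HQ]).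
  assert (Ed : eqmod 2 d 1) by (apply eqmod_iff; [discriminate | exact Hd]).
  rewrite (eqmod_mod 2 A), (eqmod_mod 2 B), Ed in Hsum by discriminate.
  destruct HA as [HA | HA], HB as [HB | HB]; rewrite HA, HB in Hsum.
  - destruct Hsum as [k Hk]. clear - Hk. exfalso. simpl in Hk. lia.
  - right. split; assumption.
  - left. split; [exact HA|]. exists (B / 2). clear - HB. lia.
  - destruct Hsum as [k Hk]. clear - Hk. exfalso. simpl in Hk. lia.
Qed.

Lemma sixth_pos (B : Z) : B <> 0 -> 0 < B ^ 6.
Proof.
  intros H. replace (B ^ 6) with ((B ^ 3) * (B ^ 3)) by ring.
  assert (B ^ 3 <> 0) by (apply Z.pow_nonzero; [exact H | discriminate]). nia.
Qed.

Lemma rel_prime_pow3 (A k : Z) : 0 <= k -> rel_prime A 3 -> rel_prime A (3 ^ k).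
Proof. intros Hk H. apply rel_prime_Zpower_r; assumption. Qed.

(** * The equations with d = 5, 14 and 17 *)

Lemma not_divide_3_const (d : Z) : d mod 3 <> 0 -> ~ (3 | d).
Proof. intros H D. apply H, Z.mod_divide; [discriminate | exact D]. Qed.

(** For [B] odd, [2 * 3^k = 5 u^6 + v^6] stops at [k = 1] modulo 9. For [B] even, the pairs of
    coefficients [80, 1] and then [4, 5] have sums divisible by 9; in each case residues modulo 16
    make the exponent even and one factors again. The third factoring stops modulo 9 at [n = 8],
    which [79^2 + 5 * 2^6] attains. *)
Lemma solutions_5 (A B n : Z) :
  0 < n -> B <> 0 -> rel_prime A B -> A ^ 2 + 5 * B ^ 6 = 3 ^ n -> n = 2 \/ n = 8.
Proof.
  intros Hn HB Hcop E.
  destruct (base_rel_prime 3 5 A B n prime_3 (not_divide_3_const 5 ltac:(discriminate)) Hcop Hn E) as [HA3 _].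
  destruct (even_exponent 5 A B n eq_refl ltac:(lia) E) as (k & Hk & Hnk).
  rewrite (pow3_double n k Hk Hnk) in E.
  pose proof (pow3_pos k Hk) as HQ. pose proof (pow3_odd k Hk) as HQ2. pose proof (sixth_pos B HB) as HB6.
  pose proof (rel_prime_pow3 A k Hk HA3) as HAQ.
  destruct (parity_cases 5 A B ((3 ^ k) ^ 2)) as [[HA2 [b ->]] | [HA2 HB2]];
    [reflexivity | apply pow_odd; [discriminate | exact HQ2] | exact E | |].
  - right.
    destruct (split_both_odd A (3 ^ k) (5 * (2 * b) ^ 6) HA2 HQ2 HAQ HQ ltac:(lia) E)
      as (x & y & Hx & Hy & Hxy & Hs & Hdiff & Hp).
    destruct (two_prime_coefficient_sixths 4 5 x y b) as (u & v & c & f & s & Hcf & Hs1 & Hu & Hv & Huv & Hsum & Hdif & Hv2);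
      [discriminate | exact prime_5 | reflexivity | exact Hx | exact Hy | exact Hxy | rewrite Hs; exact HQ2 | clear - Hp; lia |].
    rewrite Hs in Hsum.
    assert (Hk2 : 2 <= k).
    { apply pow3_large; [exact Hk|]. clear - Hcf Hu Hv Hsum. destruct Hcf as [[-> ->] | [-> ->]]; lia. }
    destruct Hcf as [[-> ->] | [-> ->]].
    + (* 3^k = 80 u^6 + v^6 *)
      rewrite Z.mul_1_l in *. change (2 ^ 4 * 5) with 80 in *.
      assert (Hv16 : 3 ^ k mod 16 = 1 \/ 3 ^ k mod 16 = 9).
      { pose proof (pow_odd v 6 ltac:(discriminate) Hv2) as Hv6. pose proof (sixth_mod16 v) as Hv16.
        rewrite Hsum. clear - Hv16 Hv6. lia. }
      assert (Hk' : exists j, 0 <= j /\ k = 2 * j).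
      { exists (k / 2). pose proof (pow3_mod16 k Hk) as K. clear - K Hv16 Hk. lia. }
      destruct Hk' as (j & Hj & Hkj). rewrite (pow3_double k j Hj Hkj) in Hsum.
      pose proof (pow3_pos j Hj) as HQj. pose proof (pow3_odd j Hj) as HQj2.
      assert (Hv3 : rel_prime (v ^ 3) (3 ^ j)).
      { apply rel_prime_Zpower; [discriminate | exact Hj |]. apply rel_prime_sym, prime_rel_prime; [exact prime_3|].
        intros [w ->]. destruct Huv as [_ _ K]. assert (D : (3 | 1)); [|destruct D as [k' D]; clear - D; lia].
        assert (Dv : (3 | (w * 3) ^ 6)) by (exists (w * (w * 3) ^ 5); ring).
        apply K; [|exact Dv].
        replace (80 * u ^ 6) with ((3 ^ j) ^ 2 - (w * 3) ^ 6) by (rewrite Hsum; ring).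
        apply Z.divide_sub_r; [|exact Dv].
        replace j with (j - 1 + 1) by ring. rewrite Z.pow_add_r by (clear - Hk2 Hkj; lia).
        exists (3 ^ (j - 1) * (3 ^ (j - 1) * 3)). ring. }
      destruct (split_both_odd (v ^ 3) (3 ^ j) (80 * u ^ 6)) as (x1 & y1 & Hx1 & Hy1 & Hxy1 & Hs' & Hd1 & Hp1);
        [apply pow_odd; [discriminate | exact Hv2] | exact HQj2 | exact Hv3 | exact HQj | exact Hu | rewrite Hsum; ring |].
      destruct (two_prime_coefficient_sixths 2 5 x1 y1 u) as (s6 & t6 & c & f & s' & Hcf & _ & Hs6 & Ht6 & Hst & Hsum1 & _ & Ht2);
        [discriminate | exact prime_5 | reflexivity | exact Hx1 | exact Hy1 | exact Hxy1 | rewrite Hs'; exact HQj2 | clear - Hp1; lia |].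
      rewrite Hs' in Hsum1.
      assert (Hj2 : 2 <= j).
      { apply pow3_large; [exact Hj|]. clear - Hcf Hs6 Ht6 Hsum1. destruct Hcf as [[-> ->] | [-> ->]]; lia. }
      destruct Hcf as [[-> ->] | [-> ->]].
      * pose proof (pow3_sum_sixths 1 j _ _ _ _ Hj Hst ltac:(rewrite Z.mul_1_l; exact Hsum1) ltac:(discriminate)) as K.
        clear - K Hj2. lia.
      * (* 3^j = 4 s^6 + 5 t^6 *)
        change (2 ^ 2) with 4 in *.
        assert (Hj16 : j mod 2 = 0).
        { pose proof (pow_odd t6 6 ltac:(discriminate) Ht2) as H1. pose proof (sixth_mod16 t6) as H2.
          pose proof (sixth_mod16 s6) as H3. pose proof (pow3_mod16 j Hj) as K. rewrite Hsum1 in K.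
          clear - H1 H2 H3 K. lia. }
        assert (Hj' : exists i, 0 <= i /\ j = 2 * i) by (exists (j / 2); clear - Hj Hj16; lia).
        destruct Hj' as (i & Hi & Hji). rewrite (pow3_double j i Hi Hji) in Hsum1.
        pose proof (pow3_pos i Hi) as HQi. pose proof (pow3_odd i Hi) as HQi2.
        assert (Hs3 : rel_prime (2 * s6 ^ 3) (3 ^ i)).
        { apply rel_prime_pow3; [exact Hi|]. apply rel_prime_sym, prime_rel_prime; [exact prime_3|].
          intros D. destruct Hst as [_ _ K]. assert (D1 : (3 | 1)); [|destruct D1 as [k' D1]; clear - D1; lia].
          assert (Ds : (3 | 4 * s6 ^ 6)).
          { replace (4 * s6 ^ 6) with (2 * s6 ^ 3 * (2 * s6 ^ 3)) by ring. apply Z.divide_mul_l. exact D. }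
          apply K; [exact Ds|]. replace (5 * t6 ^ 6) with ((3 ^ i) ^ 2 - 4 * s6 ^ 6) by (rewrite Hsum1; ring).
          apply Z.divide_sub_r; [|exact Ds].
          replace i with (i - 1 + 1) by ring. rewrite Z.pow_add_r by (clear - Hj2 Hji; lia).
          exists (3 ^ (i - 1) * (3 ^ (i - 1) * 3)). ring. }
        destruct (split_opposite_parity (2 * s6 ^ 3) (3 ^ i) (5 * t6 ^ 6)) as (x2 & y2 & Hx2 & Hy2 & Hxy2 & Hs2 & _ & Hp2 & _ & _);
          [clear - HQi2; lia | exact Hs3 | exact HQi | exact Ht6 | rewrite Hsum1; ring |].
        destruct (prime_coefficient_sixths 5 x2 y2 t6 prime_5 Hx2 Hy2 Hxy2 Hp2)
          as (u2 & v2 & s2 & _ & _ & _ & Huv2 & Hsum2 & _).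
        rewrite Hs2 in Hsum2.
        pose proof (pow3_sum_sixths 2 i 5 1 u2 v2 Hi) as K. rewrite Z.mul_1_l in K.
        specialize (K Huv2 Hsum2 ltac:(discriminate)). clear - K Hj2 Hji Hkj Hnk. lia.
    + pose proof (pow3_sum_sixths 1 k _ _ _ _ Hk Huv ltac:(rewrite Z.mul_1_l; exact Hsum) ltac:(discriminate)) as K.
      clear - K Hk2. lia.
  - left.
    destruct (split_opposite_parity A (3 ^ k) (5 * B ^ 6)) as (x & y & Hx & Hy & Hxy & Hs & _ & Hp & _ & _);
      [clear - HA2 HQ2; lia | exact HAQ | exact HQ | lia | exact E |].
    destruct (prime_coefficient_sixths 5 x y B prime_5 Hx Hy Hxy Hp) as (u & v & s & _ & _ & _ & Huv & Hsum & _).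
    rewrite Hs in Hsum.
    pose proof (pow3_sum_sixths 2 k 5 1 u v Hk) as K. rewrite Z.mul_1_l in K.
    specialize (K Huv Hsum ltac:(discriminate)). clear - K Hn Hnk. lia.
Qed.

Lemma not_divide_3_summand (X Y k : Z) :
  0 < k -> rel_prime X Y -> X + Y = 3 ^ k -> ~ (3 | Y).
Proof.
  intros Hk Hcop E D. destruct Hcop as [_ _ K].
  assert (D1 : (3 | 1)); [|destruct D1 as [w Hw]; clear - Hw; lia].
  apply K; [|exact D]. replace X with (3 ^ k - Y) by (rewrite <- E; ring).
  apply Z.divide_sub_r; [|exact D].
  replace k with (k - 1 + 1) by ring. rewrite Z.pow_add_r by (clear - Hk; lia). apply Z.divide_factor_r.
Qed.

(** Modulo 7 the power [3^n] is a square, so [n] is even. Of the possible coefficients only [224, 1]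
    have a sum divisible by 9, and one more factoring leaves [56, 1] and [8, 7], which do not. *)
Lemma no_solution_14 (A B n : Z) :
  0 < n -> B <> 0 -> rel_prime A B -> A ^ 2 + 14 * B ^ 6 = 3 ^ n -> False.
Proof.
  intros Hn HB Hcop E.
  destruct (base_rel_prime 3 14 A B n prime_3 (not_divide_3_const 14 ltac:(discriminate)) Hcop Hn E) as [HA3 _].
  assert (Hk : exists k, 0 <= k /\ n = 2 * k).
  { exists (n / 2). pose proof (sqr_mod7 A) as HA. pose proof (pow3_mod7 n ltac:(clear - Hn; lia)) as K.
    rewrite <- E in K. replace (A ^ 2 + 14 * B ^ 6) with (A ^ 2 + 2 * B ^ 6 * 7) in K by ring.
    rewrite Z.mod_add in K by discriminate. clear - HA K Hn. lia. }
  destruct Hk as (k & Hk & Hnk).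
  rewrite (pow3_double n k Hk Hnk) in E.
  pose proof (pow3_pos k Hk) as HQ. pose proof (pow3_odd k Hk) as HQ2. pose proof (sixth_pos B HB) as HB6.
  pose proof (rel_prime_pow3 A k Hk HA3) as HAQ.
  assert (HA2 : A mod 2 = 1).
  { apply (odd_root A 2); [reflexivity|].
    pose proof (pow_odd _ 2 ltac:(discriminate) HQ2) as K. rewrite <- E in K. clear - K. lia. }
  destruct (split_both_odd A (3 ^ k) (14 * B ^ 6) HA2 HQ2 HAQ HQ ltac:(lia) E)
    as (x & y & Hx & Hy & Hxy & Hs & Hdiff & Hp).
  assert (HB2 : exists b, B = 2 * b).
  { assert (HB2 : B mod 2 = 0 \/ B mod 2 = 1) by (clear; lia). destruct HB2 as [HB2 | HB2].
    - exists (B / 2). clear - HB2. lia.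
    - exfalso. pose proof (pow_odd B 6 ltac:(discriminate) HB2) as K. clear - K Hp. lia. }
  destruct HB2 as [b ->].
  destruct (two_prime_coefficient_sixths 5 7 x y b) as (u & v & c & f & s & Hcf & Hs1 & Hu & Hv & Huv & Hsum & Hdif & Hv2);
    [discriminate | exact prime_7 | reflexivity | exact Hx | exact Hy | exact Hxy | rewrite Hs; exact HQ2 | clear - Hp; lia |].
  rewrite Hs in Hsum.
  assert (Hk2 : 2 <= k).
  { apply pow3_large; [exact Hk|]. clear - Hcf Hu Hv Hsum. destruct Hcf as [[-> ->] | [-> ->]]; lia. }
  destruct Hcf as [[-> ->] | [-> ->]].
  - rewrite Z.mul_1_l in *. change (2 ^ 5 * 7) with 224 in *.
    assert (Hv16 : 3 ^ k mod 16 = 1 \/ 3 ^ k mod 16 = 9).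
    { pose proof (pow_odd v 6 ltac:(discriminate) Hv2) as Hv6. pose proof (sixth_mod16 v) as Hv16.
      rewrite Hsum. clear - Hv16 Hv6. lia. }
    assert (Hk' : exists j, 0 <= j /\ k = 2 * j).
    { exists (k / 2). pose proof (pow3_mod16 k Hk) as K. clear - K Hv16 Hk. lia. }
    destruct Hk' as (j & Hj & Hkj).
    pose proof (not_divide_3_summand _ _ k ltac:(clear - Hk2; lia) Huv (eq_sym Hsum)) as Hv3.
    rewrite (pow3_double k j Hj Hkj) in Hsum.
    pose proof (pow3_pos j Hj) as HQj. pose proof (pow3_odd j Hj) as HQj2.
    assert (Hv3' : rel_prime (v ^ 3) (3 ^ j)).
    { apply rel_prime_Zpower; [discriminate | exact Hj |]. apply rel_prime_sym, prime_rel_prime; [exact prime_3|].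
      intros D. apply Hv3. replace (v ^ 6) with (v * v ^ 5) by ring. apply Z.divide_mul_l. exact D. }
    destruct (split_both_odd (v ^ 3) (3 ^ j) (224 * u ^ 6)) as (x1 & y1 & Hx1 & Hy1 & Hxy1 & Hs' & Hd1 & Hp1);
      [apply pow_odd; [discriminate | exact Hv2] | exact HQj2 | exact Hv3' | exact HQj | exact Hu | rewrite Hsum; ring |].
    destruct (two_prime_coefficient_sixths 3 7 x1 y1 u) as (s6 & t6 & c & f & s' & Hcf & _ & Hs6 & Ht6 & Hst & Hsum1 & _ & Ht2);
      [discriminate | exact prime_7 | reflexivity | exact Hx1 | exact Hy1 | exact Hxy1 | rewrite Hs'; exact HQj2 | clear - Hp1; lia |].
    rewrite Hs' in Hsum1.
    assert (Hj2 : 2 <= j).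
    { apply pow3_large; [exact Hj|]. clear - Hcf Hs6 Ht6 Hsum1. destruct Hcf as [[-> ->] | [-> ->]]; lia. }
    assert (K : j < 2); [|clear - K Hj2; lia].
    apply (pow3_sum_sixths 1 j _ _ _ _ Hj Hst); [rewrite Z.mul_1_l; exact Hsum1|].
    destruct Hcf as [[-> ->] | [-> ->]]; discriminate.
  - pose proof (pow3_sum_sixths 1 k _ _ _ _ Hk Huv ltac:(rewrite Z.mul_1_l; exact Hsum) ltac:(discriminate)) as K.
    clear - K Hk2. lia.
Qed.

(** For [B] odd the coefficients [17, 1] pass modulo 9, and [2 * 3^2 = 17 + 1] is a solution.
    Residues modulo 16 and 13 give [k = 2 j] with [j = 1] modulo 3, and for [j >= 2] the equation
    [(v^3)^2 - 2 (3^j)^2 = -17 u^6] goes to [Z[sqrt 2]]. *)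
Lemma solutions_17 (A B n : Z) :
  0 < n -> B <> 0 -> rel_prime A B -> A ^ 2 + 17 * B ^ 6 = 3 ^ n -> n = 4.
Proof.
  intros Hn HB Hcop E.
  destruct (base_rel_prime 3 17 A B n prime_3 (not_divide_3_const 17 ltac:(discriminate)) Hcop Hn E) as [HA3 _].
  destruct (even_exponent 17 A B n eq_refl ltac:(lia) E) as (k & Hk & Hnk).
  rewrite (pow3_double n k Hk Hnk) in E.
  pose proof (pow3_pos k Hk) as HQ. pose proof (pow3_odd k Hk) as HQ2. pose proof (sixth_pos B HB) as HB6.
  pose proof (rel_prime_pow3 A k Hk HA3) as HAQ.
  destruct (parity_cases 17 A B ((3 ^ k) ^ 2)) as [[HA2 [b ->]] | [HA2 HB2]];
    [reflexivity | apply pow_odd; [discriminate | exact HQ2] | exact E | |].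
  - exfalso.
    destruct (split_both_odd A (3 ^ k) (17 * (2 * b) ^ 6) HA2 HQ2 HAQ HQ ltac:(lia) E)
      as (x & y & Hx & Hy & Hxy & Hs & Hdiff & Hp).
    destruct (two_prime_coefficient_sixths 4 17 x y b) as (u & v & c & f & s & Hcf & Hs1 & Hu & Hv & Huv & Hsum & Hdif & Hv2);
      [discriminate | exact prime_17 | reflexivity | exact Hx | exact Hy | exact Hxy | rewrite Hs; exact HQ2 | clear - Hp; lia |].
    rewrite Hs in Hsum.
    assert (Hk2 : 2 <= k).
    { apply pow3_large; [exact Hk|]. clear - Hcf Hu Hv Hsum. destruct Hcf as [[-> ->] | [-> ->]]; lia. }
    assert (K : k < 2); [|clear - K Hk2; lia].
    apply (pow3_sum_sixths 1 k _ _ _ _ Hk Huv); [rewrite Z.mul_1_l; exact Hsum|].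
    destruct Hcf as [[-> ->] | [-> ->]]; discriminate.
  - destruct (split_opposite_parity A (3 ^ k) (17 * B ^ 6)) as (x & y & Hx & Hy & Hxy & Hs & _ & Hp & Hx2 & Hy2);
      [clear - HA2 HQ2; lia | exact HAQ | exact HQ | lia | exact E |].
    destruct (prime_coefficient_sixths 17 x y B prime_17 Hx Hy Hxy Hp) as (u & v & s & _ & Hu & Hv & Huv & Hsum & _ & Hprod).
    rewrite Hs in Hsum.
    assert (Huv2 : u mod 2 = 1 /\ v mod 2 = 1).
    { assert (Hodd : (x * y) mod 2 = 1) by (rewrite Z.mul_mod, Hx2, Hy2 by discriminate; reflexivity).
      rewrite Hprod in Hodd.
      split; [apply (odd_root u 6) | apply (odd_root v 6)]; try reflexivity.
      - apply (odd_divide_odd _ (17 * u ^ 6 * v ^ 6)); [exists (17 * v ^ 6); ring | exact Hodd].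
      - apply (odd_divide_odd _ (17 * u ^ 6 * v ^ 6)); [exists (17 * u ^ 6); ring | exact Hodd]. }
    destruct Huv2 as [Hu2 Hv2].
    pose proof (pow_odd u 6 ltac:(discriminate) Hu2) as Hu6. pose proof (sixth_mod16 u) as Hu16.
    pose proof (pow_odd v 6 ltac:(discriminate) Hv2) as Hv6. pose proof (sixth_mod16 v) as Hv16.
    assert (Hk' : exists j, 0 <= j /\ k = 2 * j).
    { exists (k / 2). pose proof (pow3_mod16 k Hk) as K. clear - K Hu6 Hu16 Hv6 Hv16 Hsum Hk. lia. }
    destruct Hk' as (j & Hj & Hkj). rewrite (pow3_double k j Hj Hkj) in Hsum.
    assert (Hj3 : j mod 3 = 1).
    { pose proof (sixth_mod13 u) as H1. pose proof (sixth_mod13 v) as H2.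
      pose proof (pow3_mod13 k Hk) as K. rewrite (pow3_double k j Hj Hkj) in K. rewrite Hkj in K.
      clear - H1 H2 K Hsum. revert Hsum H1 H2 K. generalize ((3 ^ j) ^ 2) (u ^ 6) (v ^ 6).
      intros X U V Hsum H1 H2 K. destruct_or K; destruct_or H1; destruct_or H2; lia. }
    destruct (Z.lt_ge_cases j 2) as [Hlt | Hge]; [clear - Hlt Hj Hj3 Hkj Hnk; lia | exfalso].
    apply (sqrt2_no_cube u v j Hge Hj3 Hu2); [|exact Hsum].
    intros Hu3. apply Z.mod_divide in Hu3; [|discriminate]. destruct Hu3 as [w ->].
    destruct Huv as [_ _ K]. assert (D : (3 | 1)); [|destruct D as [k' D]; clear - D; lia].
    assert (Du : (3 | 17 * (w * 3) ^ 6)) by (exists (17 * w * (w * 3) ^ 5); ring).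
    apply K; [exact Du|].
    replace (v ^ 6) with (2 * (3 ^ j) ^ 2 - 17 * (w * 3) ^ 6) by (rewrite Hsum; ring).
    apply Z.divide_sub_r; [|exact Du].
    replace j with (j - 1 + 1) by ring. rewrite Z.pow_add_r by (clear - Hge; lia).
    exists (2 * 3 ^ (j - 1) * (3 ^ (j - 1) * 3)). ring.
Qed.

(** * The descent for d = 2 *)

Lemma rel_prime_add_mul (a b k : Z) : rel_prime a b -> rel_prime a (b + a * k).
Proof.
  intros [_ _ H]. apply rel_prime_intro. intros d D1 D2. apply H; [exact D1|].
  replace b with (b + a * k - a * k) by ring. apply Z.divide_sub_r; [exact D2 | apply Z.divide_mul_l; exact D1].
Qed.

Lemma rel_prime_factor (a b c : Z) : (a | b) -> rel_prime b c -> rel_prime a c.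
Proof. intros D H. apply rel_prime_div with b; assumption. Qed.

(** If [n = 3] modulo 6, then [A + B^3 sqrt -2] is up to sign the cube of some [g + h sqrt -2], and
    [B^3] is up to sign the product of the coprime factors [h] and [3 g^2 - 2 h^2]. With [h = S^3]
    the norm equation [g^2 + 2 h^2 = 3^N] has the original shape. Even [n] fails modulo 9, [n = 5]
    modulo 6 fails modulo 7, and [n = 1] modulo 6 is settled in [Z[sqrt 3]]. *)
Lemma descent_2 (A B n : Z) :
  0 < n -> B <> 0 -> rel_prime A B -> A ^ 2 + 2 * B ^ 6 = 3 ^ n ->
  n = 1 \/ exists N A' B', n = 3 * N /\ B' <> 0 /\ rel_prime A' B' /\ A' ^ 2 + 2 * B' ^ 6 = 3 ^ N.
Proof.
  intros Hn HB Hcop E.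
  destruct (base_rel_prime 3 2 A B n prime_3 (not_divide_3_const 2 ltac:(discriminate)) Hcop Hn E) as [HA3 HB3].
  assert (Hn0 : 0 <= n) by (clear - Hn; lia).
  pose proof (sixth_pos B HB) as HB6.
  assert (HA2 : A mod 2 = 1).
  { apply (odd_root A 2); [reflexivity|]. pose proof (pow3_odd n Hn0) as K. rewrite <- E in K. clear - K. lia. }
  assert (Hpar : n mod 2 = 0 \/ n mod 2 = 1) by (clear; lia). destruct Hpar as [Hn2 | Hn2].
  - exfalso.
    assert (Hk : exists k, 0 <= k /\ n = 2 * k) by (exists (n / 2); clear - Hn Hn2; lia).
    destruct Hk as (k & Hk & Hnk). rewrite (pow3_double n k Hk Hnk) in E.
    pose proof (pow3_pos k Hk) as HQ. pose proof (pow3_odd k Hk) as HQ2.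
    destruct (split_both_odd A (3 ^ k) (2 * B ^ 6) HA2 HQ2 (rel_prime_pow3 A k Hk HA3) HQ ltac:(clear - HB6; lia) E)
      as (x & y & Hx & Hy & Hxy & Hs & _ & Hp).
    assert (HB2 : exists b, B = 2 * b).
    { assert (HB2 : B mod 2 = 0 \/ B mod 2 = 1) by (clear; lia). destruct HB2 as [HB2 | HB2].
      - exists (B / 2). clear - HB2. lia.
      - exfalso. pose proof (pow_odd B 6 ltac:(discriminate) HB2) as K. clear - K Hp. lia. }
    destruct HB2 as [b ->].
    assert (Hp' : x * y = 32 * 1 * b ^ 6) by (clear - Hp; lia).
    assert (K : exists u v, rel_prime (32 * u ^ 6) (1 * v ^ 6) /\ 0 < 32 * u ^ 6 /\ 0 < 1 * v ^ 6 /\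
      1 * 3 ^ k = 32 * u ^ 6 + 1 * v ^ 6).
    { assert (Hodd : y mod 2 = 1 \/ x mod 2 = 1) by (clear - Hs HQ2; lia).
      destruct Hodd as [Hy2 | Hx2].
      - destruct (sixths_of_product 32 1 x y b) as (u & v & -> & ->); try assumption; try reflexivity.
        { apply Gauss with y; [exists (b ^ 6); rewrite Z.mul_comm, Hp'; ring|].
          apply rel_prime_sym. apply (odd_rel_prime_pow2 y 5); [discriminate | exact Hy2]. }
        { apply Z.divide_1_l. }
        exists u, v. split; [exact Hxy|]. split; [exact Hx|]. split; [exact Hy|]. rewrite Z.mul_1_l, <- Hs. reflexivity.
      - destruct (sixths_of_product 32 1 y x b) as (u & v & -> & ->); try assumption; try reflexivity.
        { apply rel_prime_sym. exact Hxy. }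
        { apply Gauss with x; [exists (b ^ 6); rewrite Hp'; ring|].
          apply rel_prime_sym. apply (odd_rel_prime_pow2 x 5); [discriminate | exact Hx2]. }
        { apply Z.divide_1_l. } { rewrite Z.mul_comm. exact Hp'. }
        exists u, v. split; [apply rel_prime_sym; exact Hxy|]. split; [exact Hy|]. split; [exact Hx|].
        rewrite Z.mul_1_l, <- Hs. apply Z.add_comm. }
    destruct K as (u & v & Huv & Hu & Hv & Hsum).
    pose proof (pow3_sum_sixths 1 k 32 1 u v Hk Huv Hsum ltac:(discriminate)) as K.
    pose proof (pow3_large k Hk ltac:(clear - Hsum Hu Hv; lia)) as K2. clear - K K2. lia.
  - assert (Hm : exists m, 0 <= m /\ n = 2 * m + 1) by (exists (n / 2); clear - Hn Hn2; lia).
    destruct Hm as (m & Hm & Hnm).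
    assert (HB3' : B mod 3 <> 0).
    { intros K. apply Z.mod_divide in K; [|discriminate]. destruct HB3 as [_ _ G].
      specialize (G 3 K (Z.divide_refl 3)). destruct G as [w Hw]. clear - Hw. lia. }
    assert (HB2 : B mod 2 = 1).
    { assert (HB2 : B mod 2 = 0 \/ B mod 2 = 1) by (clear; lia). destruct HB2 as [HB2 | HB2]; [exfalso | exact HB2].
      assert (Hb : exists b, B = 2 * b) by (exists (B / 2); clear - HB2; lia). destruct Hb as [b ->].
      assert (K : 3 ^ n mod 4 = 3) by (rewrite (pow_mod_cycle 4 3 2 n) by (reflexivity || assumption); rewrite Hn2; reflexivity).
      rewrite <- E in K. replace (A ^ 2 + 2 * (2 * b) ^ 6) with (A ^ 2 + 32 * b ^ 6 * 4) in K by ring.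
      rewrite Z.mod_add in K by discriminate. pose proof (sqr_mod4 A) as K2. clear - K K2. lia. }
    assert (Hn6 : n mod 6 = 1 \/ n mod 6 = 3).
    { pose proof (sqr_mod7 A) as H1. pose proof (sixth_mod7 B) as H2. pose proof (pow3_mod7 n Hn0) as K.
      rewrite <- E in K. clear - H1 H2 K Hn2. revert H1 H2 K. generalize (A ^ 2) (B ^ 6). intros a b H1 H2 K.
      destruct_or K; try (clear - K Hn2; lia). destruct K as [K1 K]. clear - H1 H2 K. lia. }
    destruct Hn6 as [Hn6 | Hn6].
    + left. assert (Hm0 : m = 0); [|clear - Hm0 Hnm; lia].
      apply (sqrt3_no_cube_norm2 A B m Hm); [clear - Hn6 Hnm; lia | exact HB2 | exact HB3' |].
      rewrite E, Hnm, Z.pow_add_r, (Z.mul_comm 2), Z.pow_mul_r by (clear - Hm; lia). ring.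
    + right. assert (HN : exists N, 0 <= N /\ n = 3 * N) by (exists (n / 3); clear - Hn Hn6; lia).
      destruct HN as (N & HN0 & HN).
      assert (HU3 : forall a, rel_prime a 3 -> rel_prime a (3 ^ N)) by (intros; apply rel_prime_pow3; assumption).
      destruct (norm_eq_cube 0 2 A (B ^ 3) (3 ^ N) 1) as (P & Q & g & h & N1 & N2 & EA & EB).
      { right. right. left. reflexivity. }
      { apply Z.pow_nonzero; [discriminate | exact HN0]. }
      { apply HU3, rel_prime_sym, rel_prime_Zpower_r; [discriminate | apply rel_prime_sym; exact HB3]. }
      { apply HU3, rel_prime_not_divide; [exact prime_3 | discriminate]. }
      { unfold qnorm. transitivity (A ^ 2 + 2 * B ^ 6); [ring|].
        rewrite E, HN, (Z.mul_comm 3), Z.pow_mul_r, Z.mul_1_l by (discriminate || assumption). reflexivity. }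
      assert (HPQ : Q = 0 /\ (P = 1 \/ P = -1)).
      { clear - N2. unfold qnorm in N2. assert (Q = 0) by nia. subst Q. split; [reflexivity | nia]. }
      destruct HPQ as [-> HP].
      assert (EB' : (P * B) ^ 3 = h * (3 * g ^ 2 - 2 * h ^ 2)).
      { transitivity (P * P * (P * (B ^ 3))); [ring|]. rewrite EB. unfold qmul2, qcube2.
        destruct HP as [-> | ->]; ring. }
      assert (Hgh : rel_prime g h).
      { apply rel_prime_intro. intros d D1 D2.
        assert (HAB3 : rel_prime A (B ^ 3)) by (apply rel_prime_Zpower_r; [discriminate | exact Hcop]).
        destruct HAB3 as [_ _ G]. apply G.
        - rewrite EA. unfold qmul1, qcube1. replace (P * _ - _) with (g * (P * (g ^ 2 - 6 * h ^ 2))) by ring.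
          apply Z.divide_mul_l. exact D1.
        - rewrite EB. unfold qmul2, qcube2. replace (P * _ + _ + _) with (h * (P * (3 * g ^ 2 - 2 * h ^ 2))) by ring.
          apply Z.divide_mul_l. exact D2. }
      assert (Hh3 : rel_prime h 3).
      { apply (rel_prime_factor h ((P * B) ^ 3)); [rewrite EB'; apply Z.divide_factor_l|].
        apply rel_prime_sym, rel_prime_Zpower_r; [discriminate|].
        apply rel_prime_mult; [|apply rel_prime_sym; exact HB3].
        apply rel_prime_sym. destruct HP as [-> | ->]; apply rel_prime_not_divide; (exact prime_3 || discriminate). }
      destruct (rel_prime_mul_cube h (3 * g ^ 2 - 2 * h ^ 2) (P * B)) as [S HS]; [|symmetry; exact EB'|].
      { replace (3 * g ^ 2 - 2 * h ^ 2) with (3 * g ^ 2 + h * (-2 * h)) by ring. apply rel_prime_add_mul.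
        apply rel_prime_mult; [exact Hh3|]. apply rel_prime_Zpower_r; [discriminate | apply rel_prime_sym; exact Hgh]. }
      exists N, g, S. split; [exact HN|]. split.
      { intros ->. assert (K : (P * B) ^ 3 = 0) by (rewrite EB', HS; ring).
        apply Z.pow_eq_0 in K; [|discriminate]. destruct HP as [-> | ->]; clear - K HB; lia. }
      split.
      { apply rel_prime_sym. apply (rel_prime_factor S h); [rewrite HS; exists (S ^ 2); ring | apply rel_prime_sym; exact Hgh]. }
      assert (Hpos : 0 < 3 ^ N) by (apply pow3_pos; exact HN0).
      clear - N1 HS Hpos. unfold qnorm in N1. rewrite (Z.abs_eq (3 ^ N)) in N1 by (clear - Hpos; lia).
      rewrite <- N1, Z.abs_eq by (clear; nia). rewrite HS. ring.
Qed.

(** Each step of the descent removes a factor 3 from [n], so a prime [p >= 5] would remain a divisor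
    down to [n = 1]. *)
Lemma no_prime_factor_2 (p A B n : Z) :
  prime p -> 5 <= p -> 0 < n -> B <> 0 -> rel_prime A B -> A ^ 2 + 2 * B ^ 6 = 3 ^ n -> ~ (p | n).
Proof.
  intros Hp Hp5 Hn. revert A B. remember (Z.to_nat n) as k eqn:Hk. revert n Hn Hk.
  induction k as [k IH] using lt_wf_ind. intros n Hn Hk A B HB Hcop E D.
  destruct (descent_2 A B n Hn HB Hcop E) as [-> | (N & A' & B' & HN & HB' & Hcop' & E')].
  - apply Z.divide_1_r in D. clear - D Hp5. lia.
  - apply (IH (Z.to_nat N) ltac:(clear - Hn HN Hk; lia) N ltac:(clear - Hn HN; lia) eq_refl A' B' HB' Hcop' E').
    apply Gauss with 3; [rewrite <- HN; exact D|]. apply prime_rel_prime; [exact Hp|].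
    intros D3. apply Z.divide_pos_le in D3; [clear - D3 Hp5; lia | reflexivity].
Qed.

(** * The descent for d = 11 *)

Lemma norm_11_small (P Q r : Z) : qnorm 1 3 P (2 * Q) = r -> r < 11 -> Q = 0 /\ P * P = r.
Proof.
  unfold qnorm. intros E Hr.
  assert (K : (P + Q) * (P + Q) + 11 * (Q * Q) = r) by (rewrite <- E; ring).
  assert (Q = 0) by (clear - K Hr; nia). subst Q. split; [reflexivity | rewrite <- E; ring].
Qed.

(** Modulo 2 the order is the field with four elements, where every nonzero cube is 1. *)
Lemma qcube2_11_even (g h : Z) : exists k, qcube2 1 3 g h = 2 * k.
Proof.
  exists (qcube2 1 3 g h / 2).
  assert (H : qcube2 1 3 g h mod 2 = 0); [|clear - H; lia].
  assert (Hg : g mod 2 = 0 \/ g mod 2 = 1) by (clear; lia).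
  assert (Hh : h mod 2 = 0 \/ h mod 2 = 1) by (clear; lia).
  change 0 with (0 mod 2). apply eqmod_iff; [discriminate|]. unfold qcube2.
  rewrite (eqmod_mod 2 g), (eqmod_mod 2 h) by discriminate.
  destruct Hg as [-> | ->], Hh as [-> | ->]; apply eqmod_iff; (discriminate || reflexivity).
Qed.

(** Write [n = 3 N + r]. As cubes have even second coordinate, the factor of norm [3^r] lies in
    [Z[sqrt -11]], where a norm below 11 is the square of a rational integer. So [r] is 0 or 2, and
    [r = 2] would make [B] divisible by 3. *)
Lemma cube_root_11 (A B n : Z) :
  0 < n -> rel_prime B 3 -> A ^ 2 + 11 * B ^ 6 = 3 ^ n ->
  exists N g h e, (e = 1 \/ e = -1) /\ 0 < N /\ n = 3 * N /\ qnorm 1 3 g h = 3 ^ N /\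
    2 * (e * B) ^ 3 = h * (3 * g ^ 2 + 3 * g * h - 2 * h ^ 2).
Proof.
  intros Hn HB3 E.
  assert (HN : exists N r, 0 <= N /\ n = 3 * N + r /\ (r = 0 \/ r = 1 \/ r = 2)).
  { exists (n / 3), (n mod 3). clear - Hn. lia. }
  destruct HN as (N & r & HN0 & HN & Hr).
  assert (HU3 : forall a, rel_prime a 3 -> rel_prime a (3 ^ N)) by (intros; apply rel_prime_pow3; assumption).
  assert (H23 : rel_prime 2 3) by (apply rel_prime_not_divide; [exact prime_3 | discriminate]).
  (* With [om = (1 + sqrt -11) / 2], these are the coordinates of [A + B^3 sqrt -11]. *)
  destruct (norm_eq_cube 1 3 (A - B ^ 3) (2 * B ^ 3) (3 ^ N) (3 ^ r)) as (P & Q & g & h & N1 & N2 & EX & EW).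
  { right. right. right. right. reflexivity. }
  { apply Z.pow_nonzero; [discriminate | exact HN0]. }
  { apply HU3. apply rel_prime_sym, rel_prime_mult; [apply rel_prime_sym; exact H23|].
    apply rel_prime_Zpower_r; [discriminate | apply rel_prime_sym; exact HB3]. }
  { apply HU3, rel_prime_not_divide; [exact prime_3 | discriminate]. }
  { unfold qnorm. transitivity (A ^ 2 + 11 * B ^ 6); [ring|].
    rewrite E, HN, (Z.mul_comm 3), Z.pow_add_r, Z.pow_mul_r by (clear - HN0 Hr; lia). ring. }
  destruct (qcube2_11_even g h) as [H' EH].
  set (G := qcube1 1 3 g h) in *. rewrite EH in EX, EW. unfold qmul1 in EX. unfold qmul2 in EW.
  assert (HX : (A - B ^ 3) mod 2 = 1).
  { assert (K : (A ^ 2 + 11 * B ^ 6) mod 2 = 1) by (rewrite E; apply pow3_odd; clear - Hn; lia).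
    replace (A ^ 2 + 11 * B ^ 6) with ((A - B ^ 3) * (A - B ^ 3) + 2 * (A * B ^ 3 + 5 * B ^ 6)) in K by ring.
    apply (odd_divide_odd (A - B ^ 3) ((A - B ^ 3) * (A - B ^ 3))); [apply Z.divide_factor_l|]. clear - K. lia. }
  assert (HPG : (P * G) mod 2 = 1).
  { rewrite EX in HX. replace (P * G - 3 * Q * (2 * H')) with (P * G + (-3 * Q * H') * 2) in HX by ring.
    rewrite Z.mod_add in HX by discriminate. exact HX. }
  assert (HQ2 : (2 | Q)).
  { assert (D : (2 | Q * G)) by (exists (B ^ 3 - P * H' - Q * H'); clear - EW; lia).
    apply (prime_mult 2 prime_2) in D. destruct D as [D | D]; [exact D | exfalso].
    apply (Z.divide_mul_r _ P) in D. apply Z.mod_divide in D; [|discriminate]. rewrite D in HPG. discriminate. }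
  destruct HQ2 as [q ->]. rewrite (Z.mul_comm q 2) in N2, EX, EW.
  assert (Hpos : forall x y, 0 <= qnorm 1 3 x y).
  { intros x y. unfold qnorm. assert (K : 4 * (x * x + 1 * x * y + 3 * y * y) = (2 * x + y) * (2 * x + y) + 11 * (y * y)) by ring.
    clear - K. nia. }
  rewrite !Z.abs_eq in N1, N2 by (apply Hpos || (apply Z.pow_nonneg; discriminate)).
  assert (Hr11 : 3 ^ r < 11) by (destruct_or Hr; subst r; reflexivity).
  destruct (norm_11_small P q (3 ^ r) N2 Hr11) as [-> HPP].
  assert (Hr0 : r = 0 /\ (P = 1 \/ P = -1)).
  { destruct_or Hr; subst r.
    - split; [reflexivity|]. clear - HPP. simpl in HPP. nia.
    - exfalso. clear - HPP. simpl in HPP. assert (-2 <= P <= 2) by nia.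
      assert (K : P = -2 \/ P = -1 \/ P = 0 \/ P = 1 \/ P = 2) by lia. destruct_or K; subst P; lia.
    - exfalso. assert (D : (3 | P)).
      { assert (D : (3 | P * P)) by (rewrite HPP; exists 3; reflexivity). apply (prime_mult 3 prime_3) in D. tauto. }
      destruct D as [P' ->]. assert (D : (3 | 2 * B ^ 3)) by (exists (P' * (2 * H')); rewrite EW; ring).
      apply (prime_mult 3 prime_3) in D. destruct D as [D | D].
      + destruct D as [w Hw]. clear - Hw. lia.
      + assert (HB33 : rel_prime (B ^ 3) 3) by (apply rel_prime_sym, rel_prime_Zpower_r; [discriminate | apply rel_prime_sym; exact HB3]).
        destruct HB33 as [_ _ K]. specialize (K 3 D (Z.divide_refl 3)). destruct K as [w Hw]. clear - Hw. lia. }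
  destruct Hr0 as [-> HP].
  exists N, g, h, P. split; [exact HP|]. split; [clear - Hn HN; lia|]. split; [clear - HN; lia|]. split; [exact N1|].
  transitivity (P * P * (P * (2 * B ^ 3))); [ring|]. rewrite EW.
  transitivity (P * P * (P * P) * (2 * H')); [ring|]. rewrite <- EH. unfold qcube2.
  destruct HP as [-> | ->]; ring.
Qed.

Lemma qnorm_11_mod3 (g h N : Z) : 0 < N -> qnorm 1 3 g h = 3 ^ N -> rel_prime h 3 -> rel_prime (2 * g + h) 3.
Proof.
  intros HN E Hh. apply rel_prime_sym, prime_rel_prime; [exact prime_3|]. intros D.
  assert (D3 : (3 | 3 ^ N)).
  { replace N with (N - 1 + 1) by ring. rewrite Z.pow_add_r by (clear - HN; lia). apply Z.divide_factor_r. }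
  assert (D' : (3 | 11 * (h * h))).
  { replace (11 * (h * h)) with (4 * 3 ^ N - (2 * g + h) * (2 * g + h)) by (rewrite <- E; unfold qnorm; ring).
    apply Z.divide_sub_r; [apply Z.divide_mul_r; exact D3 | apply Z.divide_mul_l; exact D]. }
  apply (prime_mult 3 prime_3) in D'. destruct D' as [[w Hw] | D']; [clear - Hw; lia|].
  assert (D1 : (3 | h)) by (apply (prime_mult 3 prime_3) in D'; tauto).
  destruct Hh as [_ _ K]. specialize (K 3 D1 (Z.divide_refl 3)). destruct K as [w Hw]. clear - Hw. lia.
Qed.

Lemma odd_case_11 (g h s t N : Z) :
  0 < N -> qnorm 1 3 g h = 3 ^ N -> h mod 2 = 1 -> rel_prime h 3 -> h = s ^ 3 ->
  3 * g ^ 2 + 3 * g * h - 2 * h ^ 2 = 2 * t ^ 3 -> N = 1 \/ N = 2.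
Proof.
  intros HN E Hh2 Hh3 Hs Ht.
  set (R := 2 * g + h).
  assert (HR3 : rel_prime R 3) by exact (qnorm_11_mod3 g h N HN E Hh3).
  assert (HR2 : R mod 2 = 1) by (unfold R; clear - Hh2; lia).
  assert (HN0 : 0 <= N) by (clear - HN; lia).
  assert (ER : R ^ 2 + 11 * s ^ 6 = 4 * 3 ^ N).
  { rewrite <- E. replace (s ^ 6) with (s ^ 3 * s ^ 3) by ring. rewrite <- Hs. unfold R, qnorm. ring. }
  assert (ET : 3 * 3 ^ N = 11 * s ^ 6 + 2 * t ^ 3).
  { rewrite <- Ht, <- E. replace (s ^ 6) with (s ^ 3 * s ^ 3) by ring. rewrite <- Hs. unfold qnorm. ring. }
  assert (Hs2 : s mod 2 = 1) by (apply (odd_root s 3); [reflexivity | rewrite <- Hs; exact Hh2]).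
  assert (Hs3 : s mod 3 <> 0).
  { intros K. apply Z.mod_divide in K; [|discriminate].
    destruct Hh3 as [_ _ G]. specialize (G 3). destruct G as [w Hw]; [|apply Z.divide_refl | clear - Hw; lia].
    rewrite Hs. replace (s ^ 3) with (s * s ^ 2) by ring. apply Z.divide_mul_l. exact K. }
  assert (Hpar : N mod 2 = 0 \/ N mod 2 = 1) by (clear; lia). destruct Hpar as [HN2 | HN2].
  - right. assert (Hk : exists k, 0 <= k /\ N = 2 * k) by (exists (N / 2); clear - HN HN2; lia).
    destruct Hk as (k & Hk & Hnk).
    assert (Hs6 : 0 < s ^ 6) by (apply sixth_pos; intros ->; discriminate).
    destruct (split_opposite_parity R (2 * 3 ^ k) (11 * s ^ 6)) as (x & y & Hx & Hy & Hxy & Hsum & _ & Hp & _ & _).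
    { clear - HR2. lia. }
    { apply rel_prime_mult; [apply rel_prime_not_divide; [exact prime_2 | rewrite HR2; discriminate]|].
      apply rel_prime_pow3; assumption. }
    { pose proof (pow3_pos k Hk) as K. clear - K. lia. }
    { clear - Hs6. lia. }
    { rewrite ER, (pow3_double N k Hk Hnk). ring. }
    destruct (prime_coefficient_sixths 11 x y s prime_11 Hx Hy Hxy Hp) as (u & v & e & _ & _ & _ & Huv & Hsum' & _).
    rewrite Hsum in Hsum'.
    pose proof (pow3_sum_sixths 4 k 11 1 u v Hk) as K. rewrite Z.mul_1_l in K.
    assert (K' : k < 2) by (apply K; [exact Huv | rewrite <- Hsum'; ring | discriminate]).
    clear - K' Hnk HN. lia.
  - left.
    assert (HN6 : N mod 6 = 1 \/ N mod 6 = 3).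
    { pose proof (sixth_mod7 s) as H1. pose proof (cube_mod7 t) as H2. pose proof (pow3_mod7 N HN0) as K.
      clear - H1 H2 K ET HN2. revert ET H1 H2 K. generalize (s ^ 6) (t ^ 3) (3 ^ N). intros S T X ET H1 H2 K.
      assert (HX : X mod 7 <> 5) by (destruct_or H1; destruct_or H2; lia).
      clear ET H1 H2. destruct_or K; lia. }
    destruct HN6 as [HN6 | HN6].
    + assert (Hm : exists m, 0 <= m /\ N = 2 * m + 1) by (exists (N / 2); clear - HN HN2; lia).
      destruct Hm as (m & Hm & HNm).
      assert (EN : 3 ^ N = 3 * (3 ^ m) ^ 2).
      { rewrite HNm, Z.pow_add_r, (Z.mul_comm 2), Z.pow_mul_r by (clear - Hm; lia). ring. }
      assert (Hm0 : m = 0); [|clear - Hm0 HNm; lia].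
      apply (sqrt3_no_cube_norm11 R s t m Hm); [clear - HN6 HNm; lia | exact Hs2 | exact Hs3 | |].
      * rewrite ER, EN. ring.
      * rewrite <- ET, EN. ring.
    + exfalso. assert (HM : exists M, 0 <= M /\ N = 3 * M) by (exists (N / 3); clear - HN HN6; lia).
      destruct HM as (M & HM0 & HM).
      assert (HU3 : forall a, rel_prime a 3 -> rel_prime a (3 ^ M)) by (intros; apply rel_prime_pow3; assumption).
      destruct (norm_eq_cube 1 3 g h (3 ^ M) 1) as (P & Q & g1 & h1 & N1 & N2 & EG & EH).
      { right. right. right. right. reflexivity. }
      { apply Z.pow_nonzero; [discriminate | exact HM0]. }
      { apply HU3. exact Hh3. }
      { apply HU3, rel_prime_not_divide; [exact prime_3 | discriminate]. }
      { rewrite E, HM, (Z.mul_comm 3), Z.pow_mul_r, Z.mul_1_l by (discriminate || assumption). reflexivity. }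
      assert (HQ : Q = 0).
      { clear - N2. unfold qnorm in N2.
        assert (K : 4 * (P * P + 1 * P * Q + 3 * Q * Q) = (2 * P + Q) * (2 * P + Q) + 11 * (Q * Q)) by ring.
        assert (K2 : P * P + 1 * P * Q + 3 * Q * Q <= 1) by lia. nia. }
      destruct (qcube2_11_even g1 h1) as [k Ek]. rewrite HQ, Ek in EH. unfold qmul2 in EH.
      rewrite EH in Hh2. replace (P * (2 * k) + 0 * qcube1 1 3 g1 h1 + 1 * 0 * (2 * k)) with (P * k * 2) in Hh2 by ring.
      rewrite Z.mod_mul in Hh2 by discriminate. discriminate.
Qed.

(** The parity of [h] decides. If [h = 2 h'], the cube root is [(g + h') + h' sqrt -11], and [h'] is
    a cube as a coprime factor of a cube, which gives a smaller solution. If [h] is odd, both [h]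
    and half of its cofactor are cubes, and [N] is 1 or 2. *)
Lemma descent_11 (A B n : Z) :
  0 < n -> B <> 0 -> rel_prime A B -> A ^ 2 + 11 * B ^ 6 = 3 ^ n ->
  exists N, 0 < N /\ n = 3 * N /\ (N = 1 \/ N = 2 \/
    exists A' B', B' <> 0 /\ rel_prime A' B' /\ A' ^ 2 + 11 * B' ^ 6 = 3 ^ N).
Proof.
  intros Hn HB Hcop E.
  destruct (base_rel_prime 3 11 A B n prime_3 (not_divide_3_const 11 ltac:(discriminate)) Hcop Hn E) as [_ HB3].
  destruct (cube_root_11 A B n Hn HB3 E) as (N & g & h & e & He & HN & HnN & Enorm & EB).
  exists N. split; [exact HN|]. split; [exact HnN|].
  assert (He3 : rel_prime e 3) by (destruct He as [-> | ->]; apply rel_prime_not_divide; (exact prime_3 || discriminate)).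
  assert (HeB3 : rel_prime ((e * B) ^ 3) 3).
  { apply rel_prime_sym, rel_prime_Zpower_r; [discriminate|].
    apply rel_prime_mult; apply rel_prime_sym; assumption. }
  assert (HeB : e * B <> 0) by (destruct He as [-> | ->]; clear - HB; lia).
  assert (Hh3 : rel_prime h 3).
  { apply (rel_prime_factor h (2 * (e * B) ^ 3)); [rewrite EB; apply Z.divide_factor_l|].
    apply rel_prime_sym, rel_prime_mult; [|apply rel_prime_sym; exact HeB3].
    apply rel_prime_not_divide; [exact prime_2 | discriminate]. }
  assert (Hgh : rel_prime h g).
  { apply rel_prime_intro. intros d D1 D2.
    assert (D : (d | 3 ^ N)).
    { rewrite <- Enorm. unfold qnorm. apply Z.divide_add_r; [apply Z.divide_add_r|].
      - apply Z.divide_mul_l. exact D2.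
      - apply Z.divide_mul_r. exact D1.
      - apply Z.divide_mul_r. exact D1. }
    assert (K : rel_prime h (3 ^ N)) by (apply rel_prime_pow3; [clear - HN; lia | exact Hh3]).
    destruct K as [_ _ K]. exact (K d D1 D). }
  assert (HF : rel_prime h (3 * g ^ 2)).
  { apply rel_prime_mult; [exact Hh3|]. apply rel_prime_Zpower_r; [discriminate | exact Hgh]. }
  assert (Hh2 : h mod 2 = 0 \/ h mod 2 = 1) by (clear; lia).
  destruct Hh2 as [Hh2 | Hh2].
  - right. right.
    assert (Hh' : exists h', h = 2 * h') by (exists (h / 2); clear - Hh2; lia). destruct Hh' as [h' Hh'].
    assert (Hfac : (h' | h)) by (exists 2; exact Hh').
    destruct (rel_prime_mul_cube h' (3 * g ^ 2 + h' * (6 * g - 8 * h')) (e * B)) as [S HS].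
    { apply rel_prime_add_mul. apply (rel_prime_factor h' h); assumption. }
    { apply (Z.mul_reg_l _ _ 2); [discriminate|]. rewrite EB, Hh'. ring. }
    exists (g + h'), S. split.
    { intros ->. apply HeB. apply (Z.pow_eq_0 _ 3); [discriminate|].
      apply (Z.mul_reg_l _ _ 2); [discriminate|]. rewrite EB, Hh', HS. ring. }
    split.
    { apply rel_prime_sym. apply (rel_prime_factor S h'); [rewrite HS; exists (S ^ 2); ring|].
      replace (g + h') with (g + h' * 1) by ring. apply rel_prime_add_mul. apply (rel_prime_factor h' h); assumption. }
    rewrite <- Enorm, Hh'. replace (S ^ 6) with (S ^ 3 * S ^ 3) by ring. rewrite <- HS. unfold qnorm. ring.
  - assert (HF2 : exists F, 3 * g ^ 2 + 3 * g * h - 2 * h ^ 2 = 2 * F).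
    { assert (D : (2 | h * (3 * g ^ 2 + 3 * g * h - 2 * h ^ 2))) by (rewrite <- EB; apply Z.divide_factor_l).
      apply (prime_mult 2 prime_2) in D. destruct D as [D | [F D]].
      - apply Z.mod_divide in D; [congruence | discriminate].
      - exists F. rewrite D. ring. }
    destruct HF2 as [F HF2].
    assert (HhF : rel_prime h F).
    { apply rel_prime_sym. apply (rel_prime_factor F (2 * F)); [apply Z.divide_factor_r|].
      rewrite <- HF2. apply rel_prime_sym.
      replace (3 * g ^ 2 + 3 * g * h - 2 * h ^ 2) with (3 * g ^ 2 + h * (3 * g - 2 * h)) by ring.
      apply rel_prime_add_mul. exact HF. }
    assert (Eprod : h * F = (e * B) ^ 3).
    { apply (Z.mul_reg_l _ _ 2); [discriminate|]. rewrite EB, HF2. ring. }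
    destruct (rel_prime_mul_cube h F (e * B) HhF Eprod) as [s Hs].
    destruct (rel_prime_mul_cube F h (e * B) (rel_prime_sym _ _ HhF)) as [t Ht]; [rewrite Z.mul_comm; exact Eprod|].
    rewrite Ht in HF2.
    destruct (odd_case_11 g h s t N HN Enorm Hh2 Hh3 Hs HF2) as [H | H]; [left | right; left]; exact H.
Qed.

Lemma no_prime_factor_11 (p A B n : Z) :
  prime p -> 5 <= p -> 0 < n -> B <> 0 -> rel_prime A B -> A ^ 2 + 11 * B ^ 6 = 3 ^ n -> ~ (p | n).
Proof.
  intros Hp Hp5 Hn. revert A B. remember (Z.to_nat n) as k eqn:Hk. revert n Hn Hk.
  induction k as [k IH] using lt_wf_ind. intros n Hn Hk A B HB Hcop E D.
  destruct (descent_11 A B n Hn HB Hcop E) as (N & HN0 & HN & HN').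
  assert (DN : (p | N)).
  { apply Gauss with 3; [rewrite <- HN; exact D|]. apply prime_rel_prime; [exact Hp|].
    intros D3. apply Z.divide_pos_le in D3; [clear - D3 Hp5; lia | reflexivity]. }
  destruct HN' as [-> | [-> | (A' & B' & HB' & Hcop' & E')]].
  - apply Z.divide_pos_le in DN; [clear - DN Hp5; lia | reflexivity].
  - apply Z.divide_pos_le in DN; [clear - DN Hp5; lia | reflexivity].
  - exact (IH (Z.to_nat N) ltac:(clear - Hn HN Hk; lia) N HN0 eq_refl A' B' HB' Hcop' E' DN).
Qed.

(** * Powers of 2 *)

Lemma fifteen_coefficient_sixths (x y b : Z) :
  0 < x -> 0 < y -> rel_prime x y -> x * y = 15 * b ^ 6 ->
  exists u v c f s, ((c = 15 /\ f = 1) \/ (c = 5 /\ f = 3)) /\ (s = 1 \/ s = -1) /\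
    0 < c * u ^ 6 /\ 0 < f * v ^ 6 /\ rel_prime (c * u ^ 6) (f * v ^ 6) /\
    x + y = c * u ^ 6 + f * v ^ 6 /\ y - x = s * (f * v ^ 6 - c * u ^ 6).
Proof.
  assert (K : forall x y c f, (c = 15 /\ f = 1) \/ (c = 5 /\ f = 3) -> 0 < x -> 0 < y -> rel_prime x y ->
    x * y = 15 * b ^ 6 -> (c | x) -> (f | y) -> exists u v, x = c * u ^ 6 /\ y = f * v ^ 6).
  { intros x' y' c f Hcf Hx Hy Hcop E Dc Df.
    apply (sixths_of_product c f x' y' b); try assumption;
      destruct Hcf as [[-> ->] | [-> ->]]; (reflexivity || exact E). }
  intros Hx Hy Hcop E.
  assert (D5 : (5 | x) \/ (5 | y)) by (apply (prime_mult 5 prime_5); exists (3 * b ^ 6); rewrite E; ring).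
  assert (D3 : (3 | x) \/ (3 | y)) by (apply (prime_mult 3 prime_3); exists (5 * b ^ 6); rewrite E; ring).
  assert (D15 : forall z, (5 | z) -> (3 | z) -> (15 | z)).
  { intros z [z1 ->] D. apply prime_mult in D; [|exact prime_3].
    destruct D as [[z2 ->] | [w Hw]]; [exists z2; ring | clear - Hw; lia]. }
  assert (Hcop' : rel_prime y x) by (apply rel_prime_sym; exact Hcop).
  assert (E' : y * x = 15 * b ^ 6) by (rewrite Z.mul_comm; exact E).
  destruct D5 as [D5 | D5], D3 as [D3 | D3].
  - destruct (K x y 15 1) as (u & v & -> & ->); auto using Z.divide_1_l.
    exists u, v, 15, 1, 1. split; [left; split; reflexivity|]. split; [left; reflexivity|].
    do 3 (split; [assumption|]). split; ring.
  - destruct (K x y 5 3) as (u & v & -> & ->); auto.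
    exists u, v, 5, 3, 1. split; [right; split; reflexivity|]. split; [left; reflexivity|].
    do 3 (split; [assumption|]). split; ring.
  - destruct (K y x 5 3) as (u & v & -> & ->); auto.
    exists u, v, 5, 3, (-1). split; [right; split; reflexivity|]. split; [right; reflexivity|].
    do 3 (split; [assumption|]). split; ring.
  - destruct (K y x 15 1) as (u & v & -> & ->); auto using Z.divide_1_l.
    exists u, v, 15, 1, (-1). split; [left; split; reflexivity|]. split; [right; reflexivity|].
    do 3 (split; [assumption|]). split; ring.
Qed.

Lemma pow2_even k : 0 < k -> 2 ^ k mod 2 = 0.
Proof. intros Hk. replace k with (k - 1 + 1) by ring. rewrite Z.pow_add_r by lia. apply Z.mod_mul. discriminate. Qed.

Lemma pow2_pos k : 0 <= k -> 0 < 2 ^ k.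
Proof. intros Hk. apply Z.pow_pos_nonneg; [reflexivity | exact Hk]. Qed.

Lemma pow2_double n k : 0 <= k -> n = 2 * k -> 2 ^ n = (2 ^ k) ^ 2.
Proof. intros Hk ->. rewrite (Z.mul_comm 2), Z.pow_mul_r by lia. reflexivity. Qed.

Lemma pow2_succ k : 0 <= k -> 2 * 2 ^ k = 2 ^ (k + 1).
Proof. intros Hk. rewrite Z.pow_add_r by lia. ring. Qed.

Lemma pow2_sixth m k i : 0 <= m -> 0 <= i -> k = m + 6 * i -> 2 ^ k = 2 ^ m * (2 ^ i) ^ 6.
Proof. intros Hm Hi ->. rewrite Z.pow_add_r, (Z.mul_comm 6), Z.pow_mul_r by lia. reflexivity. Qed.

Lemma pow2_mod3 i : 0 <= i -> 2 ^ i mod 3 <> 0.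
Proof.
  intros Hi. rewrite (pow_mod_cycle 3 2 2 i) by (reflexivity || exact Hi).
  assert (H : i mod 2 = 0 \/ i mod 2 = 1) by (clear; lia). destruct H as [-> | ->]; discriminate.
Qed.

Lemma both_odd_of_even_sum (c f u v : Z) :
  c mod 2 = 1 -> f mod 2 = 1 -> rel_prime u v -> (c * u ^ 6 + f * v ^ 6) mod 2 = 0 ->
  u mod 2 = 1 /\ v mod 2 = 1.
Proof.
  intros Hc Hf Hcop H.
  assert (Hu : u mod 2 = 0 \/ u mod 2 = 1) by (clear; lia).
  assert (Hv : v mod 2 = 0 \/ v mod 2 = 1) by (clear; lia).
  assert (K : eqmod 2 (c * u ^ 6 + f * v ^ 6) 0) by (apply eqmod_iff; [discriminate | exact H]).
  rewrite (eqmod_mod 2 c), (eqmod_mod 2 f), (eqmod_mod 2 u), (eqmod_mod 2 v), Hc, Hf in K by discriminate.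
  destruct Hu as [Hu | Hu], Hv as [Hv | Hv]; rewrite Hu, Hv in K.
  - exfalso. apply Z.mod_divide in Hu, Hv; try discriminate. destruct Hcop as [_ _ G].
    specialize (G 2 Hu Hv). destruct G as [w Hw]. clear - Hw. lia.
  - destruct K as [w Hw]. clear - Hw. simpl in Hw. lia.
  - destruct K as [w Hw]. clear - Hw. simpl in Hw. lia.
  - split; assumption.
Qed.

Lemma rel_prime_of_multiples (c f u v : Z) : rel_prime (c * u ^ 6) (f * v ^ 6) -> rel_prime u v.
Proof.
  intros H. apply (rel_prime_factor u (c * u ^ 6)); [exists (c * u ^ 5); ring|].
  apply rel_prime_sym. apply (rel_prime_factor v (f * v ^ 6)); [exists (f * v ^ 5); ring|].
  apply rel_prime_sym. exact H.
Qed.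

(** Residues modulo 7 give [e = 0] modulo 3, and those modulo 9 then give [e = 3] modulo 6. The
    solution [8 = 5 + 3] belongs to [c = 1]; for larger powers [c] of 2 the equation
    [8 c^6 = 5 u^6 + 3 v^6] goes to the cubic field. *)
Lemma pow2_eq_5_3 (u v e : Z) :
  0 <= e -> rel_prime u v -> v <> 0 -> 2 ^ e = 5 * u ^ 6 + 3 * v ^ 6 -> e = 3.
Proof.
  intros He Hcop Hv0 E.
  assert (H6 : e mod 6 = 3 /\ u ^ 6 mod 9 = 1 /\ v ^ 6 mod 9 = 1).
  { pose proof (sixth_mod7 u) as U7. pose proof (sixth_mod7 v) as V7. pose proof (pow2_mod7 e He) as K7.
    pose proof (sixth_mod9 u) as U9. pose proof (sixth_mod9 v) as V9. pose proof (pow2_mod9 e He) as K9.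
    revert E U7 V7 K7 U9 V9 K9. generalize (u ^ 6) (v ^ 6) (2 ^ e). clear. intros U V X E U7 V7 K7 U9 V9 K9.
    assert (H3 : e mod 3 = 0).
    { clear U9 V9 K9. assert (X mod 7 = 1) by (destruct_or U7; destruct_or V7; destruct_or K7; lia).
      clear E U7 V7. lia. }
    clear U7 V7 K7. assert (HX : X mod 9 = 8 /\ U mod 9 = 1 /\ V mod 9 = 1 \/ X mod 9 = 5 \/ X mod 9 = 0 \/ X mod 9 = 3).
    { clear K9 H3. destruct_or U9; destruct_or V9; lia. }
    clear E U9 V9. destruct HX as [[HX HUV] | HX].
    - split; [clear HUV; destruct_or K9; lia | exact HUV].
    - exfalso. destruct_or K9; destruct K9 as [K1 K2]; destruct_or HX; rewrite HX in K2; try discriminate. clear - K1 H3. lia. }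
  destruct H6 as (H6 & HU9 & HV9).
  assert (Hi : exists i, 0 <= i /\ e = 3 + 6 * i) by (exists (e / 6); clear - He H6; lia).
  destruct Hi as (i & Hi & Hei).
  destruct (Z.eq_dec i 0) as [-> | Hi0]; [clear - Hei; lia | exfalso].
  rewrite (pow2_sixth 3 e i ltac:(discriminate) Hi Hei) in E. change (2 ^ 3) with 8 in E.
  assert (Hc2 : 2 ^ i mod 2 = 0) by (apply pow2_even; clear - Hi Hi0; lia).
  destruct (both_odd_of_even_sum 5 3 u v eq_refl eq_refl Hcop) as [Hu2 Hv2].
  { rewrite <- E. replace (8 * (2 ^ i) ^ 6) with (4 * (2 ^ i) ^ 6 * 2) by ring. apply Z.mod_mul. discriminate. }
  assert (H3 : forall w, w ^ 6 mod 9 = 1 -> w mod 3 <> 0).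
  { intros w Hw K. apply Z.mod_divide in K; [|discriminate]. destruct K as [w' ->].
    replace ((w' * 3) ^ 6) with (81 * w' ^ 6 * 9) in Hw by ring. rewrite Z.mod_mul in Hw by discriminate. discriminate. }
  destruct (square_root_th5 (2 ^ i) u v Hcop Hv0 Hu2 Hc2 (H3 u HU9) (pow2_mod3 i Hi) (H3 v HV9) E) as [[[x y] z] Hd].
  destruct (th5_quadrics x y z u i Hi Hu2 (H3 u HU9) Hd) as [Hcc Huu].
  (* With [c^2 = 4] and [u^2 = 1] the equation would give [v^6 = 169], which is 7 modulo 9. *)
  replace ((2 ^ i) ^ 6) with (((2 ^ i) ^ 2) ^ 3) in E by ring.
  replace (u ^ 6) with ((u ^ 2) ^ 3) in E by ring. rewrite Hcc, Huu in E.
  clear - E HV9. lia.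
Qed.

(** The difference of the two factors is kept besides their sum. Modulo 7, [2 v^3] is 0, 2 or -2
    while [b^6 - 15 a^6] is 0, 1 or -1, so [a^6] and [b^6] agree and [2^(m+1) = 2]; hence 3 divides
    [m]. *)
Lemma pow2_eq_15_1_step (u v e : Z) :
  0 < e -> 15 * u ^ 6 <> 0 -> rel_prime u v -> 2 ^ e = 15 * u ^ 6 + v ^ 6 ->
  exists m, e = 2 * m /\ (m = 2 \/ (m mod 3 = 0 /\ 0 <= m /\
    exists a b, 15 * a ^ 6 <> 0 /\ b ^ 6 <> 0 /\ rel_prime a b /\ 2 ^ (m + 1) = 15 * a ^ 6 + b ^ 6 /\
      (2 * v ^ 3 = b ^ 6 - 15 * a ^ 6 \/ - 2 * v ^ 3 = b ^ 6 - 15 * a ^ 6))).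
Proof.
  intros He Hu0 Hcop E.
  assert (Hu6 : 0 < 15 * u ^ 6).
  { assert (K : u <> 0) by (intros ->; apply Hu0; reflexivity). apply sixth_pos in K. clear - K. lia. }
  assert (H2 : e mod 2 = 0).
  { pose proof (sixth_mod9 u) as U9. pose proof (sixth_mod9 v) as V9. pose proof (pow2_mod9 e ltac:(clear - He; lia)) as K9.
    revert E U9 V9 K9. generalize (u ^ 6) (v ^ 6) (2 ^ e). clear. intros U V X E U9 V9 K9.
    assert (HX : X mod 9 = 0 \/ X mod 9 = 6 \/ X mod 9 = 1 \/ X mod 9 = 7) by (clear K9; destruct_or U9; destruct_or V9; lia).
    clear E U9 V9. destruct_or K9; lia. }
  assert (Hm : exists m, 0 < m /\ e = 2 * m) by (exists (e / 2); clear - He H2; lia).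
  destruct Hm as (m & Hm & Hem). exists m. split; [exact Hem|].
  assert (Hm0 : 0 <= m) by (clear - Hm; lia).
  rewrite (pow2_double e m Hm0 Hem) in E.
  destruct (both_odd_of_even_sum 15 1 u v eq_refl eq_refl Hcop) as [Hu2 Hv2].
  { rewrite Z.mul_1_l, <- E. rewrite <- Z.mod_pow_l, (pow2_even m Hm). reflexivity. }
  destruct (split_opposite_parity (v ^ 3) (2 ^ m) (15 * u ^ 6)) as (x & y & Hx & Hy & Hxy & Hs & Hd & Hp & _ & _).
  { pose proof (pow_odd v 3 ltac:(discriminate) Hv2) as K1. pose proof (pow2_even m Hm) as K2. clear - K1 K2. lia. }
  { apply odd_rel_prime_pow2; [exact Hm0 | apply pow_odd; [discriminate | exact Hv2]]. }
  { apply pow2_pos. exact Hm0. } { exact Hu6. } { rewrite E. ring. }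
  destruct (fifteen_coefficient_sixths x y u Hx Hy Hxy Hp) as (a & b & c & f & s & Hcf & Hs1 & Ha & Hb & Hab & Hsum & Hdif).
  rewrite Hs, pow2_succ in Hsum by exact Hm0. rewrite Hd in Hdif.
  pose proof (rel_prime_of_multiples c f a b Hab) as Hab'.
  destruct Hcf as [[-> ->] | [-> ->]].
  - right. rewrite Z.mul_1_l in *.
    assert (Hdif' : 2 * v ^ 3 = b ^ 6 - 15 * a ^ 6 \/ - 2 * v ^ 3 = b ^ 6 - 15 * a ^ 6)
      by (clear - Hdif Hs1; destruct Hs1; subst s; lia).
    split.
    { pose proof (sixth_mod7 a) as A7. pose proof (sixth_mod7 b) as B7. pose proof (cube_mod7 v) as V7.
      pose proof (pow2_mod7 (m + 1) ltac:(clear - Hm; lia)) as K7.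
      revert Hdif' Hsum A7 B7 V7 K7. generalize (a ^ 6) (b ^ 6) (v ^ 3) (2 ^ (m + 1)). clear.
      intros A B V X Hdif Hsum A7 B7 V7 K7.
      assert (HX : X mod 7 = 2 \/ X mod 7 = 0).
      { clear K7. destruct_or A7; destruct_or B7; destruct_or V7; destruct Hdif; lia. }
      clear Hdif Hsum A7 B7 V7. destruct_or K7; lia. }
    split; [exact Hm0|]. exists a, b.
    split; [clear - Ha; lia|]. split; [clear - Hb; lia|]. split; [exact Hab'|]. split; [exact Hsum | exact Hdif'].
  - left. assert (Hb0 : b <> 0) by (intros ->; clear - Hb; simpl in Hb; lia).
    assert (K : m + 1 = 3) by (apply (pow2_eq_5_3 a b); [clear - Hm; lia | exact Hab' | exact Hb0 | exact Hsum]).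
    clear - K. lia.
Qed.

(** The step is taken twice. Since 3 divides [m], it cannot divide half of [m + 1], so the second
    step ends at [16 = 15 a^6 + b^6]; then [v^3] would be 7 or -7. *)
Lemma pow2_eq_15_1 (u v e : Z) :
  0 < e -> 15 * u ^ 6 <> 0 -> rel_prime u v -> 2 ^ e = 15 * u ^ 6 + v ^ 6 -> e = 4.
Proof.
  intros He Hu Hcop E.
  destruct (pow2_eq_15_1_step u v e He Hu Hcop E) as (m & Hem & [-> | (Hm3 & Hm0 & a & b & Ha & Hb & Hab & E1 & Hd)]).
  { clear - Hem. lia. }
  exfalso.
  destruct (pow2_eq_15_1_step a b (m + 1) ltac:(clear - Hm0; lia) Ha Hab E1) as (m' & Hem' & [-> | (Hm3' & _)]).
  2:{ clear - Hm3 Hm3' Hem'. lia. }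
  rewrite Hem' in E1. change (2 ^ (2 * 2)) with 16 in E1.
  assert (Ha6 : 0 < a ^ 6) by (apply sixth_pos; intros ->; apply Ha; reflexivity).
  assert (Hb6 : 0 < b ^ 6) by (apply sixth_pos; intros ->; apply Hb; reflexivity).
  assert (Ha1 : a ^ 6 = 1) by (clear - Ha6 Hb6 E1; lia).
  assert (Hv : v ^ 3 = 7 \/ v ^ 3 = -7) by (clear - Ha1 E1 Hd; lia).
  pose proof (cube_mono v 1). pose proof (cube_mono 2 v). pose proof (cube_mono v (-2)). pose proof (cube_mono (-1) v).
  clear - Hv H H0 H1 H2. lia.
Qed.

Lemma both_odd_base (d A B n : Z) :
  d mod 2 = 1 -> 0 < n -> rel_prime A B -> A ^ 2 + d * B ^ 6 = 2 ^ n -> A mod 2 = 1 /\ B mod 2 = 1.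
Proof.
  intros Hd Hn Hcop E.
  assert (HA : A mod 2 = 0 \/ A mod 2 = 1) by (clear; lia).
  assert (HB : B mod 2 = 0 \/ B mod 2 = 1) by (clear; lia).
  assert (K : eqmod 2 (A ^ 2 + d * B ^ 6) 0) by (rewrite E; apply eqmod_iff; [discriminate | apply pow2_even; exact Hn]).
  rewrite (eqmod_mod 2 d), (eqmod_mod 2 A), (eqmod_mod 2 B), Hd in K by discriminate.
  destruct HA as [HA | HA], HB as [HB | HB]; rewrite HA, HB in K.
  - exfalso. apply Z.mod_divide in HA, HB; try discriminate. destruct Hcop as [_ _ G].
    specialize (G 2 HA HB). destruct G as [w Hw]. clear - Hw. lia.
  - destruct K as [w Hw]. clear - Hw. simpl in Hw. lia.
  - destruct K as [w Hw]. clear - Hw. simpl in Hw. lia.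
  - split; assumption.
Qed.

Lemma solutions_15 (A B n : Z) :
  0 < n -> B <> 0 -> rel_prime A B -> A ^ 2 + 15 * B ^ 6 = 2 ^ n -> n = 4 \/ n = 6.
Proof.
  intros Hn HB Hcop E.
  destruct (both_odd_base 15 A B n eq_refl Hn Hcop E) as [HA2 HB2].
  pose proof (sixth_pos B HB) as HB6.
  assert (Hk : exists k, 0 < k /\ n = 2 * k).
  { exists (n / 2). assert (K : n mod 2 = 0); [|clear - K Hn; lia].
    assert (Hpar : n mod 2 = 0 \/ n mod 2 = 1) by (clear; lia). destruct Hpar as [H | H]; [exact H | exfalso].
    assert (K : 2 ^ n mod 3 = 2) by (rewrite (pow_mod_cycle 3 2 2 n) by (reflexivity || (clear - Hn; lia)); rewrite H; reflexivity).
    rewrite <- E in K. replace (A ^ 2 + 15 * B ^ 6) with (A ^ 2 + 5 * B ^ 6 * 3) in K by ring.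
    rewrite Z.mod_add in K by discriminate. rewrite <- Z.mod_pow_l in K.
    assert (HA : A mod 3 = 0 \/ A mod 3 = 1 \/ A mod 3 = 2) by (clear; lia).
    destruct_or HA; rewrite HA in K; discriminate. }
  destruct Hk as (k & Hk & Hnk).
  assert (Hk0 : 0 <= k) by (clear - Hk; lia). rewrite (pow2_double n k Hk0 Hnk) in E.
  destruct (split_opposite_parity A (2 ^ k) (15 * B ^ 6)) as (x & y & Hx & Hy & Hxy & Hs & _ & Hp & _ & _).
  { pose proof (pow2_even k Hk) as K. clear - K HA2. lia. }
  { apply odd_rel_prime_pow2; assumption. } { apply pow2_pos. exact Hk0. } { clear - HB6. lia. } { exact E. }
  destruct (fifteen_coefficient_sixths x y B Hx Hy Hxy Hp) as (u & v & c & f & s & Hcf & _ & Hu & Hv & Huv & Hsum & _).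
  rewrite Hs, pow2_succ in Hsum by exact Hk0.
  pose proof (rel_prime_of_multiples c f u v Huv) as Huv'.
  destruct Hcf as [[-> ->] | [-> ->]].
  - right. rewrite Z.mul_1_l in Hsum.
    assert (K : k + 1 = 4) by (apply (pow2_eq_15_1 u v); [clear - Hk; lia | clear - Hu; lia | exact Huv' | exact Hsum]).
    clear - K Hnk. lia.
  - left. assert (Hv0 : v <> 0) by (intros ->; clear - Hv; simpl in Hv; lia).
    assert (K : k + 1 = 3) by (apply (pow2_eq_5_3 u v); [clear - Hk; lia | exact Huv' | exact Hv0 | exact Hsum]).
    clear - K Hnk. lia.
Qed.

(** * The equation with d = 7 *)

Lemma pow2_eq_7_1 (u v e : Z) :
  0 < e -> u <> 0 -> rel_prime u v -> 2 ^ e = 7 * u ^ 6 + v ^ 6 -> e = 3.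
Proof.
  intros He Hu0 Hcop E.
  assert (He0 : 0 <= e) by (clear - He; lia).
  assert (Hu6 : 0 < 7 * u ^ 6) by (pose proof (sixth_pos u Hu0) as K; clear - K; lia).
  destruct (both_odd_of_even_sum 7 1 u v eq_refl eq_refl Hcop) as [Hu2 Hv2].
  { rewrite Z.mul_1_l, <- E. apply pow2_even. exact He. }
  assert (H3 : e mod 3 = 0).
  { pose proof (sixth_mod7 v) as V7. pose proof (pow2_mod7 e He0) as K7. rewrite E in K7.
    replace (7 * u ^ 6 + v ^ 6) with (v ^ 6 + u ^ 6 * 7) in K7 by ring. rewrite Z.mod_add in K7 by discriminate.
    clear - V7 K7. lia. }
  assert (Hpar : e mod 2 = 0 \/ e mod 2 = 1) by (clear; lia). destruct Hpar as [He2 | He2].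
  - exfalso.
    assert (Hm : exists m, 0 < m /\ e = 2 * m /\ m mod 3 = 0) by (exists (e / 2); clear - He He2 H3; lia).
    destruct Hm as (m & Hm & Hem & Hm3). assert (Hm0 : 0 <= m) by (clear - Hm; lia).
    rewrite (pow2_double e m Hm0 Hem) in E.
    (* Splitting gives [2 * 2^m = 7 a^6 + b^6], and 3 divides [m], so [b^6] would be 2 modulo 7. *)
    destruct (split_opposite_parity (v ^ 3) (2 ^ m) (7 * u ^ 6)) as (x & y & Hx & Hy & Hxy & Hs & _ & Hp & _ & _).
    { pose proof (pow_odd v 3 ltac:(discriminate) Hv2) as K1. pose proof (pow2_even m Hm) as K2. clear - K1 K2. lia. }
    { apply odd_rel_prime_pow2; [exact Hm0 | apply pow_odd; [discriminate | exact Hv2]]. }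
    { apply pow2_pos. exact Hm0. } { exact Hu6. } { rewrite E. ring. }
    destruct (prime_coefficient_sixths 7 x y u prime_7 Hx Hy Hxy Hp) as (a & b & s & _ & _ & _ & _ & Hsum & _).
    rewrite Hs in Hsum. pose proof (sixth_mod7 b) as B7. pose proof (pow2_mod7 m Hm0) as K7.
    clear - Hsum B7 K7 Hm3. lia.
  - assert (Hi : exists i, 0 <= i /\ e = 3 + 6 * i) by (exists (e / 6); clear - He He2 H3; lia).
    destruct Hi as (i & Hi & Hei).
    destruct (Z.eq_dec i 0) as [-> | Hi0]; [clear - Hei; lia | exfalso].
    rewrite (pow2_sixth 3 e i ltac:(discriminate) Hi Hei) in E. change (2 ^ 3) with 8 in E.
    set (c := 2 ^ i) in *.
    (* [8 c^6 - v^6] is a difference of cubes as well. Its factors are coprime since 3 does not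
       divide [P]. If [P = 7 a^6], then [R] is [5 c^4] modulo 7, which is no sixth power for [c] a
       power of 2; if [P = b^6], then [v] odd and [c] even contradict modulo 4. *)
    set (P := 2 * c ^ 2 - v ^ 2). set (R := 4 * c ^ 4 + 2 * c ^ 2 * v ^ 2 + v ^ 4).
    assert (EPR : P * R = 7 * u ^ 6).
    { unfold P, R. transitivity (8 * c ^ 6 - v ^ 6); [ring | rewrite E; ring]. }
    assert (HR : 0 < R).
    { unfold R. pose proof (odd_sqr_pos v Hv2) as K1.
      assert (K2 : 0 <= c ^ 2) by (apply Z.pow_nonneg; unfold c; apply Z.pow_nonneg; discriminate).
      replace (c ^ 4) with (c ^ 2 * c ^ 2) by ring. replace (v ^ 4) with (v ^ 2 * v ^ 2) by ring.
      clear - K1 K2. nia. }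
    assert (HP : 0 < P).
    { rewrite <- EPR in Hu6. apply mul_pos_cases in Hu6. clear - Hu6 HR. clearbody P R. lia. }
    assert (Hc4 : (4 | c ^ 2)).
    { unfold c. replace i with (i - 1 + 1) by ring. rewrite Z.pow_add_r by (clear - Hi Hi0; lia).
      exists ((2 ^ (i - 1)) ^ 2). ring. }
    assert (HP2 : P mod 2 = 1).
    { unfold P. pose proof (pow_odd v 2 ltac:(discriminate) Hv2) as K. clear - K. lia. }
    assert (HP3 : P mod 3 <> 0).
    { assert (K1 : c ^ 2 mod 3 = 1).
      { pose proof (pow2_mod3 i Hi) as K. fold c in K. rewrite <- Z.mod_pow_l.
        assert (K' : c mod 3 = 1 \/ c mod 3 = 2) by (clear - K; lia). destruct K' as [-> | ->]; reflexivity. }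
      assert (K2 : v ^ 2 mod 3 = 0 \/ v ^ 2 mod 3 = 1).
      { rewrite <- Z.mod_pow_l. assert (K' : v mod 3 = 0 \/ v mod 3 = 1 \/ v mod 3 = 2) by (clear; lia).
        destruct_or K'; rewrite K'; [left | right | right]; reflexivity. }
      unfold P. clear - K1 K2. lia. }
    assert (Hcc : 2 * c ^ 2 = 1 * 2 ^ (2 * i + 1)).
    { rewrite Z.mul_1_l, <- pow2_succ by (clear - Hi; lia). f_equal. unfold c.
      rewrite <- Z.pow_mul_r by (clear - Hi; lia). f_equal. clear; lia. }
    assert (HPc : rel_prime P (2 * c ^ 2)).
    { rewrite Hcc, Z.mul_1_l. apply odd_rel_prime_pow2; [clear - Hi; lia | exact HP2]. }
    assert (HPv : rel_prime P (v ^ 2)).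
    { replace (v ^ 2) with (2 * c ^ 2 + P * -1) by (unfold P; ring). apply rel_prime_add_mul. exact HPc. }
    assert (HPR : rel_prime P R).
    { replace R with (3 * (2 * c ^ 2 * v ^ 2) + P * P) by (unfold P, R; ring). apply rel_prime_add_mul.
      apply rel_prime_mult; [apply rel_prime_not_divide; [exact prime_3 | exact HP3]|].
      apply rel_prime_mult; assumption. }
    destruct (prime_coefficient_sixths 7 P R u prime_7 HP HR HPR EPR) as (a & b & s & Hs & _ & _ & _ & Hsum & Hdif & _).
    destruct Hs as [-> | ->].
    + assert (HRb : R = b ^ 6) by (clear - Hsum Hdif; clearbody P R; lia).
      assert (HPa : 2 * c ^ 2 - v ^ 2 = 7 * a ^ 6) by (fold P; clear - Hsum Hdif; clearbody P R; lia).
      assert (Hvv : v ^ 2 = 2 * c ^ 2 - 7 * a ^ 6) by (clear - HPa; lia).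
      unfold R in HRb. replace (v ^ 4) with (v ^ 2 * v ^ 2) in HRb by ring. rewrite Hvv in HRb.
      pose proof (sixth_mod7 b) as B7. rewrite <- HRb in B7.
      replace (4 * c ^ 4 + 2 * c ^ 2 * (2 * c ^ 2 - 7 * a ^ 6) + (2 * c ^ 2 - 7 * a ^ 6) * (2 * c ^ 2 - 7 * a ^ 6))
        with (5 * c ^ 4 + (c ^ 4 - 6 * c ^ 2 * a ^ 6 + 7 * a ^ 12) * 7) in B7 by ring.
      rewrite Z.mod_add in B7 by discriminate.
      assert (Hc4' : c ^ 4 = 2 ^ (i * 4)) by (unfold c; rewrite Z.pow_mul_r by (clear - Hi; lia); reflexivity).
      rewrite Hc4' in B7. pose proof (pow2_mod7 (i * 4) ltac:(clear - Hi; lia)) as K7. clear - B7 K7. lia.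
    + assert (HPb : 2 * c ^ 2 - v ^ 2 = b ^ 6) by (fold P; clear - Hsum Hdif; clearbody P R; lia).
      pose proof (sixth_mod4 b) as B4. pose proof (sqr_mod4 v) as V4. pose proof (pow_odd v 2 ltac:(discriminate) Hv2) as V2.
      destruct Hc4 as [w Hw]. rewrite Hw in HPb. clear - HPb B4 V4 V2. lia.
Qed.

Lemma solutions_7_mod3 (A B n : Z) :
  0 < n -> rel_prime A B -> A ^ 2 + 7 * B ^ 6 = 2 ^ n -> n mod 6 = 3 -> n = 3 \/ n = 15.
Proof.
  intros Hn Hcop E H6.
  destruct (both_odd_base 7 A B n eq_refl Hn Hcop E) as [HA2 HB2].
  assert (Hi : exists i, 0 <= i /\ n = 3 + 6 * i) by (exists (n / 6); clear - Hn H6; lia).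
  destruct Hi as (i & Hi & Hni).
  destruct (Z.eq_dec i 0) as [-> | Hi0]; [left; clear - Hni; lia | right].
  rewrite (pow2_sixth 3 n i ltac:(discriminate) Hi Hni) in E. change (2 ^ 3) with 8 in E.
  destruct (square_root_th7 A B (2 ^ i) Hcop) as [[[x y] z] Hd].
  { intros ->. discriminate. } { exact HB2. } { apply pow2_even. clear - Hi Hi0. lia. } { rewrite <- E. ring. }
  pose proof (th7_quadrics x y z B i Hi HB2 Hd) as K.
  assert (K2 : i = 2); [|clear - K2 Hni; lia].
  apply (Z.pow_inj_r 2); [reflexivity | exact Hi | discriminate | exact K].
Qed.

Lemma solutions_7_mod1 (A B n : Z) :
  0 < n -> B <> 0 -> rel_prime A B -> A ^ 2 + 7 * B ^ 6 = 2 ^ n -> n mod 6 = 1 -> n = 7.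
Proof.
  intros Hn HB Hcop E H6.
  destruct (both_odd_base 7 A B n eq_refl Hn Hcop E) as [HA2 HB2].
  assert (Hi : exists i, 0 <= i /\ n = 1 + 6 * i) by (exists (n / 6); clear - Hn H6; lia).
  destruct Hi as (i & Hi & Hni).
  destruct (Z.eq_dec i 0) as [-> | Hi0].
  { exfalso. rewrite Hni in E. change (2 ^ (1 + 6 * 0)) with 2 in E.
    pose proof (sixth_pos B HB) as K. assert (K2 : 0 <= A ^ 2) by (clear; nia). clear - E K K2. lia. }
  destruct (Z.eq_dec i 1) as [-> | Hi1]; [clear - Hni; lia | exfalso].
  rewrite (pow2_sixth 1 n i ltac:(discriminate) Hi Hni) in E. change (2 ^ 1) with 2 in E.
  destruct (square_root_th28 A B (2 ^ i) Hcop HA2 HB2) as [[[x y] z] Hd].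
  { replace i with (i - 2 + 2) by ring. rewrite Z.pow_add_r by (clear - Hi Hi0 Hi1; lia). apply Z.mod_mul. discriminate. }
  { rewrite <- E. ring. }
  apply (th28_quadrics x y z B i); [clear - Hi Hi0 Hi1; lia | exact HB2 | exact Hd].
Qed.

(** [(A + B^3 sqrt -7) / 2] has norm [2^(3 K)] and is up to sign the cube of some [g + h om]. The
    factors [h] and [3 g^2 + 3 g h - h^2] of the cube [(P B)^3] are coprime because 3 does not
    divide [h]: for odd [K] the power [2^K] is 2 modulo 3, not a square. So both factors are cubes,
    [s^3] and [t^3], and [R = 2 g + h]. *)
Lemma cube_factor_7 (A B K : Z) :
  0 < K -> A mod 2 = 1 -> B mod 2 = 1 -> K mod 2 = 1 -> A ^ 2 + 7 * B ^ 6 = 4 * 2 ^ (K * 3) ->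
  exists R s t, s mod 2 = 1 /\ rel_prime R s /\ R ^ 2 + 7 * s ^ 6 = 2 ^ (K + 2) /\ t ^ 3 = 3 * 2 ^ K - 7 * s ^ 6.
Proof.
  intros HK HA2 HB2 HK2 E.
  assert (HK0 : 0 <= K) by (clear - HK; lia).
  assert (HX : exists X, A - B ^ 3 = 2 * X).
  { exists ((A - B ^ 3) / 2). pose proof (pow_odd B 3 ltac:(discriminate) HB2) as H. clear - H HA2. lia. }
  destruct HX as [X HX]. assert (HA : A = 2 * X + B ^ 3) by (clear - HX; lia).
  assert (HB3 : (B ^ 3) mod 2 = 1) by (apply pow_odd; [discriminate | exact HB2]).
  destruct (norm_eq_cube 1 2 X (B ^ 3) (2 ^ K) 1) as (P & Q & g & h & N1 & N2 & EX & EW).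
  { right. right. right. left. reflexivity. }
  { apply Z.pow_nonzero; [discriminate | exact HK0]. }
  { apply odd_rel_prime_pow2; assumption. }
  { apply odd_rel_prime_pow2; [exact HK0 | reflexivity]. }
  { apply (Z.mul_reg_l _ _ 4); [discriminate|]. rewrite Z.mul_1_l, <- Z.pow_mul_r, <- E, HA by (clear - HK; lia).
    unfold qnorm. ring. }
  assert (HPQ : Q = 0 /\ (P = 1 \/ P = -1)).
  { clear - N2. unfold qnorm in N2.
    assert (H : 4 * (P * P + 1 * P * Q + 2 * Q * Q) = (2 * P + Q) * (2 * P + Q) + 7 * (Q * Q)) by ring.
    assert (H2 : P * P + 1 * P * Q + 2 * Q * Q <= 1) by lia. assert (Q = 0) by nia. subst Q.
    split; [reflexivity | nia]. }
  destruct HPQ as [-> HP].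
  assert (Enorm : qnorm 1 2 g h = 2 ^ K).
  { pose proof (pow2_pos K HK0) as Hpos. clear - N1 Hpos. unfold qnorm in *.
    assert (H : 4 * (g * g + 1 * g * h + 2 * h * h) = (2 * g + h) * (2 * g + h) + 7 * (h * h)) by ring.
    assert (0 <= g * g + 1 * g * h + 2 * h * h) by nia. lia. }
  assert (EB : h * (3 * g ^ 2 + 3 * g * h - h ^ 2) = (P * B) ^ 3).
  { transitivity (P * P * (P * (B ^ 3))); [|ring]. rewrite EW. unfold qmul2, qcube2.
    destruct HP as [-> | ->]; ring. }
  assert (Hh2 : h mod 2 = 1).
  { apply (odd_divide_odd h ((P * B) ^ 3)); [rewrite <- EB; apply Z.divide_factor_l|].
    apply pow_odd; [discriminate|]. destruct HP as [-> | ->]; clear - HB2; lia. }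
  assert (Hgh : rel_prime h g).
  { apply rel_prime_intro. intros d D1 D2.
    apply (odd_divide_pow2 d 1 K); [exact HK0 | exact (odd_divide_odd d h D1 Hh2) |].
    rewrite Z.mul_1_l, <- Enorm. unfold qnorm. apply Z.divide_add_r; [apply Z.divide_add_r|].
    - apply Z.divide_mul_l. exact D2.
    - apply Z.divide_mul_r. exact D1.
    - apply Z.divide_mul_r. exact D1. }
  assert (Hh3 : rel_prime h 3).
  { apply rel_prime_not_divide; [exact prime_3|]. intros D. apply Z.mod_divide in D; [|discriminate].
    destruct D as [h' Dh].
    assert (H1 : 2 ^ K mod 3 = 2) by (rewrite (pow_mod_cycle 3 2 2 K) by (reflexivity || exact HK0); rewrite HK2; reflexivity).
    rewrite <- Enorm, Dh in H1. unfold qnorm in H1.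
    replace (g * g + 1 * g * (h' * 3) + 2 * (h' * 3) * (h' * 3)) with (g ^ 2 + (g * h' + 6 * h' * h') * 3) in H1 by ring.
    rewrite Z.mod_add in H1 by discriminate. rewrite <- Z.mod_pow_l in H1.
    assert (Hg : g mod 3 = 0 \/ g mod 3 = 1 \/ g mod 3 = 2) by (clear; lia).
    destruct_or Hg; rewrite Hg in H1; discriminate. }
  set (F := 3 * g ^ 2 + 3 * g * h - h ^ 2) in *.
  assert (HhF : rel_prime h F).
  { unfold F. replace (3 * g ^ 2 + 3 * g * h - h ^ 2) with (3 * g ^ 2 + h * (3 * g - h)) by ring.
    apply rel_prime_add_mul. apply rel_prime_mult; [exact Hh3|]. apply rel_prime_Zpower_r; [discriminate | exact Hgh]. }
  destruct (rel_prime_mul_cube h F (P * B) HhF EB) as [s Hs].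
  destruct (rel_prime_mul_cube F h (P * B) (rel_prime_sym _ _ HhF)) as [t Ht]; [rewrite Z.mul_comm; exact EB|].
  assert (Hs2 : s mod 2 = 1) by (apply (odd_root s 3); [reflexivity | rewrite <- Hs; exact Hh2]).
  exists (2 * g + h), s, t. split; [exact Hs2|]. split.
  { apply rel_prime_sym. replace (2 * g + h) with (2 * g + s * s ^ 2) by (rewrite Hs; ring).
    apply rel_prime_add_mul. apply rel_prime_mult.
    - apply (odd_rel_prime_pow2 s 1); [discriminate | exact Hs2].
    - apply (rel_prime_factor s h); [rewrite Hs; exists (s ^ 2); ring | exact Hgh]. }
  replace (s ^ 6) with (s ^ 3 * s ^ 3) by ring. rewrite <- Hs, <- Ht.
  rewrite Z.pow_add_r, <- Enorm by (clear - HK; lia). unfold qnorm, F. split; ring.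
Qed.

(** Modulo 7 the cube [t^3] is [3 * 2^K], so [K = 1] modulo 3, and [R], [s] solve the original
    equation with exponent [K + 2 = 3] modulo 6. That case allows 3 and 15 only. *)
Lemma solutions_7_mod5 (A B n : Z) :
  0 < n -> rel_prime A B -> A ^ 2 + 7 * B ^ 6 = 2 ^ n -> n mod 6 = 5 -> n = 5.
Proof.
  intros Hn Hcop E H6.
  destruct (both_odd_base 7 A B n eq_refl Hn Hcop E) as [HA2 HB2].
  assert (HK : exists K, 0 < K /\ n = 2 + K * 3 /\ K mod 2 = 1) by (exists ((n - 2) / 3); clear - Hn H6; lia).
  destruct HK as (K & HK & HnK & HK2).
  rewrite HnK, Z.pow_add_r in E by (clear - HK; lia). change (2 ^ 2) with 4 in E.
  destruct (cube_factor_7 A B K HK HA2 HB2 HK2 E) as (R & s & t & Hs2 & HRs & ER & Et).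
  assert (HK0 : 0 <= K) by (clear - HK; lia).
  assert (HK3 : (K + 2) mod 6 = 3).
  { pose proof (cube_mod7 t) as T7. pose proof (pow2_mod7 K HK0) as K7. rewrite Et in T7.
    replace (3 * 2 ^ K - 7 * s ^ 6) with (3 * 2 ^ K + (- s ^ 6) * 7) in T7 by ring.
    rewrite Z.mod_add in T7 by discriminate. clear - T7 K7 HK2. lia. }
  destruct (solutions_7_mod3 R s (K + 2) ltac:(clear - HK; lia) HRs ER HK3) as [H | H]; [clear - H HnK; lia | exfalso].
  assert (HK13 : K = 13) by (clear - H; lia). subst K.
  change (2 ^ 13) with 8192 in Et. change (2 ^ (13 + 2)) with 32768 in ER.
  assert (HR : 0 <= R ^ 2) by (clear; nia).
  assert (Hs6 : s ^ 6 = 1 \/ s ^ 6 = 729).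
  { replace (s ^ 6) with (s ^ 3 * s ^ 3) in * by ring.
    pose proof (cube_mono 5 s) as S1. pose proof (cube_mono s (-5)) as S2.
    assert (Hs : -5 < s < 5).
    { split.
      - destruct (Z.lt_ge_cases (-5) s) as [G | G]; [exact G | exfalso]. specialize (S2 G). clear - S2 ER HR. nia.
      - destruct (Z.lt_ge_cases s 5) as [G | G]; [exact G | exfalso]. specialize (S1 G). clear - S1 ER HR. nia. }
    assert (Hs' : s = -4 \/ s = -3 \/ s = -2 \/ s = -1 \/ s = 0 \/ s = 1 \/ s = 2 \/ s = 3 \/ s = 4) by (clear - Hs; lia).
    clear - Hs' Hs2. destruct_or Hs'; subst s; try discriminate Hs2; (left; reflexivity) || (right; reflexivity). }
  (* [t^3] would be [24576 - 7 = 24569], between [29^3] and [30^3], or [24576 - 5103 = 19473],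
     between [26^3] and [27^3]. *)
  pose proof (cube_mono t 26) as T1. pose proof (cube_mono 27 t) as T2.
  pose proof (cube_mono t 29) as T3. pose proof (cube_mono 30 t) as T4.
  clear - Hs6 Et T1 T2 T3 T4. lia.
Qed.

Lemma solutions_7 (A B n : Z) :
  0 < n -> B <> 0 -> rel_prime A B -> A ^ 2 + 7 * B ^ 6 = 2 ^ n ->
  n = 3 \/ n = 4 \/ n = 5 \/ n = 7 \/ n = 15.
Proof.
  intros Hn HB Hcop E.
  assert (H6 : n mod 2 = 0 \/ n mod 6 = 1 \/ n mod 6 = 3 \/ n mod 6 = 5) by (clear; lia).
  destruct H6 as [H6 | [H6 | [H6 | H6]]].
  - destruct (both_odd_base 7 A B n eq_refl Hn Hcop E) as [HA2 HB2].
    pose proof (sixth_pos B HB) as HB6.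
    assert (Hk : exists k, 0 < k /\ n = 2 * k) by (exists (n / 2); clear - Hn H6; lia).
    destruct Hk as (k & Hk & Hnk). assert (Hk0 : 0 <= k) by (clear - Hk; lia).
    rewrite (pow2_double n k Hk0 Hnk) in E.
    destruct (split_opposite_parity A (2 ^ k) (7 * B ^ 6)) as (x & y & Hx & Hy & Hxy & Hs & _ & Hp & _ & _).
    { pose proof (pow2_even k Hk) as K. clear - K HA2. lia. }
    { apply odd_rel_prime_pow2; assumption. } { apply pow2_pos. exact Hk0. } { clear - HB6. lia. } { exact E. }
    destruct (prime_coefficient_sixths 7 x y B prime_7 Hx Hy Hxy Hp) as (u & v & s & _ & Hu & Hv & Huv & Hsum & _).
    rewrite Hs, pow2_succ in Hsum by exact Hk0.
    assert (Huv' : rel_prime u v) by (apply (rel_prime_of_multiples 7 1 u v); rewrite Z.mul_1_l; exact Huv).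
    assert (K : k + 1 = 3).
    { apply (pow2_eq_7_1 u v); [clear - Hk; lia | intros ->; clear - Hu; simpl in Hu; lia | exact Huv' | exact Hsum]. }
    clear - K Hnk. lia.
  - pose proof (solutions_7_mod1 A B n Hn HB Hcop E H6). tauto.
  - pose proof (solutions_7_mod3 A B n Hn Hcop E H6). tauto.
  - pose proof (solutions_7_mod5 A B n Hn Hcop E H6). tauto.
Qed.

(** * Reduction to one prime *)

Lemma rel_prime_base (d A B c p : Z) :
  0 <= p -> A ^ 2 + d * B ^ 6 = c ^ p -> Z.gcd (Z.gcd A B) c = 1 -> rel_prime A B.
Proof.
  intros Hp E Hg. apply Zgcd_1_rel_prime in Hg.
  assert (K : rel_prime (Z.gcd A B) (c ^ p)) by (apply rel_prime_Zpower_r; assumption).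
  apply rel_prime_intro. intros e D1 D2. destruct K as [_ _ K]. apply K.
  - apply Z.gcd_greatest; assumption.
  - rewrite <- E. apply Z.divide_add_r.
    + replace (A ^ 2) with (A * A) by ring. apply Z.divide_mul_l. exact D1.
    + replace (d * B ^ 6) with (B * (d * B ^ 5)) by ring. apply Z.divide_mul_l. exact D2.
Qed.

Lemma sqr_mod8_odd (x : Z) : x mod 2 = 1 -> x ^ 2 mod 8 = 1.
Proof.
  intros Hx. rewrite <- Z.mod_pow_l.
  assert (K : x mod 8 = 1 \/ x mod 8 = 3 \/ x mod 8 = 5 \/ x mod 8 = 7) by lia.
  destruct_or K; rewrite K; reflexivity.
Qed.

(** Divisibility by 4 forces [B] odd, and [A] odd when [d] is odd; odd squares are 1 modulo 8. So
    for [d = 3, 11, 19] the value is 4 modulo 8, for [d = 7, 15] it is divisible by 8, and for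
    [d = 5, 13, 17] divisibility by 4 fails. *)
Lemma even_base_mod (d A B : Z) :
  rel_prime A B -> (4 | A ^ 2 + d * B ^ 6) -> d mod 4 <> 2 /\ (d mod 2 = 1 -> (A ^ 2 + d * B ^ 6) mod 8 = (1 + d) mod 8).
Proof.
  intros Hcop D4.
  assert (HA : A mod 2 = 0 \/ A mod 2 = 1) by (clear; lia).
  assert (HB : B mod 2 = 0 \/ B mod 2 = 1) by (clear; lia).
  assert (N : ~ (A mod 2 = 0 /\ B mod 2 = 0)).
  { intros [H1 H2]. apply Z.mod_divide in H1, H2; try discriminate. destruct Hcop as [_ _ G].
    specialize (G 2 H1 H2). destruct G as [w Hw]. clear - Hw. lia. }
  assert (H6 : B mod 2 = 1 -> B ^ 6 mod 8 = 1).
  { intros H. replace (B ^ 6) with ((B ^ 3) ^ 2) by ring. apply sqr_mod8_odd, pow_odd; [discriminate | exact H]. }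
  assert (E8 : B mod 2 = 1 -> eqmod 8 (A ^ 2 + d * B ^ 6) (A ^ 2 + d)).
  { intros H. assert (K : eqmod 8 (B ^ 6) 1) by (apply eqmod_iff; [discriminate | exact (H6 H)]).
    rewrite K, Z.mul_1_r. reflexivity. }
  assert (HB0 : B mod 2 = 0 -> False).
  { intros H. assert (HA1 : A mod 2 = 1) by tauto. apply sqr_mod8_odd in HA1.
    apply Z.mod_divide in H; [|discriminate]. destruct H as [b ->]. destruct D4 as [w Hw].
    replace (A ^ 2 + d * (b * 2) ^ 6) with (A ^ 2 + 64 * (d * b ^ 6)) in Hw by ring. clear - Hw HA1. lia. }
  destruct HB as [HB | HB]; [exfalso; exact (HB0 HB)|].
  pose proof (proj1 (eqmod_iff 8 _ _ ltac:(discriminate)) (E8 HB)) as E.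
  destruct D4 as [w Hw]. split.
  - intros Hd. pose proof (sqr_mod4 A) as K. rewrite Hw in E.
    assert (K' : A mod 2 = 0 -> A ^ 2 mod 4 = 0).
    { intros H. apply Z.mod_divide in H; [|discriminate]. destruct H as [a ->].
      replace ((a * 2) ^ 2) with (a ^ 2 * 4) by ring. apply Z.mod_mul. discriminate. }
    clear - E Hd K. lia.
  - intros Hd. rewrite E.
    assert (HA1 : A mod 2 = 1).
    { destruct HA as [HA | HA]; [exfalso | exact HA].
      apply Z.mod_divide in HA; [|discriminate]. destruct HA as [a ->].
      rewrite Hw in E. replace ((a * 2) ^ 2) with (a ^ 2 * 4) in E by ring. clear - E Hd. lia. }
    apply sqr_mod8_odd in HA1. clear - HA1. lia.
Qed.

(** Coprimality excludes 3 dividing [B], so [A^2 = - d] modulo 9. Among the given [d] this leaves 2,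
    5, 11, 14 and 17 for a base divisible by 3. *)
Lemma base_mod3 (d A B : Z) :
  rel_prime A B -> (9 | A ^ 2 + d * B ^ 6) -> d mod 3 = 1 \/ d mod 9 = 3 \/ d mod 9 = 6 -> False.
Proof.
  intros Hcop D9 Hd.
  assert (Hsq : forall x, x ^ 2 mod 3 = 1 \/ (3 | x)).
  { intros x. rewrite <- Z.mod_pow_l. assert (K : x mod 3 = 0 \/ x mod 3 = 1 \/ x mod 3 = 2) by (clear; lia).
    destruct_or K; rewrite ?K; [right; apply Z.mod_divide; [discriminate | exact K] | left; reflexivity | left; reflexivity]. }
  assert (HB : (3 | B) -> False).
  { intros [b ->]. assert (DA : (3 | A ^ 2)).
    { destruct D9 as [w Hw]. exists (3 * w - 243 * (d * b ^ 6)).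
      replace (A ^ 2) with (A ^ 2 + d * (b * 3) ^ 6 - 729 * (d * b ^ 6)) by ring. rewrite Hw. ring. }
    replace (A ^ 2) with (A * A) in DA by ring. apply prime_mult in DA; [|exact prime_3].
    destruct Hcop as [_ _ G]. specialize (G 3 ltac:(tauto) ltac:(exists b; ring)). destruct G as [w Hw]. clear - Hw. lia. }
  assert (HB9 : B ^ 6 mod 9 = 1).
  { destruct (sixth_mod9 B) as [K | K]; [exfalso | exact K]. apply HB.
    destruct (Hsq (B ^ 3)) as [K2 | K2].
    - replace ((B ^ 3) ^ 2) with (B ^ 6) in K2 by ring. clear - K K2. lia.
    - replace (B ^ 3) with (B * (B * B)) in K2 by ring.
      apply prime_mult in K2; [|exact prime_3]. destruct K2 as [K2 | K2]; [exact K2|].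
      apply prime_mult in K2; [tauto | exact prime_3]. }
  assert (E : eqmod 9 (A ^ 2 + d) 0).
  { assert (K : eqmod 9 (B ^ 6) 1) by (apply eqmod_iff; [discriminate | exact HB9]).
    transitivity (A ^ 2 + d * B ^ 6); [rewrite K, Z.mul_1_r; reflexivity | apply divide_eqmod_0; exact D9]. }
  destruct E as [w Hw].
  destruct (Hsq A) as [K | [a ->]].
  - clear - Hw K Hd. lia.
  - replace ((a * 3) ^ 2) with (9 * a ^ 2) in Hw by ring. clear - Hw Hd. lia.
Qed.

Lemma perfect_power_bounds (d p a b A B : Z) :
  d = 2 \/ d = 3 \/ d = 5 \/ d = 6 \/ d = 7 \/ d = 10 \/ d = 11 \/ d = 13 \/ d = 14 \/ d = 15 \/ d = 17 \/ d = 19 ->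
  prime p -> 0 <= a -> 0 <= b -> B <> 0 ->
  A ^ 2 + d * B ^ 6 = (2 ^ a * 3 ^ b) ^ p -> Z.gcd (Z.gcd A B) (2 ^ a * 3 ^ b) = 1 ->
  (d = 2 /\ p <= 3) \/ ((d = 3 \/ d = 5 \/ d = 17) /\ p <= 2) \/ (d = 7 /\ p <= 7) \/
  (d = 11 /\ p <= 5) \/ (d = 15 /\ p <= 3).
Proof.
  intros Hd Hp Ha Hb HB E Hg.
  assert (Hp2 : 2 <= p) by (destruct Hp as [K _]; clear - K; lia).
  assert (Hp0 : 0 <= p) by (clear - Hp2; lia).
  pose proof (rel_prime_base d A B _ p Hp0 E Hg) as Hcop.
  rewrite Z.pow_mul_l, <- !Z.pow_mul_r in E by assumption.
  assert (Hap : a = 0 \/ 2 <= a * p) by (clear - Ha Hp2; nia).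
  assert (Hbp : b = 0 \/ 2 <= b * p) by (clear - Hb Hp2; nia).
  pose proof (sixth_pos B HB) as HB6.
  assert (HA2 : 0 <= A ^ 2) by (clear; nia).
  (* The power is at least [d], which rules out the value 1 everywhere and the value 4 for
     [d = 19]. *)
  assert (Hbig : d < A ^ 2 + d * B ^ 6 + 1) by (clear - HB6 HA2 Hd; destruct_or Hd; subst d; lia).
  rewrite E in Hbig.
  assert (Ha' : a = 0 \/ ((d = 3 \/ d = 11 \/ d = 19) /\ p = 2 /\ a = 1) \/ (d = 7 \/ d = 15)).
  { destruct Hap as [Hap | Hap]; [left; exact Hap | right].
    assert (D4 : exists w, 2 ^ (a * p) = 4 * w /\ (w mod 2 = 1 -> a * p = 2)).
    { exists (2 ^ (a * p - 2)). split.
      - replace (a * p) with (2 + (a * p - 2)) at 1 by ring. rewrite Z.pow_add_r by (clear - Hap; lia). reflexivity.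
      - intros K. destruct (Z.eq_dec (a * p) 2) as [G | G]; [exact G | exfalso].
        rewrite pow2_even in K by (clear - Hap G; lia). discriminate. }
    destruct D4 as (w & Hw & Hw2). rewrite Hw in E.
    destruct (even_base_mod d A B Hcop) as [H4 H8]; [rewrite E; exists (w * 3 ^ (b * p)); ring|].
    rewrite E in H8. clear Hg HB6 HA2 Hbig Hcop.
    assert (H3 : 3 ^ (b * p) mod 2 = 1) by (apply pow3_odd; clear - Hb Hp0; nia).
    (* The exact power of 2 is 4 for these [d], so [a p = 2]; the bound on [p] then needs no further
       equation. *)
    assert (Hw' : (d = 3 \/ d = 11 \/ d = 19) -> p = 2 /\ a = 1).
    { intros Hd'. assert (Hap2 : a * p = 2).
      { apply Hw2. assert (Hw0 : w mod 2 = 0 \/ w mod 2 = 1) by (clear; lia).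
        destruct Hw0 as [Hw0 | Hw0]; [exfalso | exact Hw0].
        apply Z.mod_divide in Hw0; [|discriminate]. destruct Hw0 as [w' ->].
        replace (4 * (w' * 2) * 3 ^ (b * p)) with (w' * 3 ^ (b * p) * 8) in H8 by ring.
        rewrite Z.mod_mul in H8 by discriminate.
        destruct_or Hd'; subst d; specialize (H8 eq_refl); discriminate. }
      clear - Hap2 Hp2 Ha. assert (a <> 0) by (intros ->; discriminate). nia. }
    assert (H8' : d mod 2 = 1 -> ((1 + d) mod 8 = 0 \/ (1 + d) mod 8 = 4)).
    { intros G. rewrite <- (H8 G). clear. generalize (w * 3 ^ (b * p)). intros z.
      lia. }
    clear E H8 Hw Hw2.
    destruct_or Hd; subst d; try (exfalso; apply H4; reflexivity);
      try (exfalso; specialize (H8' eq_refl); destruct H8' as [G | G]; discriminate G);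
      try (right; tauto); left; split; try tauto; apply Hw'; tauto. }
  assert (Hb' : b = 0 \/ (d = 2 \/ d = 5 \/ d = 11 \/ d = 14 \/ d = 17)).
  { destruct Hbp as [Hbp | Hbp]; [left; exact Hbp | right].
    assert (D9 : (9 | A ^ 2 + d * B ^ 6)).
    { rewrite E. exists (2 ^ (a * p) * 3 ^ (b * p - 2)).
      assert (Hpow : 3 ^ (b * p) = 3 ^ (b * p - 2) * 9).
      { clear - Hbp. change 9 with (3 ^ 2). rewrite <- Z.pow_add_r by lia. f_equal. ring. }
      rewrite Hpow. ring. }
    pose proof (base_mod3 d A B Hcop D9) as K. clear - K Hd.
    destruct_or Hd; subst d; try tauto; exfalso; apply K; (left; reflexivity) || (right; left; reflexivity) || (right; right; reflexivity). }
  destruct Ha' as [-> | [(Hd' & -> & ->) | Hd']].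
  - destruct Hbp as [-> | Hbp].
    { exfalso. simpl in Hbig. clear - Hbig Hd. lia. }
    rewrite Z.mul_0_l, Z.mul_1_l in E. destruct Hb' as [-> | Hb']; [clear - Hbp; lia|].
    assert (Hn : 0 < b * p) by (clear - Hbp; lia).
    assert (Dp : (p | b * p)) by apply Z.divide_factor_r.
    destruct_or Hb'; subst d.
    + left. split; [reflexivity|]. destruct (Z.le_gt_cases p 3) as [G | G]; [exact G | exfalso].
      assert (Hp5 : 5 <= p).
      { destruct (Z.eq_dec p 4) as [-> | G4]; [|clear - G G4; lia].
        exfalso. destruct (prime_divisors 4 Hp 2 ltac:(exists 2; reflexivity)) as [K | [K | [K | K]]]; discriminate. }
      exact (no_prime_factor_2 p A B (b * p) Hp Hp5 Hn HB Hcop E Dp).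
    + right. left. split; [tauto|].
      destruct (solutions_5 A B (b * p) Hn HB Hcop E) as [K | K].
      * rewrite K in Dp. apply Z.divide_pos_le in Dp; [exact Dp | reflexivity].
      * rewrite K in Dp. apply (prime_mult p Hp 2 4) in Dp. destruct Dp as [Dp | Dp].
        -- apply Z.divide_pos_le in Dp; [exact Dp | reflexivity].
        -- apply (prime_mult p Hp 2 2) in Dp. destruct Dp as [Dp | Dp]; apply Z.divide_pos_le in Dp; (exact Dp || reflexivity).
    + right. right. right. left. split; [reflexivity|]. destruct (Z.le_gt_cases p 5) as [G | G]; [exact G | exfalso].
      exact (no_prime_factor_11 p A B (b * p) Hp ltac:(clear - G; lia) Hn HB Hcop E Dp).
    + exfalso. exact (no_solution_14 A B (b * p) Hn HB Hcop E).
    + right. left. split; [tauto|].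
      rewrite (solutions_17 A B (b * p) Hn HB Hcop E) in Dp.
      apply (prime_mult p Hp 2 2) in Dp. destruct Dp as [Dp | Dp]; apply Z.divide_pos_le in Dp; (exact Dp || reflexivity).
  - destruct_or Hd'; subst d.
    + right. left. split; [tauto | discriminate].
    + right. right. right. left. split; [reflexivity | discriminate].
    + exfalso. destruct Hb' as [-> | Hb']; [|clear - Hb'; lia]. simpl in Hbig. clear - Hbig. lia.
  - destruct Hb' as [-> | Hb']; [|clear - Hd' Hb'; lia].
    rewrite Z.mul_0_l, Z.mul_1_r in E, Hbig.
    destruct Hap as [-> | Hap]; [exfalso; simpl in Hbig; clear - Hbig Hd'; lia|].
    assert (Hn : 0 < a * p) by (clear - Hap; lia).
    assert (Dp : (p | a * p)) by apply Z.divide_factor_r.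
    destruct Hd' as [-> | ->].
    + right. right. left. split; [reflexivity|].
      destruct (solutions_7 A B (a * p) Hn HB Hcop E) as [K | [K | [K | [K | K]]]]; rewrite K in Dp;
        try (apply Z.divide_pos_le in Dp; [clear - Dp; lia | reflexivity]).
      apply (prime_mult p Hp 3 5) in Dp. destruct Dp as [Dp | Dp]; apply Z.divide_pos_le in Dp; (reflexivity || (clear - Dp; lia)).
    + right. right. right. right. split; [reflexivity|].
      destruct (solutions_15 A B (a * p) Hn HB Hcop E) as [K | K]; rewrite K in Dp.
      * apply (prime_mult p Hp 2 2) in Dp. destruct Dp as [Dp | Dp]; apply Z.divide_pos_le in Dp; (reflexivity || (clear - Dp; lia)).
      * apply (prime_mult p Hp 2 3) in Dp. destruct Dp as [Dp | Dp]; apply Z.divide_pos_le in Dp; (reflexivity || (clear - Dp; lia)).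
Qed.

(** * Transfer to the integers of MathComp *)

(* MathComp takes the key [Z] for the scope of [int]. *)
Delimit Scope Z_scope with coqZ.
From mathcomp Require Import all_boot all_order all_algebra.
From mathcomp Require Import ssrZ.
Import GRing.Theory.
Local Open Scope ring_scope.

Lemma Z_exprE (x : Z) (n : nat) : x ^+ n = Z.pow x (Z.of_nat n).
Proof.
elim: n => [//|n IHn]; rewrite exprS IHn Nat2Z.inj_succ Z.pow_succ_r //.
exact: Nat2Z.is_nonneg.
Qed.

Lemma Z_of_int_dvd (x : Z) (m : int) : Z.divide x (Z_of_int m) -> (int_of_Z x %| m)%Z.
Proof.
case=> w hw; apply/dvdzP; exists (int_of_Z w).
by apply: (can_inj Z_of_intK); rewrite rmorphM /= !int_of_ZK.
Qed.

(** The gcd in [Z] is carried back to [int], where it divides a gcd equal to 1; being nonnegative,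
    it is 1. *)
Lemma Z_of_int_gcd (A B C : int) :
  gcdz (gcdz A B) C = 1 ->
  Z.gcd (Z.gcd (Z_of_int A) (Z_of_int B)) (Z_of_int C) = Zpos xH.
Proof.
move=> h; set g := Z.gcd _ _.
have gC : Z.divide g (Z_of_int C) by exact: Z.gcd_divide_r.
have gAB : Z.divide g (Z.gcd (Z_of_int A) (Z_of_int B)) by exact: Z.gcd_divide_l.
have gA := Z.divide_trans _ _ _ gAB (Z.gcd_divide_l _ _).
have gB := Z.divide_trans _ _ _ gAB (Z.gcd_divide_r _ _).
have : (int_of_Z g %| gcdz (gcdz A B) C)%Z by rewrite !dvdz_gcd !Z_of_int_dvd.
rewrite h => /dvdzP[w hw].
apply: Z.divide_1_r_nonneg; first exact: Z.gcd_nonneg.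
exists (Z_of_int w); have := congr1 Z_of_int hw.
by rewrite rmorph1 rmorphM /= int_of_ZK.
Qed.

Lemma Z_of_nat_prime (p : nat) : prime p -> Znumtheory.prime (Z.of_nat p).
Proof.
move=> /primeP[p1 hp]; apply/prime_alt; split; first by apply/(Nat2Z.inj_lt 1)/ltP.
move=> n [n1 np] [w hw].
have n0 : Z.le Z0 n by lia.
have w0 : Z.le Z0 w by nia.
have /hp/orP[/eqP e|/eqP e] : (Z.to_nat n %| p)%N.
- apply/dvdnP; exists (Z.to_nat w); apply: Nat2Z.inj.
  by rewrite Nat2Z.inj_mul !Z2Nat.id.
- lia.
- lia.
Qed.

Theorem theorem2p2 (d p a b : nat) (A B : int)
  (hd : d \in [:: 2; 3; 5; 6; 7; 10; 11; 13; 14; 15; 17; 19]%N)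
  (hp : prime p)
  (hAB : A * B != 0)
  (heq : A ^+ 2 + d%:Z * B ^+ 6 = ((2 ^+ a * 3 ^+ b) ^+ p : int))
  (hgcd : gcdz (gcdz A B) (2 ^+ a * 3 ^+ b) = 1) :
  (d = 2%N -> (p <= 3)%N) /\
  (d \in [:: 3; 5; 17]%N -> (p <= 2)%N) /\
  (d = 7%N -> (p <= 7)%N) /\
  (d = 11%N -> (p <= 5)%N) /\
  (d = 15%N -> (p <= 3)%N) /\
  (d \in [:: 6; 10; 13; 14; 19]%N -> False).
Proof.
have dZ : let D := Z.of_nat d in (D = 2 \/ D = 3 \/ D = 5 \/ D = 6 \/ D = 7 \/ D = 10 \/
    D = 11 \/ D = 13 \/ D = 14 \/ D = 15 \/ D = 17 \/ D = 19)%coqZ.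
  by move: hd; rewrite !inE => hd /=; do !(case/orP: hd => [/eqP -> | hd]); last move/eqP: hd => ->;
    tauto.
have BZ : Z_of_int B <> Z0.
  move=> hB; move: hAB; rewrite mulf_eq0 negb_or => /andP[_ /eqP]; apply.
  by apply: (can_inj Z_of_intK).
have base : Z_of_int (2 ^+ a * 3 ^+ b) = (2 ^ Z.of_nat a * 3 ^ Z.of_nat b)%coqZ.
  by rewrite rmorphM !rmorphXn /= -!Z_exprE.
have eqZ : (Z_of_int A ^ 2 + Z.of_nat d * Z_of_int B ^ 6 =
    (2 ^ Z.of_nat a * 3 ^ Z.of_nat b) ^ Z.of_nat p)%coqZ.
  rewrite -base -Z_exprE -rmorphXn -heq rmorphD rmorphM !rmorphXn /=.
  by rewrite !Z_exprE.
have gcdZ := Z_of_int_gcd _ _ _ hgcd; rewrite base in gcdZ.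
have := perfect_power_bounds _ _ _ _ _ _ dZ (Z_of_nat_prime _ hp)
  (Nat2Z.is_nonneg a) (Nat2Z.is_nonneg b) BZ eqZ gcdZ.
move=> {dZ hd hp hAB heq hgcd BZ base eqZ gcdZ} H.
rewrite !inE; do !split; move=> h; first [apply/leP | idtac]; lia.
Qed.
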